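(* Let $(\mathbf{F},\mathbf{C})$ be a decorated contracted forest with root set $\{\rho,\bar\rho\}$ such that no contracting edge is incident to $\rho$ or $\bar\rho$. Suppose: (a) for every non-Dirac vertex $v\in V^*$, $z_v:=-\max\{a_e/4:e\in\mathfrak{C}(V_{F_v})\cap\mathfrak{C}(V\setminus V_{F_v})\}-|k_{\hat v,v}|/2+\gamma_{\hat v,v}>-1$; (b) for every $v\in I^*$, $\Lambda(F_v)+\min\{a_e/4:e\in\mathfrak{C}(V_{F_v})\cap\mathfrak{C}(V\setminus V_{F_v})\}>-1$; (c) $a_e\in(0,n)$ for all $e\in\mathfrak{C}$. Then for any $0\le\theta\le\max\{a_e:e\in\mathfrak{C}(L_{F_\rho})\cap\mathfrak{C}(L_{F_{\bar\rho}})\}$, $$\mathcal{I}^{\mathbf{F},\mathbf{C}}(t,\bar t,x-\bar x)\lesssim t^{\Lambda(F_\rho)+\theta/4}\,\bar t^{\Lambda(F_{\bar\rho})+\theta/4}|x-\bar x|^{-\theta}.$$ Suppose further that $U\subset W\subset C_\rho\cup C_{\bar\rho}$ with $|U\cap C_\rho|\le1$, $|U\cap C_{\bar\rho}|\le1$, and $0<s\le t\le2s$. Let $\kappa,\bar\kappa\in[0,1]$ be such that $\kappa<1+z_\ell$ if $U\cap C_\rho=\{\ell\}$ with $\ell$ non-Dirac, and $\bar\kappa<1+z_{\bar\ell}$ if $U\cap C_{\bar\rho}=\{\bar\ell\}$ with $\bar\ell$ non-Dirac, and set $\zeta=\kappa\mathbf{1}_{|U\cap C_\rho|=1}+\bar\kappa\mathbf{1}_{|U\cap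 C_{\bar\rho}|=1}$. Then $$\mathcal{K}^{\mathbf{F},\mathbf{C}}_{W;U}(t,x-\bar x;s)\lesssim|t-s|^{\zeta}t^{\Lambda(F_\rho)+\Lambda(F_{\bar\rho})+\theta/2-\zeta}|x-\bar x|^{-\theta}.$$
   Context: Forest: $\mathfrak{F}$ consists of two finite rooted trees with roots $\rho,\bar\rho$; $V,E$ its vertices/edges. A leaf is a non-root vertex of degree 1 or a root of degree 0; $L$ the leaves, $I=V\setminus L$, $V^*=V\setminus\{\rho,\bar\rho\}$, $L^*=L\setminus\{\rho,\bar\rho\}$, $I^*=I\setminus\{\rho,\bar\rho\}$. Every $v\in V^*$ has a parent $\hat v$ (its neighbour on the path to the root); $C_u$ is the set of children of $u$. For $v\in V$, the branch $F_v$ is the subtree consisting of $v$ and all its descendants, with root $v$; $V_{F_v},L_{F_v},E_{F_v}$ its vertices, leaves, edges. A contraction $\mathfrak{C}$ is a set of unordered pairs $\{u,v\}$ of distinct leaves such that each leaf lies in at most one pair (''contracting edges''); for $O\subset V$, $\mathfrak{C}(O)$ is the set of $e\in\mathfrak{C}$ incident to some element of $O$. Conventions: $\max\emptyset=\min\emptyset=0$. Decoration: reals $\beta_v$ ($v\in V$) with $\beta_v\ge-1$ for $v\in L^*$; for each edge $e$ a real $\gamma_e$ and multi-index $k_e\in\mathbb{N}_0^n$; for each $e\in\mathfrak{C}$ a real $a_e$. A vertex $v\in L^*$ with $\beta_v=-1$ is Dirac; $g_v=\delta_0$ (integration sets $t_v=0$) if $v$ is Dirac, else $g_v(t)=t^{\beta_v}\mathbf{1}_{t>0}$.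 $G_t(x)=\sum_{m\in\mathbb{Z}^n}(4\pi t)^{-n/2}e^{-|x+m|^2/(4t)}$ for $t>0$ is the heat kernel on $\mathbb{T}^n$, $G^{(k)}$ its $k$-th spatial derivative; factors $(r)^{\gamma}G^{(k)}_r$ with $r\le0$ are taken to be $0$. $D=(0,1)\times\mathbb{T}^n$. With $(t_\rho,x_\rho)=(t,x)$, $(t_{\bar\rho},x_{\bar\rho})=(\bar t,\bar x)\in D$: $\mathcal{I}^{\mathbf{F},\mathbf{C}}(t,\bar t,x-\bar x)=\int_{D^{V^*}}\prod_{\{u,v\}\in\mathfrak{C}}|x_u-x_v|^{-a_{u,v}}\prod_{w\in V}g_w(t_w)\prod_{w\in V^*}\big|(t_{\hat w}-t_w)^{\gamma_{\hat w,w}}G^{(k_{\hat w,w})}_{t_{\hat w}-t_w}(x_{\hat w}-x_w)\big|\,dx_wdt_w$. For $\bar t=t$, $s\in(0,1)$ and $U,W$ as in the claim, $\mathcal{K}^{\mathbf{F},\mathbf{C}}_{W;U}(t,x-\bar x;s)=\int_{D^{V^*}}\big|\prod_{w\in V}g_w(t_w)\prod_{\{u,v\}\in\mathfrak{C}}|x_u-x_v|^{-a_{u,v}}\prod_{u\in V^*\setminus W}(t_{\hat u}-t_u)^{\gamma_{\hat u,u}}G^{(k_{\hat u,u})}_{t_{\hat u}-t_u}(x_{\hat u}-x_u)\prod_{v\in W\setminus U}(s-t_v)^{\gamma_{\hat v,v}}G^{(k_{\hat v,v})}_{s-t_v}(x_{\hat v}-x_v)\prod_{w\in U}\{(t-t_w)^{\gamma_{\hat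 w,w}}G^{(k_{\hat w,w})}_{t-t_w}(x_{\hat w}-x_w)-(s-t_w)^{\gamma_{\hat w,w}}G^{(k_{\hat w,w})}_{s-t_w}(x_{\hat w}-x_w)\}\big|\prod_{w\in V^*}dx_wdt_w$. For a branch $\sigma$: $\Lambda(\sigma)=|E_\sigma|+\sum_{e\in E_\sigma}(\gamma_e-|k_e|/2)+\sum_{u\in V_\sigma}\beta_u-\frac14\sum_{\ell\in L_\sigma}b_\ell$, where $b_\ell=a_e$ if $\ell$ is in the contracting edge $e$ and $b_\ell=0$ otherwise. $\lesssim$ means up to a constant independent of $t,\bar t,s\in(0,1)$ and $x\ne\bar x$. *)

(* Defs.v *)
From HB Require Import structures.
From mathcomp Require Import all_boot all_order all_algebra.
From mathcomp Require Import all_classical all_reals all_analysis.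
Import Order.TTheory GRing.Theory Num.Theory.
Import numFieldNormedType.Exports.

Set Implicit Arguments.
Unset Strict Implicit.
Unset Printing Implicit Defensive.

Local Open Scope classical_set_scope.
Local Open Scope ring_scope.

Section Forest.
Context {V : finType}.

Definition is_root (rho rhob v : V) : bool := (v == rho) || (v == rhob).

(* par is the parent map; the roots are the fixed points rho, rhob and
   every vertex reaches one of the roots by iterating par (no cycles). *)
Definition is_forest (par : V -> V) (rho rhob : V) : Prop :=
  [/\ rho != rhob, par rho = rho, par rhob = rhob &
      forall v, exists k, is_root rho rhob (iter k par v)].

Definition Vstar (rho rhob : V) : {set V} := [set v | ~~ is_root rho rhob v].

Definition children (par : V -> V) (rho rhob u : V) : {set V} :=
  [set v | ~~ is_root rho rhob v & par v == u].

(* leaf: non-root of degree 1 or root of degree 0, i.e. no children *)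
Definition leaves (par : V -> V) (rho rhob : V) : {set V} :=
  [set v | #|children par rho rhob v| == 0%N].

Definition Lstar par rho rhob : {set V} := leaves par rho rhob :\: [set rho; rhob].
Definition Istar par rho rhob : {set V} := ~: leaves par rho rhob :\: [set rho; rhob].

Definition branch (par : V -> V) (v : V) : {set V} :=
  [set w | [exists k : 'I_#|V|.+1, iter k par w == v]].

(* E_{F_v}: edges {par w, w} of F_v, indexed by the child w *)
Definition branch_edges (par : V -> V) (v : V) : {set V} :=
  branch par v :\ v.

Definition branch_leaves par rho rhob v : {set V} :=
  branch par v :&: leaves par rho rhob.

Definition is_contr par rho rhob (C : {set {set V}}) : Prop :=
  forall e, e \in C ->
    [/\ #|e| = 2, e \subset leaves par rho rhob &
        forall e', e' \in C -> e != e' -> #|e :&: e'| == 0%N].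

Definition Cof (C : {set {set V}}) (O : {set V}) : {set {set V}} :=
  [set e in C | #|e :&: O| != 0%N].

Definition Ccross (C : {set {set V}}) (O : {set V}) : {set {set V}} :=
  Cof C O :&: Cof C (~: O).

End Forest.

Section Reals.
Context {R : realType} {V : finType}.

(* max / min over a finite set, with max \emptyset = min \emptyset = 0 *)
Definition setmax (T : finType) (S : {set T}) (f : T -> R) : R :=
  match [pick e in S] with
  | None => 0
  | Some e0 => \big[Num.max/f e0]_(e in S) f e
  end.
Definition setmin (T : finType) (S : {set T}) (f : T -> R) : R :=
  match [pick e in S] with
  | None => 0
  | Some e0 => \big[Num.min/f e0]_(e in S) f e
  end.

Definition ksize (n : nat) (k : 'I_n -> nat) : nat := \sum_(i < n) k i.

Definition bcoef (C : {set {set V}}) (a : {set V} -> R) (l : V) : R :=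
  match [pick e in C | l \in e] with
  | Some e => a e
  | None => 0
  end.

Definition Lambda (n : nat) (par : V -> V) (rho rhob : V)
    (beta gam : V -> R) (k : V -> 'I_n -> nat)
    (C : {set {set V}}) (a : {set V} -> R) (v : V) : R :=
  (#|branch_edges par v|)%:R
  + \sum_(w in branch_edges par v) (gam w - (ksize (k w))%:R / 2)
  + \sum_(u in branch par v) beta u
  - 4^-1 * \sum_(l in branch_leaves par rho rhob v) bcoef C a l.

Definition isDirac par rho rhob (beta : V -> R) (v : V) : bool :=
  (v \in Lstar par rho rhob) && (beta v == -1).

Definition zval (n : nat) (par : V -> V) (gam : V -> R) (k : V -> 'I_n -> nat)
    (C : {set {set V}}) (a : {set V} -> R) (v : V) : R :=
  - setmax (Ccross C (branch par v)) (fun e => a e / 4)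
  - (ksize (k v))%:R / 2 + gam v.

End Reals.

(* points are represented by row vectors 'rV[R]_n                      *)
Section Heat.
Context {R : realType} {n : nat}.

Definition sqnorm (y : 'rV[R]_n) : R := \sum_(i < n) (y ord0 i) ^+ 2.

Definition distZ (r : R) : R :=
  Num.min (r - (Num.floor r)%:~R) ((Num.floor r)%:~R + 1 - r).

(* |y| for y in T^n: Euclidean distance from y to the lattice Z^n *)
Definition tnorm (y : 'rV[R]_n) : R :=
  Num.sqrt (\sum_(i < n) (distZ (y ord0 i)) ^+ 2).

Definition gauss (t : R) (y : 'rV[R]_n) : R :=
  powR (4 * pi * t) (- (n%:R / 2)) * expR (- sqnorm y / (4 * t)).

Definition heatG (t : R) (x : 'rV[R]_n) : R :=
  fine (\esum_(m in [set: 'rV[int]_n]) (gauss t (x + map_mx intr m))%:E).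

Definition pderiv (i : 'I_n) (f : 'rV[R]_n -> R) : 'rV[R]_n -> R :=
  fun x => derive1 (fun h : R => f (x + h *: delta_mx ord0 i)) 0.

Definition kderiv (k : 'I_n -> nat) (f : 'rV[R]_n -> R) : 'rV[R]_n -> R :=
  foldr (fun i g => iter (k i) (pderiv i) g) f (enum 'I_n).

Definition kfac (gam : R) (k : 'I_n -> nat) (r : R) (y : 'rV[R]_n) : R :=
  if 0 < r then powR r gam * kderiv k (heatG r) y else 0.

(* x in the fundamental cube [0,1)^n (representatives of T^n) *)
Definition in_cube (x : 'rV[R]_n) : Prop := forall i, 0 <= x ord0 i < 1.

End Heat.

Section Integrals.
Context {R : realType}.
Local Open Scope ereal_scope.

Definition leb := (@lebesgue_measure R).

Definition tint (dirac : bool) (f : R -> \bar R) : \bar R :=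
  if dirac then f 0%R
  else \int[leb]_(s in `]0%R, 1%R[) f s.

Fixpoint cint (m : nat) (f : (nat -> R) -> \bar R) : \bar R :=
  match m with
  | 0 => f (fun _ => 0%R)
  | m'.+1 => \int[leb]_(y in `[0%R, 1%R[)
               cint m' (fun z => f (fun i => if i is j.+1 then z j else y))
  end.

Definition xint (n : nat) (f : 'rV[R]_n -> \bar R) : \bar R :=
  cint n (fun z => f (\row_(i < n) z i)).

Definition upd (V : eqType) (T : Type) (f : V -> T) (w : V) (y : T) : V -> T :=
  fun v => if v == w then y else f v.

Fixpoint vint (n : nat) (V : eqType) (vs : seq V) (isD : V -> bool)
    (F : (V -> R) -> (V -> 'rV[R]_n) -> \bar R)
    (tt : V -> R) (xx : V -> 'rV[R]_n) : \bar R :=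
  match vs with
  | [::] => F tt xx
  | w :: ws => tint (isD w) (fun tw => xint (fun xw =>
                  vint ws isD F (upd tt w tw) (upd xx w xw)))
  end.

End Integrals.

Section Main.
Context {R : realType} {n : nat} {V : finType}.
Variables (par : V -> V) (rho rhob : V) (beta gam : V -> R)
  (k : V -> 'I_n -> nat) (C : {set {set V}}) (a : {set V} -> R).

Definition gfac (v : V) (t : R) : R :=
  if isDirac par rho rhob beta v then 1
  else if (0 < t)%R then powR t (beta v) else 0.

Definition cfac (xx : V -> 'rV[R]_n) (e : {set V}) : R :=
  match enum e with
  | [:: u; v] => powR (tnorm (xx u - xx v)) (- a e)
  | _ => 1
  end.

Definition Iintegrand (tt : V -> R) (xx : V -> 'rV[R]_n) : R :=
  (\prod_(w : V) gfac w (tt w)) * (\prod_(e in C) cfac xx e)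
  * \prod_(w in Vstar rho rhob)
      `| kfac (gam w) (k w) (tt (par w) - tt w) (xx (par w) - xx w) |.

Definition Kintegrand (t s : R) (W U : {set V})
    (tt : V -> R) (xx : V -> 'rV[R]_n) : R :=
  `| (\prod_(w : V) gfac w (tt w)) * (\prod_(e in C) cfac xx e)
     * (\prod_(u in Vstar rho rhob :\: W)
          kfac (gam u) (k u) (tt (par u) - tt u) (xx (par u) - xx u))
     * (\prod_(v in W :\: U)
          kfac (gam v) (k v) (s - tt v) (xx (par v) - xx v))
     * (\prod_(w in U)
          (kfac (gam w) (k w) (t - tt w) (xx (par w) - xx w)
           - kfac (gam w) (k w) (s - tt w) (xx (par w) - xx w))) |.

Definition init (T : Type) (d p q : T) : V -> T :=
  upd (upd (fun _ => d) rho p) rhob q.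

Definition Ival (t tb : R) (x xb : 'rV[R]_n) : \bar R :=
  vint (enum (Vstar rho rhob)) (isDirac par rho rhob beta)
    (fun tt xx => (Iintegrand tt xx)%:E)
    (init 0 t tb) (init 0 x xb).

Definition Kval (W U : {set V}) (t : R) (x xb : 'rV[R]_n) (s : R) : \bar R :=
  vint (enum (Vstar rho rhob)) (isDirac par rho rhob beta)
    (fun tt xx => (Kintegrand t s W U tt xx)%:E)
    (init 0 t t) (init 0 x xb).

End Main.

(* Main.v *)
(** Write x_w = x_(parent w) + y_w and let r_w be the time elapsed along the
    edge above w. Each kernel factor is at most a constant times
    r_w^(gamma - |k|/2) Q(y_w), where Q is a periodic bump of mass O(1) at scale
    sqrt r_w. For fixed times the singularities |x_u - x_v|^-a are integrated out
    one by one. List the contracting edges, starting with an edge e0 of maximal a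
    joining the two trees, and let each branch belong to the first listed edge
    that leaves it. On either side an edge has an outermost branch of its own;
    integrating y at the root of the one with the larger elapsed time r costs
    r^(-a/2) <= (r r')^(-a/4) and does not move the edges listed earlier. For e0
    only a - theta is paid, which leaves |x - xb|^-theta. The remaining time
    integrals are Beta integrals, evaluated from the leaves to the roots: (a)
    and (b) are integrability at their two endpoints. For the second estimate,
    a difference of kernels is at most |t - s|^kappa times the sum of the two
    majorants with exponents lowered by kappa, and the product is expanded. *)

(* Which of the two pivots of an edge e is integrated depends on the times, whereas the cost
   charged, a quarter of a_e to each of the two, does not. This is why the geometric mean is taken:
   what remains is a product of powers of times along the trees, with fixed exponents.

   A pivot belongs to one edge and one side only, so the exponent at a vertex is lowered by at most
   one a_e/4, of an edge leaving its branch: hence the maximum in (a). If some contracting edge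
   leaves F_v, the first such edge charges nothing strictly inside F_v, because its outermost branch
   is F_v or contains it. Lambda(F_v) subtracts a quarter of b at every leaf, so at least the
   minimum in (b) is saved.

   The edge e0 heads the list so that its singularity involves no pivot of another edge and survives
   until those are integrated.

   Since the scales are functions of the times, measurability is needed jointly in all coordinates,
   and the integrals are reordered many times; working with iterated integrals of functions of one
   family of reals keeps both manageable. *)
Require Import Defs.
From HB Require Import structures.
From mathcomp Require Import all_boot all_order all_algebra.
From mathcomp Require Import all_classical all_reals all_analysis.
From mathcomp Require Import measurable_realfun zify ring lra.
Import Order.TTheory GRing.Theory Num.Theory.
Import numFieldNormedType.Exports.
Local Open Scope classical_set_scope.
Local Open Scope ring_scope.
Set Implicit Arguments.
Unset Strict Implicit.
Unset Printing Implicit Defensive.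

(** * Iterated integrals without a product sigma-algebra *)

Section Iterated.
Context {R : realType} {I : eqType}.
Implicit Types (c : I -> R) (F G : (I -> R) -> \bar R).
Local Notation mu := (@lebesgue_measure R).
Local Notation D := `[0%R, 1%R[%classic.

(* Measurability of a function of a family of reals, tested along all
   measurable families: no sigma-algebra on the family space is needed. *)
Definition fmeas d' (Y : sigmaRingType d') (F : (I -> R) -> Y) :=
  forall d (T : measurableType d) (g : T -> I -> R),
    (forall i, measurable_fun setT (fun t => g t i)) ->
    measurable_fun setT (fun t => F (g t)).

Definition Op i F c : \bar R := (\int[mu]_(y in D) F (upd c i y))%E.

Fixpoint It (s : seq I) F : (I -> R) -> \bar R :=
  if s is i :: s' then Op i (It s' F) else F.

Lemma fmeas_cst d' (Y : sigmaRingType d') (y : Y) : fmeas (fun=> y).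
Proof. by move=> d T g mg; exact: measurable_cst. Qed.

Lemma fmeas_coord i : fmeas (fun c => c i : R).
Proof. by move=> d T g mg; exact: mg. Qed.

Lemma fmeas_comp d1 d2 (Y : sigmaRingType d1) (Z : sigmaRingType d2)
    (f : Y -> Z) (F : (I -> R) -> Y) :
  measurable (setT : set Y) ->
  measurable_fun setT f -> fmeas F -> fmeas (fun c => f (F c)).
Proof.
move=> mT mf mF d T g mg; apply: (@measurable_comp _ _ _ _ _ _ setT f setT) => //.
exact: mF.
Qed.

Lemma fmeasM F G : fmeas F -> fmeas G -> fmeas (fun c => F c * G c)%E.
Proof. by move=> mF mG d T g mg; apply: emeasurable_funM; [exact: mF|exact: mG]. Qed.

Lemma fmeas_prod (J : Type) (s : seq J) (P : pred J) (F : J -> (I -> R) -> \bar R) :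
  (forall j, fmeas (F j)) -> fmeas (fun c => \prod_(j <- s | P j) F j c)%E.
Proof.
move=> mF; elim: s => [|j s IH].
  by rewrite [fun _ => _](_ : _ = fun=> 1%E) => [|]; [exact: fmeas_cst|
     apply/funext => c; rewrite big_nil].
have [Pj|Pj] := boolP (P j); last first.
  rewrite [fun _ => _](_ : _ = fun c => (\prod_(j <- s | P j) F j c)%E) //.
  by apply/funext => c; rewrite big_cons (negbTE Pj).
rewrite [fun _ => _](_ : _ = fun c => (F j c * \prod_(j <- s | P j) F j c)%E).
  exact: fmeasM.
by apply/funext => c; rewrite big_cons Pj.
Qed.

Lemma fmeas_EFin (f : (I -> R) -> R) : fmeas f -> fmeas (fun c => (f c)%:E).
Proof. by move=> mf d T g mg; apply/measurable_EFinP; exact: mf. Qed.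

Lemma fmeasD_real (f g : (I -> R) -> R) : fmeas f -> fmeas g -> fmeas (fun c => f c + g c).
Proof. by move=> mF mG d T h mh; apply: measurable_funD; [exact: mF|exact: mG]. Qed.

Lemma fmeasB_real (f g : (I -> R) -> R) : fmeas f -> fmeas g -> fmeas (fun c => f c - g c).
Proof. by move=> mF mG d T h mh; apply: measurable_funB; [exact: mF|exact: mG]. Qed.

Lemma fmeasM_real (f g : (I -> R) -> R) : fmeas f -> fmeas g -> fmeas (fun c => f c * g c).
Proof. by move=> mF mG d T h mh; apply: measurable_funM; [exact: mF|exact: mG]. Qed.

Lemma fmeas_sum_real (J : Type) (s : seq J) (F : J -> (I -> R) -> R) :
  (forall j, fmeas (F j)) -> fmeas (fun c => \sum_(j <- s) F j c).
Proof. by move=> mF d T g mg; apply: measurable_sum => j; exact: mF. Qed.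

Lemma fmeas_upd d' (Y : sigmaRingType d') (F : (I -> R) -> Y) i (f : (I -> R) -> R) :
  fmeas F -> fmeas f -> fmeas (fun c => F (upd c i (f c))).
Proof.
move=> mF mf d T g mg; apply: (mF d T (fun t => upd (g t) i (f (g t)))) => j.
rewrite /upd; case: (j == i); last exact: mg.
exact: mf.
Qed.

Lemma fmeas_updy F i c : fmeas F -> measurable_fun setT (fun y => F (upd c i y)).
Proof.
move=> mF; apply: (mF _ _ (fun y => upd c i y)) => j.
rewrite /upd; case: (j == i); [exact: measurable_id|exact: measurable_cst].
Qed.

Lemma fmeas_updyD F i c (A : set R) : fmeas F -> measurable_fun A (fun y => F (upd c i y)).
Proof. by move=> mF; apply: (measurable_funS measurableT) => //; exact: fmeas_updy. Qed.

Lemma OpE i F c : (Op i F c = \int[mu]_y ((\1_D y)%:E * F (upd c i y)))%E.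
Proof.
rewrite /Op integral_mkcond; apply: eq_integral => y _.
by rewrite patchE indicE; case: ifP => _; rewrite ?mul1e ?mul0e.
Qed.

Lemma Op_ge0 i F : (forall c, 0 <= F c)%E -> forall c, (0 <= Op i F c)%E.
Proof. by move=> F0 c; apply: integral_ge0. Qed.

(** Closure under integration is the reason for testing along families indexed by an arbitrary
    measurable space: adjoining the integration variable to [T] gives such a family again, and
    Tonelli's theorem on the product applies. *)
Lemma fmeas_Op i F : (forall c, 0 <= F c)%E -> fmeas F -> fmeas (Op i F).
Proof.
move=> F0 mF d T g mg.
pose f (z : T * measurableTypeR R) : \bar R := ((\1_D z.2)%:E * F (upd (g z.1) i z.2))%E.
rewrite (_ : (fun _ => _) = fubini_F (mu : {sigma_finite_measure set (measurableTypeR R) -> \bar R}) f); last first.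
  by apply/funext => t; rewrite OpE.
apply: measurable_fun_fubini_tonelli_F.
  apply: emeasurable_funM.
    apply/measurable_EFinP.
    have mI : measurable_fun setT (\1_D : measurableTypeR R -> R).
      exact: measurable_indic (measurable_itv _).
    exact: (measurableT_comp mI measurable_snd).
  apply: (mF _ _ (fun z : T * measurableTypeR R => upd (g z.1) i z.2)) => j.
  rewrite /upd; case: (j == i); first exact: measurable_snd.
  exact: (measurableT_comp (mg j) measurable_fst).
by move=> z; rewrite mule_ge0// lee_fin.
Qed.

Lemma upd_swap c i j x y : i != j -> upd (upd c i x) j y = upd (upd c j y) i x.
Proof.
move=> ij; apply/funext => l; rewrite /upd; case: (eqVneq l j) => [->|//].
by rewrite eq_sym (negbTE ij).
Qed.

Lemma upd_upd c i x y : upd (upd c i x) i y = upd c i y.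
Proof. by apply/funext => l; rewrite /upd; case: (l == i). Qed.

Lemma Op_swap i j F : (forall c, 0 <= F c)%E -> fmeas F ->
  Op i (Op j F) = Op j (Op i F).
Proof.
move=> F0 mF; have [->//|ij] := eqVneq i j.
apply/funext => c.
pose f (z : measurableTypeR R * measurableTypeR R) : \bar R :=
  ((\1_D z.1)%:E * ((\1_D z.2)%:E * F (upd (upd c i z.1) j z.2)))%E.
have mI : measurable_fun setT (\1_D : measurableTypeR R -> R).
  exact: measurable_indic (measurable_itv _).
have := @fubini_tonelli _ _ (measurableTypeR R) (measurableTypeR R) R mu mu f.
have mupd k l (x : R) : measurable_fun setT (fun t : measurableTypeR R => (\1_D t)%:E * F (upd (upd c k x) l t))%E.
  apply: emeasurable_funM; last exact: (fmeas_updy _ _ mF).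
  exact/measurable_EFinP.
have -> : Op i (Op j F) c = (\int[mu]_x \int[mu]_y f (x, y))%E.
  rewrite OpE; apply: eq_integral => x _.
  rewrite OpE -ge0_integralZl//.
  by move=> y _; rewrite mule_ge0// lee_fin.
have -> : Op j (Op i F) c = (\int[mu]_y \int[mu]_x f (x, y))%E.
  rewrite OpE; apply: eq_integral => y _.
  rewrite OpE -ge0_integralZl//; last first.
    by move=> x _; rewrite mule_ge0// lee_fin.
  by apply: eq_integral => x _; rewrite /f /= upd_swap 1?eq_sym// muleCA.
apply.
  apply: emeasurable_funM.
    apply/measurable_EFinP; exact: (measurableT_comp mI measurable_fst).
  apply: emeasurable_funM.
    apply/measurable_EFinP; exact: (measurableT_comp mI measurable_snd).
  apply: (mF _ _ (fun z : measurableTypeR R * measurableTypeR R => upd (upd c i z.1) j z.2)) => l.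
  rewrite /upd; case: (l == j); first exact: measurable_snd.
  case: (l == i); first exact: measurable_fst.
  exact: measurable_cst.
by move=> z; rewrite !mule_ge0// lee_fin.
Qed.

End Iterated.

Section MonotoneIterated.
Context {R : realType} {I : eqType}.
Implicit Types (c : I -> R) (F G : (I -> R) -> \bar R).
Local Notation mu := (@lebesgue_measure R).
Local Notation D := `[0%R, 1%R[%classic.

(* No measurability is needed: the integral of a nonnegative function is a
   supremum over the simple functions below it. Hence only the majorants, never
   the integrands of the theorem, have to be shown measurable. *)
Lemma le_integral_nonmeas d (T : measurableType d) (m : {measure set T -> \bar R})
    (A : set T) (f g : T -> \bar R) :
  (forall x, A x -> 0 <= f x)%E -> (forall x, A x -> f x <= g x)%E ->
  (\int[m]_(x in A) f x <= \int[m]_(x in A) g x)%E.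
Proof.
move=> f0 fg; rewrite !ge0_integralE//; last first.
  by move=> x Ax; exact: le_trans (f0 x Ax) (fg x Ax).
apply: le_ereal_sup => _ /= [h hf <-]; exists h => // x.
apply: le_trans (hf x) _; rewrite /patch; case: ifP => // /set_mem Ax.
exact: fg.
Qed.

Lemma le_Op i F G c : (forall y, D y -> 0 <= F (upd c i y))%E ->
  (forall y, D y -> F (upd c i y) <= G (upd c i y))%E -> (Op i F c <= Op i G c)%E.
Proof. by move=> F0 FG; exact: le_integral_nonmeas. Qed.

Lemma It_ge0 s F : (forall c, 0 <= F c)%E -> forall c, (0 <= It s F c)%E.
Proof. by move=> F0; elim: s => //= i s IH c; exact: Op_ge0. Qed.

Lemma le_It s F G : (forall c, 0 <= F c)%E -> (forall c, F c <= G c)%E ->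
  forall c, (It s F c <= It s G c)%E.
Proof.
move=> F0 FG; elim: s => //= i s IH c; apply: le_Op => y _ //.
exact: It_ge0.
Qed.

Lemma eq_It s F G : F =1 G -> It s F =1 It s G.
Proof. by move=> /funext ->. Qed.

Lemma fmeas_It s F : (forall c, 0 <= F c)%E -> fmeas F -> fmeas (It s F).
Proof. by move=> F0 mF; elim: s => //= i s IH; apply: fmeas_Op => //; exact: It_ge0. Qed.

Lemma It_cat s1 s2 F : It (s1 ++ s2) F = It s1 (It s2 F).
Proof. by elim: s1 => //= i s ->. Qed.

Lemma It_move s i F : (forall c, 0 <= F c)%E -> fmeas F ->
  It (s ++ [:: i]) F = Op i (It s F).
Proof.
move=> F0 mF; elim: s => //= j s ->; rewrite Op_swap//; first exact: It_ge0.
exact: fmeas_It.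
Qed.

Lemma It_perm s1 s2 F : (forall c, 0 <= F c)%E -> fmeas F ->
  perm_eq s1 s2 -> It s1 F = It s2 F.
Proof.
move=> F0 mF; elim: s1 s2 => [|i s1 IH] s2.
  by move=> /perm_size /=; case: s2.
move=> /= p; have is2 : i \in s2 by rewrite -(perm_mem p) mem_head.
case: (path.splitPr is2) p => p1 p2 p.
have {}p : perm_eq s1 (p1 ++ p2).
  rewrite -(perm_cons i); apply: (perm_trans p).
  by rewrite perm_catC /= perm_cons perm_catC.
rewrite /= (IH _ p) -cat1s catA (It_cat (p1 ++ _)) It_move ?(It_cat p1)//.
  exact: It_ge0.
exact: fmeas_It.
Qed.

Lemma Op_mull i (K : (I -> R) -> \bar R) F c :
  (forall c, 0 <= F c)%E -> fmeas F -> (0 <= K c)%E ->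
  (forall y, K (upd c i y) = K c) ->
  Op i (fun c => K c * F c)%E c = (K c * Op i F c)%E.
Proof.
move=> F0 mF K0 Kc; rewrite /Op -ge0_integralZl//.
- by apply: eq_integral => y _; rewrite Kc.
- exact: fmeas_updyD.
Qed.

Lemma It_mull s (K : (I -> R) -> \bar R) F c :
  (forall c, 0 <= F c)%E -> fmeas F -> (forall c, 0 <= K c)%E ->
  (forall i c y, i \in s -> K (upd c i y) = K c) ->
  It s (fun c => K c * F c)%E c = (K c * It s F c)%E.
Proof.
move=> F0 mF K0; elim: s c => //= i s IH c Kc.
have -> : It s (fun c => K c * F c)%E = (fun c => K c * It s F c)%E.
  apply/funext => c'; apply: IH => j c'' y js; apply: Kc.
  by rewrite inE js orbT.
apply: Op_mull => //; [exact: It_ge0|exact: fmeas_It|].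
by move=> y; apply: Kc; rewrite mem_head.
Qed.

End MonotoneIterated.

(** * Translation invariance for periodic functions *)

Section PeriodicIntegral.
Context {R : realType}.
Local Notation mu := (@lebesgue_measure R).
Local Notation D := `[0%R, 1%R[%classic.
Implicit Types f : R -> \bar R.

Lemma lebesgue_measure_shift (z : R) (A : set R) : measurable A ->
  pushforward mu ((fun x => z + x) : measurableTypeR R -> measurableTypeR R) A = mu A.
Proof.
have mz : measurable_fun setT ((fun x => z + x) : measurableTypeR R -> measurableTypeR R).
  exact: measurable_funD (measurable_cst _) (@measurable_id _ _ _).
move=> mA; apply/esym.
apply: (lebesgue_measure_unique (mu := pushforward mu ((fun x => z + x) : measurableTypeR R -> measurableTypeR R))) => //.
move=> _ [[a b]] _ <- /=.
rewrite /pushforward.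
have -> : (fun x => z + x) @^-1` `]a, b]%classic = `](a - z), (b - z)]%classic.
  apply/seteqP; split => x /=; rewrite !in_itv /= lterBDl lterBDl.
    by [].
  by [].
rewrite !lebesgue_measure_itv/= !lte_fin ltrD2r.
by case: ifP => // _; rewrite -!EFinB; congr EFin; ring.
Qed.

Lemma integral_shift (z : R) (a b : R) f :
  measurable_fun setT f -> (forall x, 0 <= f x)%E ->
  (\int[mu]_(x in `[(z + a)%R, (z + b)%R[) f x = \int[mu]_(x in `[a, b[) f (z + x)%R)%E.
Proof.
move=> mf f0.
have mz : measurable_fun setT ((fun x => z + x) : measurableTypeR R -> measurableTypeR R).
  exact: measurable_funD (measurable_cst _) (@measurable_id _ _ _).
have -> : `[a, b[%classic = (fun x => z + x) @^-1` `[z + a, z + b[%classic.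
  by apply/seteqP; split => x /=; rewrite !in_itv /= lerD2l ltrD2l.
rewrite -(ge0_integral_pushforward mz)//=; last first.
  exact: measurable_funS mf.
by apply: eq_measure_integral => //= A mA AS; exact/esym/lebesgue_measure_shift.
Qed.

Lemma periodic_shift f (k : int) : (forall x, f (x + 1) = f x) ->
  forall x, f (x + k%:~R) = f x.
Proof.
move=> p; have pn (n : nat) x : f (x + n%:R) = f x.
  by elim: n x => [|n IH] x; rewrite ?addr0// -natr1 addrA p IH.
move=> x; case: k => n; first exact: pn.
by rewrite NegzE -[in RHS](subrK (n.+1%:R) x) pn rmorphN.
Qed.

(** The interval from z to z + 1 is cut at u + 1, where u is the integer part of z. The piece to the
    right of u + 1, moved back by one period, becomes the interval from u to z and completes the
    other piece to a full period starting at an integer. *)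
Lemma integral_periodic (z : R) f :
  measurable_fun setT f -> (forall x, 0 <= f x)%E -> (forall x, f (x + 1)%R = f x) ->
  (\int[mu]_(x in D) f (z + x)%R = \int[mu]_(x in D) f x)%E.
Proof.
move=> mf f0 pf; rewrite -(integral_shift z 0 1)// addr0.
set k := Num.floor z; set u := k%:~R : R.
have uz : u <= z by exact: floor_le_tmp.
have zu : z < u + 1 by rewrite -[1]/(1%:~R) -rmorphD; exact: floorD1_gt.
have split a b c : a <= b -> b <= c -> (\int[mu]_(x in `[a, c[) f x =
    \int[mu]_(x in `[a, b[) f x + \int[mu]_(x in `[b, c[) f x)%E.
  move=> ab bc; rewrite -ge0_integral_setU//.
  - by rewrite -itv_bndbnd_setU.
  - exact: measurable_funS mf.
  - rewrite disj_set2E; apply/eqP/seteqP; split => x //= [].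
    rewrite !in_itv/= => /andP[_ xb] /andP[bx _].
    by have := lt_le_trans xb bx; rewrite ltxx.
rewrite (split _ (u + 1)) ?lerD2r// ?(ltW zu)//.
have -> : (\int[mu]_(x in `[(u + 1)%R, (z + 1)%R[) f x = \int[mu]_(x in `[u, z[) f x)%E.
  rewrite addrC [(z + 1)%R]addrC integral_shift//.
  by apply: eq_integral => x _; rewrite addrC pf.
rewrite addeC -split ?(ltW zu)//.
rewrite -[X in `[X, _[]addr0 integral_shift//.
by apply: eq_integral => x _; rewrite addrC periodic_shift.
Qed.

End PeriodicIntegral.

(** * Kernels and singularities on the torus *)

Section TorusDistance.
Context {R : realType}.
Implicit Types (u v : R).

(** With [distZ_ex] this describes [distZ] as an attained minimum of |u - m| over the integers m,
    from which the triangle inequality, symmetry and periodicity are derived. *)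
Lemma distZ_le u (m : int) : distZ u <= `|u - m%:~R|.
Proof.
rewrite /distZ; set k := Num.floor u.
have ku : (k%:~R : R) <= u by exact: floor_le_tmp.
have uk : u < k%:~R + 1 by rewrite -[1]/(1%:~R) -rmorphD; exact: floorD1_gt.
rewrite ge_min; have [mk|km] := leP m k.
  have : (m%:~R : R) <= k%:~R by rewrite ler_int.
  move=> mk'; apply/orP; left; apply: le_trans (ler_norm _); lra.
have : (k%:~R + 1 : R) <= m%:~R by rewrite -[1]/(1%:~R) -rmorphD ler_int lezD1.
move=> km'; apply/orP; right; rewrite distrC; apply: le_trans (ler_norm _); lra.
Qed.

Lemma distZ_ex u : exists m : int, distZ u = `|u - m%:~R|.
Proof.
rewrite /distZ; set k := Num.floor u.
have ku : (k%:~R : R) <= u by exact: floor_le_tmp.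
have uk : u < k%:~R + 1 by rewrite -[1]/(1%:~R) -rmorphD; exact: floorD1_gt.
rewrite minEle; case: ifP => _.
  by exists k; rewrite ger0_norm// subr_ge0.
exists (k + 1); rewrite rmorphD /= distrC ger0_norm// subr_ge0; exact: ltW.
Qed.

Lemma distZ_ge0 u : 0 <= distZ u.
Proof. by have [m ->] := distZ_ex u. Qed.

Lemma distZ_norm u : distZ u <= `|u|.
Proof. by have := distZ_le u 0; rewrite subr0. Qed.

Lemma distZ_le1 u : distZ u <= 1.
Proof.
rewrite /distZ ge_min; apply/orP; left.
have : u < (Num.floor u)%:~R + 1 by rewrite -[1]/(1%:~R) -rmorphD; exact: floorD1_gt.
lra.
Qed.

Lemma distZ_addr u v : distZ (u + v) <= distZ u + distZ v.
Proof.
have [m ->] := distZ_ex u; have [p ->] := distZ_ex v.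
apply: le_trans (distZ_le _ (m + p)) _; rewrite rmorphD /=.
rewrite (_ : u + v - _ = (u - m%:~R) + (v - p%:~R)); last by ring.
exact: ler_normD.
Qed.

Lemma distZN u : distZ (- u) = distZ u.
Proof.
have H v : distZ (- v) <= distZ v.
  have [m ->] := distZ_ex v; apply: le_trans (distZ_le _ (- m)) _.
  by rewrite rmorphN /= -opprD normrN.
by apply/eqP; rewrite eq_le H /=; have := H (- u); rewrite opprK.
Qed.

Lemma distZ_addz u (k : int) : distZ (u + k%:~R) = distZ u.
Proof.
have H v (j : int) : distZ (v + j%:~R) <= distZ v.
  have [m ->] := distZ_ex v; apply: le_trans (distZ_le _ (m + j)) _.
  by rewrite rmorphD /= opprD addrACA subrr addr0.
apply/eqP; rewrite eq_le H /=.
by have := H (u + k%:~R) (- k); rewrite rmorphN /= addrK.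
Qed.

Lemma distZ_add1 u : distZ (u + 1) = distZ u.
Proof. exact: (distZ_addz u 1). Qed.

Lemma distZ_lip u v : `|distZ u - distZ v| <= `|u - v|.
Proof.
have H (a b : R) : distZ a - distZ b <= `|a - b|.
  rewrite lerBlDr; have := distZ_addr (a - b) b; rewrite subrK => /le_trans; apply.
  by rewrite lerD2r distZ_norm.
rewrite ler_norml H andbT lerNl opprB distrC; exact: H.
Qed.

Lemma distZ_eq0 u : (distZ u == 0) = (u == (Num.floor u)%:~R).
Proof.
apply/eqP/eqP => [|uE].
  have [m ->] := distZ_ex u => /eqP; rewrite normr_eq0 subr_eq0 => /eqP ->.
  by rewrite intrKfloor.
apply/eqP; rewrite eq_le distZ_ge0 andbT; apply: le_trans (distZ_le u (Num.floor u)) _.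
by rewrite -uE subrr normr0.
Qed.

Lemma continuous_distZ : continuous (distZ : R -> R).
Proof.
move=> x; apply/cvgrPdist_le => e e0.
exists e => //= y xy; apply: le_trans (distZ_lip _ _) _; exact: ltW.
Qed.

Lemma measurable_distZ (A : set R) : measurable_fun A (distZ : R -> R).
Proof.
apply: measurable_funS (continuous_measurable_fun continuous_distZ) => //.
Qed.

End TorusDistance.

Section SupDistance.
Context {R : realType} {n : nat}.
Implicit Types (x y z : 'rV[R]_n).

(** Torus distance in the supremum norm. Its balls are products of intervals, so that their volumes
    are computed coordinate by coordinate; it agrees with [tnorm] up to the factor sqrt n. *)
Definition dinf z : R := \big[Num.max/0]_(i < n) distZ (z ord0 i).

Lemma dinf_ge0 z : 0 <= dinf z.
Proof. by rewrite /dinf; elim/big_ind: _ => // [x y x0 y0|i _]; rewrite ?le_max ?x0 ?distZ_ge0. Qed.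

Lemma distZ_le_dinf z i : distZ (z ord0 i) <= dinf z.
Proof. by rewrite /dinf (bigD1 i)//= le_max lexx. Qed.

Lemma dinf_le z (r : R) : 0 <= r -> (forall i, distZ (z ord0 i) <= r) -> dinf z <= r.
Proof. by move=> r0 H; rewrite /dinf; elim/big_ind: _ => // [x y xr yr]; rewrite ge_max xr. Qed.

Lemma dinf_le1 z : dinf z <= 1.
Proof. by apply: dinf_le => // i; exact: distZ_le1. Qed.

Lemma dinfD y z : dinf (y + z) <= dinf y + dinf z.
Proof.
apply: dinf_le; first by rewrite addr_ge0// dinf_ge0.
move=> i; rewrite mxE; apply: le_trans (distZ_addr _ _) _.
by apply: lerD; exact: distZ_le_dinf.
Qed.

Lemma dinfN z : dinf (- z) = dinf z.
Proof. by apply: eq_bigr => i _; rewrite mxE distZN. Qed.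

Lemma tnorm_ge_dinf z : dinf z <= tnorm z.
Proof.
apply: dinf_le; first exact: sqrtr_ge0.
move=> i; rewrite -[leLHS]ger0_norm ?distZ_ge0// -sqrtr_sqr; apply: ler_wsqrtr.
rewrite (bigD1 i)//= lerDl; apply: sumr_ge0 => j _; exact: sqr_ge0.
Qed.

Lemma tnorm_le_dinf z : tnorm z <= Num.sqrt n%:R * dinf z.
Proof.
rewrite -[X in _ * X]ger0_norm ?dinf_ge0// -sqrtr_sqr -sqrtrM ?ler0n//.
apply: ler_wsqrtr; rewrite -[n in n%:R]card_ord -sumr_const mulr_suml.
apply: ler_sum => i _; rewrite mul1r ler_sqr ?nnegrE ?distZ_ge0 ?dinf_ge0//.
exact: distZ_le_dinf.
Qed.

Lemma dinf_sub_eq0 x y : in_cube x -> in_cube y -> dinf (x - y) = 0 -> x = y.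
Proof.
move=> cx cy d0; apply/rowP => i.
have : distZ ((x - y) ord0 i) == 0.
  by rewrite eq_le distZ_ge0 andbT -d0 distZ_le_dinf.
rewrite distZ_eq0 !mxE; set m := Num.floor _ => /eqP xym.
have /andP[x0 x1] := cx i; have /andP[y0 y1] := cy i.
have : m = 0.
  have m1 : (m%:~R : R) < 1%:~R by lra.
  have m2 : ((-1)%:~R : R) < m%:~R by rewrite rmorphN /=; lra.
  move: m1 m2; rewrite !ltr_int; clear; move: m => m m1 m2; lia.
by move=> m0; move: xym; rewrite m0 => /eqP; rewrite subr_eq0 => /eqP.
Qed.

End SupDistance.

Section PowerFacts.
Context {R : realType}.

Lemma powR_le_neg (x y a : R) : 0 < x -> x <= y -> 0 <= a -> y `^ (- a) <= x `^ (- a).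
Proof.
move=> x0 xy a0; rewrite !powRN lef_pV2 ?posrE ?powR_gt0 ?(lt_le_trans x0 xy)//.
by apply: ge0_ler_powR => //; rewrite nnegrE; [exact: ltW|exact: le_trans (ltW x0) xy].
Qed.

(** The least admissible [j] is taken; minimality yields the lower bound unless [j] is zero. *)
Lemma dyadic_scale (t : R) : exists j : nat,
  t <= 2 ^+ j /\ (j = 0%N \/ exists2 i, j = i.+1 & 2 ^+ i < t).
Proof.
have ex : exists j : nat, t <= 2 ^+ j.
  have := archi_boundP (normr_ge0 t); set N := Num.bound _ => tN.
  exists N; apply: le_trans (ler_norm t) _; apply: le_trans (ltW tN) _.
  have : (N%:R : R) <= (2 ^ N)%:R by rewrite ler_nat ltnW// ltn_expl.
  by rewrite natrX.
case: (ex_minnP ex) => j tj jmin; exists j; split => //.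
case: j => [|i] in tj jmin *; [by left|right; exists i => //].
by rewrite ltNge; apply/negP => /jmin; rewrite ltnn.
Qed.

Lemma nneseries_le_bound (f : nat -> \bar R) (B : \bar R) :
  (forall j, 0 <= f j)%E -> (forall k, \sum_(0 <= j < k) f j <= B)%E ->
  (\sum_(0 <= j <oo) f j <= B)%E.
Proof.
move=> f0 fB; apply: lime_le; first by apply: is_cvg_nneseries => j _ _; exact: f0.
by near=> k; exact: fB.
Unshelve. all: by end_near. Qed.

Lemma nneseries_term (f : nat -> \bar R) j :
  (forall j, 0 <= f j)%E -> (f j <= \sum_(0 <= j <oo) f j)%E.
Proof.
move=> f0; apply: le_trans (nneseries_lim_ge (P := xpredT) j.+1 (fun i _ _ => f0 i)).
by rewrite big_nat_recr//= leeDr// sume_ge0.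
Qed.

Lemma geometric_sum_le (r : R) k : 0 <= r < 1 -> \sum_(0 <= j < k) r ^+ j <= (1 - r)^-1.
Proof.
move=> /andP[r0 r1]; have r1' : 0 < 1 - r by rewrite subr_gt0.
rewrite -[leRHS]mul1r ler_pdivlMr// mulrC big_mkord -opprB mulNr -subrX1 opprB.
by rewrite gerBl exprn_ge0.
Qed.

Lemma geometric_series_le (K r : R) : 0 <= K -> 0 <= r < 1 ->
  (\sum_(0 <= j <oo) (K * r ^+ j)%:E <= (K / (1 - r))%:E)%E.
Proof.
move=> K0 r01; have /andP[r0 r1] := r01.
apply: nneseries_le_bound => [j|k]; first by rewrite lee_fin mulr_ge0 ?exprn_ge0.
rewrite sumEFin lee_fin -mulr_sumr ler_wpM2l//; exact: geometric_sum_le.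
Qed.

End PowerFacts.

Section IteratedSeries.
Context {R : realType} {I : eqType}.
Implicit Types (c : I -> R) (F : nat -> (I -> R) -> \bar R).
Local Notation mu := (@lebesgue_measure R).
Local Notation D := `[0%R, 1%R[%classic.

Lemma It_nneseries s F : (forall j c, 0 <= F j c)%E -> (forall j, fmeas (F j)) ->
  forall c, It s (fun c => \sum_(0 <= j <oo) F j c)%E c =
            (\sum_(0 <= j <oo) It s (F j) c)%E.
Proof.
move=> F0 mF; elim: s => //= i s IH c.
rewrite (_ : It s _ = fun c => (\sum_(0 <= j <oo) It s (F j) c)%E); last exact/funext.
rewrite /Op integral_nneseries//; last by move=> *; exact: It_ge0.
by move=> j; apply: fmeas_updyD; exact: fmeas_It.
Qed.

Lemma It_prod1 (s : seq I) (g : I -> R -> \bar R) : uniq s ->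
  (forall i y, 0 <= g i y)%E -> (forall i, measurable_fun setT (g i)) ->
  forall c, It s (fun c => \prod_(i <- s) g i (c i))%E c =
     (\prod_(i <- s) \int[mu]_(y in D) g i y)%E.
Proof.
move=> us g0 mg.
have mgc i : fmeas (fun c => g i (c i)).
  by apply: (fmeas_comp (f := g i)) => //; exact: fmeas_coord.
elim: s us => [_ c|i s IH /= /andP[ins us] c]; first by rewrite /= !big_nil.
rewrite big_cons.
have -> : It s (fun c => \prod_(i0 <- (i :: s)) g i0 (c i0))%E =
    fun c => (g i (c i) * \prod_(i0 <- s) \int[mu]_(y in D) g i0 y)%E.
  apply/funext => c'; rewrite -(IH us c') -(@It_mull _ _ s (fun c => g i (c i)) _ c')//.
  - by apply: eq_It => c''; rewrite big_cons.
  - by move=> c''; apply: prode_ge0 => j _; exact: g0.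
  - exact: fmeas_prod.
  - move=> j c'' y js; rewrite /upd; case: eqVneq => // ij.
    by rewrite ij js in ins.
rewrite /Op ge0_integralZr//.
- by congr (_ * _)%E; apply: eq_integral => y _; rewrite /upd eqxx.
- by apply: (fmeas_updyD (F := fun c => g i (c i))); exact: mgc.
- by apply: prode_ge0 => j _; exact: integral_ge0.
Qed.

End IteratedSeries.

Section OneDimKernel.
Context {R : realType}.
Local Notation mu := (@lebesgue_measure R).
Local Notation D := `[0%R, 1%R[%classic.

(** Bump of mass O(1) at scale h on the circle. Polynomial decay suffices to dominate every
    derivative of the periodised Gaussian and is simple to compare at different scales. *)
Definition qk (p : nat) (h u : R) : R := h^-1 * (1 + distZ u / h) `^ (- p%:R).

Definition dball (r : R) : R -> R := fun d => (d <= r)%R%:R.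

Lemma dball_ge0 r d : 0 <= dball r d. Proof. exact: ler0n. Qed.

Lemma measurable_dball r : measurable_fun setT (dball r).
Proof.
apply: nonincreasing_measurable => // x y xy; rewrite /dball ler_nat.
by case: (leP y r) => // yr; rewrite (le_trans xy yr).
Qed.

Lemma measurable_qk p h : measurable_fun setT (qk p h).
Proof.
apply: measurable_funM; first exact: measurable_cst.
apply: (measurableT_comp (measurable_powR _)).
apply: measurable_funD; first exact: measurable_cst.
by apply: measurable_funM; [exact: measurable_distZ|exact: measurable_cst].
Qed.

Lemma qk_ge0 p h u : 0 < h -> 0 <= qk p h u.
Proof. by move=> h0; rewrite mulr_ge0 ?powR_ge0// invr_ge0 ltW. Qed.

Lemma integral_dball_distZ (r : R) : 0 <= r ->
  (\int[mu]_(y in D) (dball r (distZ y))%:E <= (2 * r)%:E)%E.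
Proof.
move=> r0.
have mA : measurable (`[0, r]%classic `|` `[1 - r, 1]%classic : set R).
  by apply: measurableU; exact: measurable_itv.
apply: (@le_trans _ _ (\int[mu]_(y in D) (\1_(`[0, r]%classic `|` `[1 - r, 1]%classic) y)%:E)%E).
  apply: le_integral_nonmeas => y /=; first by move=> _; rewrite lee_fin dball_ge0.
  rewrite in_itv /= => /andP[y0 y1]; rewrite lee_fin /dball indicE.
  have [|_] := leP (distZ y) r; last by rewrite ler0n.
  have fy : Num.floor y = 0 by apply: floor_def; rewrite y0/= add0r.
  rewrite /distZ fy subr0 add0r ge_min => /orP H.
  rewrite ler_nat lt0b; apply/mem_set.
  by case: H => H; [left|right] => /=; rewrite in_itv /= ?y0 ?H//; apply/andP; split; lra.
rewrite integral_indic//.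
apply: (@le_trans _ _ (mu (`[0, r]%classic `|` `[1 - r, 1]%classic))).
  by apply: le_measure; rewrite ?inE//; apply: measurableI.
apply: le_trans (measureU2 _ _ _) _; [exact: measurable_itv|exact: measurable_itv|].
apply: (@le_trans _ _ (r%:E + r%:E)%E); last by rewrite -EFinD lee_fin; lra.
have itvl (a : R) : (mu `[a, (a + r)%R]%classic <= r%:E)%E.
  rewrite lebesgue_measure_itv/= lte_fin.
  by case: ifP => _; rewrite -?EFinB lee_fin//; lra.
apply: leeD; first by have := itvl 0; rewrite add0r.
by have := itvl (1 - r); rewrite subrK.
Qed.

Lemma integral_distZ_affine (g : R -> R) (z : R) (b : bool) :
  measurable_fun setT g -> (forall x, 0 <= g x) ->
  (\int[mu]_(y in D) (g (distZ (z + (-1) ^+ b * y)))%:E = \int[mu]_(y in D) (g (distZ y))%:E)%E.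
Proof.
move=> mg g0.
rewrite -(@integral_periodic _ ((-1) ^+ b * z) (fun y => (g (distZ y))%:E)) //.
- apply: eq_integral => y _; congr (g _)%:E.
  by case: b; rewrite ?expr1 ?expr0 ?mul1r// !mulN1r -distZN opprD opprK.
- by apply/measurable_EFinP; apply: (measurableT_comp mg); exact: measurable_distZ.
- by move=> x; rewrite lee_fin.
- by move=> x; rewrite distZ_add1.
Qed.

Lemma integral_qk p h : (1 < p)%N -> 0 < h ->
  (\int[mu]_(y in D) (qk p h y)%:E <= 16%:E)%E.
Proof.
move=> p1 h0; have h' : 0 < h^-1 by rewrite invr_gt0.
(* Where [distZ y / h] is of order 2^j, the square in the denominator gives at most 4 * 4^-j, and
   the ball of radius 2^j h has measure at most 2 * 2^j h. The terms are then at most 8 * 2^-j,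
   which sum to 16. *)
pose F j y : \bar R := ((h^-1 * (4 * 4^-1 ^+ j)) * dball (2 ^+ j * h) (distZ y))%:E.
have F0 j y : (0 <= F j y)%E.
  by rewrite lee_fin mulr_ge0 ?dball_ge0// !mulr_ge0 ?exprn_ge0// ltW.
have mF j : measurable_fun setT (F j).
  apply/measurable_EFinP; apply: measurable_funM; first exact: measurable_cst.
  by apply: (measurableT_comp (measurable_dball _)); exact: measurable_distZ.
apply: (@le_trans _ _ (\int[mu]_(y in D) (\sum_(0 <= j <oo) F j y))%E).
  apply: le_integral_nonmeas => y _; first by rewrite lee_fin qk_ge0.
  have [j [tj H]] := dyadic_scale (distZ y / h).
  apply: le_trans (nneseries_term j (fun j => F0 j y)).
  have dj : distZ y <= 2 ^+ j * h by rewrite -ler_pdivrMr.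
  rewrite lee_fin /dball dj mulr1 ler_wpM2l// ?(ltW h')//.
  have t0 : 0 <= distZ y / h by rewrite divr_ge0 ?distZ_ge0 ?ltW.
  have h1 : (1 + distZ y / h) `^ (- p%:R) <= (1 + distZ y / h) `^ (- 2).
    by apply: ler_powR; rewrite ?lerDl// lerN2 ler_nat.
  apply: le_trans h1 _; rewrite powR_invn ?addr_ge0//.
  case: H => [->|[i -> ti]].
    rewrite expr0 mulr1; apply: (@le_trans _ _ 1) => //; last by lra.
    by rewrite invf_le1 ?exprn_ege1 ?exprn_gt0 ?lerDl//; lra.
  rewrite (exprS 4^-1) mulrA divff// mul1r.
  have -> : (4 : R) = 2 ^+ 2 by ring.
  rewrite exprVn -exprM mulnC exprM lef_pV2 ?posrE ?exprn_gt0//; [|lra].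
  by rewrite lerXn2r ?nnegrE ?exprn_ge0//; lra.
rewrite integral_nneseries//; last by move=> j; apply: measurable_funS (mF j).
apply: (@le_trans _ _ (\sum_(0 <= j <oo) (8 * 2^-1 ^+ j)%:E)%E).
  apply: lee_nneseries => [j _ _|j _]; first by apply: integral_ge0.
  have -> : (\int[mu]_(y in D) F j y = (h^-1 * (4 * 4^-1 ^+ j))%:E *
      \int[mu]_(y in D) (dball (2 ^+ j * h) (distZ y))%:E)%E.
    rewrite -ge0_integralZl_EFin//; last by rewrite !mulr_ge0 ?exprn_ge0// ltW.
      by move=> y _; rewrite lee_fin dball_ge0.
    apply/measurable_EFinP; apply: (measurable_funS measurableT) => //.
    by apply: (measurableT_comp (measurable_dball _)); exact: measurable_distZ.
  apply: (@le_trans _ _ ((h^-1 * (4 * 4^-1 ^+ j))%:E * (2 * (2 ^+ j * h))%:E)%E).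
    apply: lee_wpmul2l; first by rewrite lee_fin !mulr_ge0 ?exprn_ge0// ltW.
    by apply: integral_dball_distZ; rewrite mulr_ge0 ?exprn_ge0 ?ltW.
  rewrite -EFinM lee_fin.
  have -> : (4 : R) = 2 ^+ 2 by ring.
  rewrite !exprVn -exprM mulnC exprM.
  have u0 : (2 ^+ j : R) != 0 by rewrite lt0r_neq0 ?exprn_gt0.
  move: (2 ^+ j) u0 => u u0.
  rewrite le_eqVlt; apply/orP; left; apply/eqP; field.
  by rewrite u0 lt0r_neq0.
apply: le_trans (geometric_series_le _ _) _ => //; first by lra.
by rewrite lee_fin ler_pdivrMr; lra.
Qed.

End OneDimKernel.

Section SingularKernel.
Context {R : realType}.

(* The value +oo at 0 makes the bounds hold without discarding a null set. *)
Definition S (a d : R) : \bar R := if d == 0 then +oo%E else (d `^ (- a))%:E.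

Lemma S_ge0 a d : (0 <= S a d)%E.
Proof. by rewrite /S; case: ifP => // _; rewrite lee_fin powR_ge0. Qed.

Lemma measurable_S a : measurable_fun setT (S a).
Proof.
apply: measurable_fun_ifT.
- exact: measurable_fun_eqr.
- exact: measurable_cst.
- by apply/measurable_EFinP; exact: measurable_powR.
Qed.

Lemma powRX (x s : R) (j : nat) : 0 <= x -> (x ^+ j) `^ s = (x `^ s) ^+ j.
Proof. by move=> x0; rewrite -!powR_mulrn ?powR_ge0// powRAC. Qed.

Definition layer_radius (M : R) (j : nat) : R := if j is j'.+1 then M * 2^-1 ^+ j' else 1.

(** Layer cake over dyadic balls. Layer 0 is the whole torus, of radius 1, with height M^-a, and
    takes care of d > M. Layer i + 1 has radius M 2^-i and the height attained at half that
    radius. *)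
Lemma S_layer (a d M : R) : 0 < M <= 1 -> 0 <= d <= 1 -> 0 <= a ->
  (S a d <= \sum_(0 <= j <oo)
     ((M * 2^-1 ^+ j) `^ (- a) * dball (layer_radius M j) d)%:E)%E.
Proof.
move=> /andP[M0 M1] /andP[d0 d1] a0.
pose f j : \bar R := ((M * 2^-1 ^+ j) `^ (- a) * dball (layer_radius M j) d)%:E.
have e0 j : 0 < (2^-1 : R) ^+ j by rewrite exprn_gt0.
have f0 j : (0 <= f j)%E by rewrite lee_fin mulr_ge0 ?powR_ge0 ?dball_ge0.
rewrite /S; case: eqVneq => [dE|dN].
  rewrite leye_eq; apply/eqP/eq_infty => r.
  (* At d = 0 every layer is present, with height at least 1 because M 2^-j <= 1 and a >= 0; the sum
     is therefore infinite, as [S] is there. *)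
  have f1 j : (1 <= f j)%E.
    rewrite lee_fin /dball dE (_ : 0 <= _).
      rewrite mulr1 powRN -[leLHS]invr1 lef_pV2 ?posrE ?powR_gt0 ?mulr_gt0//.
      rewrite -[leRHS](powRr0 (M * 2^-1 ^+ j)); apply: ger_powR => //.
      by rewrite mulr_gt0//= mulr_ile1 ?(ltW M0) ?(ltW (e0 j))// exprn_ile1//; lra.
    by case: j => //= j; rewrite mulr_ge0 ?ltW.
  have := archi_boundP (normr_ge0 r); set N := Num.bound _ => rN.
  apply: le_trans (nneseries_lim_ge (P := xpredT) N (fun i _ _ => f0 i)).
  apply: (@le_trans _ _ (\sum_(0 <= j < N) 1)%E); last exact: lee_sum.
  rewrite sumEFin lee_fin big_mkord sumr_const card_ord.
  by apply: le_trans (ler_norm _) _; exact: ltW.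
have {d0}d0 : 0 < d by rewrite lt_def dN.
have [dM|Md] := leP d M; last first.
  apply: le_trans (nneseries_term 0 f0).
  rewrite lee_fin /dball d1 mulr1 expr0 mulr1.
  by apply: powR_le_neg => //; exact: ltW.
(* The factor 2 aligns the indices: the minimal j for M / (2 d) satisfies M 2^-(j+1) <= d, and also
   d <= M 2^-j, by minimality or, for j = 0, by d <= M. *)
have [j [tj H]] := dyadic_scale (M / (2 * d)).
have [i [di id]] : exists i, d <= M * 2^-1 ^+ i /\ M * 2^-1 ^+ i.+1 <= d.
  have p2 i : 0 < (2 : R) ^+ i by rewrite exprn_gt0.
  exists j; split; last first.
    rewrite exprVn exprS invfM mulrA ler_pdivrMr//.
    by move: tj; rewrite ler_pdivrMr ?mulr_gt0//; lra.
  case: H => [->|[i -> Hi]]; first by rewrite expr0 mulr1.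
  rewrite exprVn ler_pdivlMr//.
  by move: Hi; rewrite ltr_pdivlMr ?mulr_gt0// exprS; lra.
apply: le_trans (nneseries_term i.+1 f0).
rewrite lee_fin /dball /= di mulr1; apply: powR_le_neg => //.
by rewrite mulr_gt0.
Qed.

End SingularKernel.

Section VectorKernel.
Context {R : realType} {n : nat} {V : finType}.
Implicit Types (c : V * nat -> R) (w : V).
Local Notation mu := (@lebesgue_measure R).
Local Notation D := `[0%R, 1%R[%classic.

Definition vec c w : 'rV[R]_n := \row_(i < n) c (w, i.+1).

(* A configuration is a family c indexed by V * nat: c (w, 0) is the time of w
   and c (w, i.+1) is the i-th space coordinate of w. *)
Definition sp w : seq (V * nat) := [seq (w, i.+1) | i <- iota 0 n].

(** The exponent n + 1 exceeds 1 in every dimension n >= 1, which makes each factor integrable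
    uniformly in h, and it is at least n, which gives the pointwise bound [Q_le_dinf]. *)
Definition Q (h : R) (y : 'rV[R]_n) : R := \prod_(i < n) qk n.+1 h (y ord0 i).

Lemma Q_ge0 h y : 0 < h -> 0 <= Q h y.
Proof. by move=> h0; apply: prodr_ge0 => i _; exact: qk_ge0. Qed.

Lemma uniq_sp w : uniq (sp w).
Proof. by rewrite map_inj_uniq ?iota_uniq// => i j []. Qed.

Lemma prod_EFin (J : Type) (s : seq J) (P : pred J) (f : J -> R) :
  ((\prod_(j <- s | P j) f j)%:E = \prod_(j <- s | P j) (f j)%:E)%E.
Proof. exact: (big_morph EFin EFinM). Qed.

Lemma prode_le (J : Type) (s : seq J) (P : pred J) (f : J -> \bar R) (g : J -> R) :
  (forall j, P j -> 0 <= f j)%E -> (forall j, P j -> f j <= (g j)%:E)%E ->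
  (\prod_(j <- s | P j) f j <= (\prod_(j <- s | P j) g j)%:E)%E.
Proof.
move=> f0 fg.
suff [] : (0 <= \prod_(j <- s | P j) f j)%E /\
    (\prod_(j <- s | P j) f j <= (\prod_(j <- s | P j) g j)%:E)%E by [].
apply: (big_ind2 (fun (x : \bar R) (y : R) => (0 <= x)%E /\ (x <= y%:E)%E)).
- by [].
- move=> x1 x2 y1 y2 [x0 xy] [y0 yz]; split; first exact: mule_ge0.
  by rewrite EFinM; apply: lee_pmul.
- by move=> j Pj; split; [exact: f0|exact: fg].
Qed.

Lemma It_sp_prod w (g : nat -> R -> R) : (forall i y, 0 <= g i y) ->
  (forall i, measurable_fun setT (g i)) -> forall c,
  It (sp w) (fun c => (\prod_(i < n) g i (c (w, i.+1)))%:E) c =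
  (\prod_(i < n) \int[mu]_(y in D) (g i y)%:E)%E.
Proof.
move=> g0 mg c.
have E (F : nat -> \bar R) : (\prod_(i < n) F i = \prod_(j <- sp w) F j.2.-1)%E.
  by rewrite big_map -(big_mkord xpredT) /index_iota subn0.
rewrite (E (fun i => \int[mu]_(y in D) (g i y)%:E)%E).
have h0 (i : V * nat) y : (0 <= (g i.2.-1 y)%:E)%E by rewrite lee_fin.
have hm (i : V * nat) : measurable_fun setT (fun y => (g i.2.-1 y)%:E).
  exact/measurable_EFinP.
rewrite -(It_prod1 (uniq_sp w) h0 hm c).
apply: eq_It => c'; rewrite prod_EFin (E (fun i => (g i (c' (w, i.+1)))%:E)).
by rewrite !big_map.
Qed.

Lemma fmeas_vec w (i : 'I_n) : fmeas (fun c => vec c w ord0 i).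
Proof.
rewrite (_ : (fun c => _) = fun c => c (w, i.+1)); first exact: fmeas_coord.
by apply/funext => c; rewrite mxE.
Qed.

Lemma fmeas_prod_real (J : Type) (s : seq J) (F : J -> (V * nat -> R) -> R) :
  (forall j, fmeas (F j)) -> fmeas (fun c => \prod_(j <- s) F j c).
Proof.
move=> mF d T g mg; elim: s => [|j s IH].
  by under eq_fun do rewrite big_nil; exact: measurable_cst.
by under eq_fun do rewrite big_cons; apply: measurable_funM => //; exact: mF.
Qed.

Lemma fmeas_dinf (z : (V * nat -> R) -> 'rV[R]_n) : (forall i, fmeas (fun c => z c ord0 i)) ->
  fmeas (fun c => dinf (z c)).
Proof.
move=> mz d T g mg; rewrite /dinf; elim: (index_enum _) => [|i s IH].
  by under eq_fun do rewrite big_nil; exact: measurable_cst.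
under eq_fun do rewrite big_cons.
apply: measurable_maxr => //.
exact: (measurableT_comp (@measurable_distZ R setT) (mz i _ _ g mg)).
Qed.

Lemma fmeas_Q_vec h w : fmeas (fun c => (Q h (vec c w))).
Proof.
apply: fmeas_prod_real => i; apply: (fmeas_comp (f := qk n.+1 h)) => //; last exact: fmeas_vec.
exact: measurable_qk.
Qed.

(** Let P be the product of the factors 1 + d_i / h, all at least 1. Then [Q] equals h^-n P^-(n+1),
    and P dominates its largest factor, 1 + dinf y / h. *)
Lemma Q_le_dinf h y : 0 < h -> Q h y <= (h + dinf y) ^- n.
Proof.
move=> h0; have h' : 0 < h^-1 by rewrite invr_gt0.
have f1 i : 1 <= 1 + distZ (y ord0 i) / h by rewrite lerDl divr_ge0 ?distZ_ge0 ?ltW.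
pose P := \prod_(i < n) (1 + distZ (y ord0 i) / h).
have P1 : 1 <= P.
  by rewrite /P; elim/big_ind: _ => // x z x1 z1; rewrite -[1]mulr1 ler_pM.
have QE : Q h y = h ^- n * P ^- n.+1.
  rewrite /Q /qk big_split /= prodr_const card_ord exprVn; congr (_ * _).
  rewrite -exprVn -prodfV -prodrXl; apply: eq_bigr => i _.
  by rewrite powR_invn ?exprVn// (le_trans _ (f1 i)).
have dP : 1 + dinf y / h <= P.
  suff : dinf y <= (P - 1) * h by rewrite -ler_pdivrMr//; lra.
  apply: dinf_le; first by rewrite mulr_ge0 ?(ltW h0) ?subr_ge0.
  move=> i; rewrite -ler_pdivrMr// lerBrDl /P (bigD1 i)//= -[leLHS]mulr1 ler_pM//.
    by rewrite (le_trans _ (f1 i)).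
  by elim/big_ind: _ => // x z x1 z1; rewrite -[1]mulr1 ler_pM.
have hd : h + dinf y = h * (1 + dinf y / h) by field; exact: lt0r_neq0.
have d1 : 1 <= 1 + dinf y / h by rewrite lerDl divr_ge0 ?dinf_ge0 ?ltW.
rewrite QE hd exprMn invfM ler_wpM2l ?invr_ge0 ?exprn_ge0 ?(ltW h0)//.
rewrite lef_pV2 ?posrE ?exprn_gt0 ?(lt_le_trans ltr01)//.
apply: (@le_trans _ _ (P ^+ n)); last by apply: ler_weXn2l.
by rewrite lerXn2r ?nnegrE ?(le_trans ler01)//.
Qed.

Lemma It_Q w h c : (0 < n)%N -> 0 < h -> (It (sp w) (fun c => (Q h (vec c w))%:E) c <= (16 ^+ n)%:E)%E.
Proof.
move=> n0 h0.
rewrite (@eq_It _ _ (sp w) _ (fun c : V * nat -> R => (\prod_(i < n) qk n.+1 h (c (w, i.+1)))%:E)); last first.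
  by move=> c'; congr (_%:E); apply: eq_bigr => i _; rewrite mxE.
rewrite (It_sp_prod w (g := fun _ => qk n.+1 h)).
- rewrite -[n in 16 ^+ n]card_ord -prodr_const; apply: prode_le => i _.
    by apply: integral_ge0 => y _; rewrite lee_fin qk_ge0.
  exact: integral_qk.
- by move=> _ y; exact: qk_ge0.
- by move=> _; exact: measurable_qk.
Qed.

Lemma It_dball w (z : 'rV[R]_n) (b : bool) (r : R) c : 0 <= r ->
  (It (sp w) (fun c => (dball r (dinf (z + (-1) ^+ b *: vec c w)))%:E) c <= ((2 * r) ^+ n)%:E)%E.
Proof.
(* [zc] extends the coordinates of [z] by 0 to all natural indices, as [It_sp_prod] expects. *)
move=> r0; pose zc (i : nat) := oapp (z ord0) 0 (insub i).
pose g i (y : R) := dball r (distZ (zc i + (-1) ^+ b * y)).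
apply: (@le_trans _ _ (It (sp w) (fun c => (\prod_(i < n) g i (c (w, i.+1)))%:E) c)).
  apply: le_It => c'; first by rewrite lee_fin dball_ge0.
  rewrite lee_fin /dball; have [dr|_] := leP (dinf _) r; last first.
    by apply: prodr_ge0 => i _; exact: dball_ge0.
  rewrite big1// => i _; rewrite /g /dball (_ : distZ _ <= r)//.
  apply: le_trans dr; apply: le_trans (distZ_le_dinf _ i).
  by rewrite !mxE /zc valK.
have mg i : measurable_fun setT (g i).
  apply: (measurableT_comp (measurable_dball r)).
  apply: (measurableT_comp (@measurable_distZ R setT)).
  apply: measurable_funD; first exact: measurable_cst.
  by apply: measurable_funM; [exact: measurable_cst|exact: measurable_id].
rewrite It_sp_prod//.
rewrite -[n in (2 * r) ^+ n]card_ord -prodr_const; apply: prode_le => i _.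
  by apply: integral_ge0 => y _; rewrite lee_fin dball_ge0.
rewrite /g (integral_distZ_affine _ _ (measurable_dball r)); last exact: dball_ge0.
exact: integral_dball_distZ.
Qed.

End VectorKernel.

Section KernelBound.
Context {R : realType} {n : nat} {V : finType}.
Implicit Types (c : V * nat -> R) (w : V) (z : 'rV[R]_n).
Local Notation mu := (@lebesgue_measure R).
Local Notation vecn := (@vec R n V).
Local Notation spn := (@sp n V).

Lemma fmeas_dinf_affine z b w :
  fmeas (fun c => dinf (z + (-1) ^+ b *: vecn c w)).
Proof.
apply: fmeas_dinf => i.
rewrite (_ : (fun c => _) = fun c => z ord0 i + (-1) ^+ b * vecn c w ord0 i); last first.
  by apply/funext => c; rewrite !mxE.
apply: fmeasD_real; first exact: fmeas_cst.
by apply: fmeasM_real; [exact: fmeas_cst|exact: fmeas_vec].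
Qed.

Lemma dinf_sign z (b : bool) : dinf ((-1) ^+ b *: z) = dinf z.
Proof.
by case: b; [rewrite expr1 scaleN1r dinfN|rewrite expr0 scale1r].
Qed.

(** For j = 0 and j = 1 the total mass 16^n of the bump is enough, and this fixes the constant 32.
    For j >= 2 the ball has radius at most M/2, and on it h + dinf y >= M/2: either h = M, or y is
    at distance at least dinf z - M/2 from 0. So the bump is at most (2/M)^n there, and this is
    multiplied by the volume of the ball. *)
Lemma It_Q_dball w h z (b : bool) (M : R) (j : nat) c : (0 < n)%N -> 0 < h ->
  M = Num.max h (dinf z) ->
  (It (spn w) (fun c => (Q h (vecn c w))%:E *
       (dball (layer_radius M j) (dinf (z + (-1) ^+ b *: vecn c w)))%:E) c
    <= ((32 * 2^-1 ^+ j) ^+ n)%:E)%E.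
Proof.
move=> n0 h0 ME.
have M0 : 0 < M by rewrite ME lt_max h0.
have e0 i : 0 < (2^-1 : R) ^+ i by rewrite exprn_gt0.
have triv : (It (spn w) (fun c => (Q h (vecn c w))%:E *
       (dball (layer_radius M j) (dinf (z + (-1) ^+ b *: vecn c w)))%:E) c
    <= (16 ^+ n)%:E)%E.
  apply: le_trans (It_Q w c n0 h0).
  apply: le_It => c'; first by rewrite -EFinM lee_fin mulr_ge0 ?Q_ge0 ?dball_ge0.
  rewrite -EFinM lee_fin ler_piMr ?Q_ge0// /dball.
  by rewrite lern1 leq_b1.
case: j triv => [|[|j]] triv.
- by apply: le_trans triv _; rewrite lee_fin expr0 mulr1 lerXn2r ?nnegrE//; lra.
- by apply: le_trans triv _; rewrite lee_fin expr1 lerXn2r ?nnegrE//; lra.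
clear triv; set r := layer_radius M _.
have r0 : 0 <= r by rewrite /r /= mulr_ge0 ?ltW.
have rM : r <= M / 2.
  rewrite /r /= exprS mulrA ler_piMr//; first by rewrite divr_ge0 ?ltW.
  by rewrite exprn_ile1//; lra.
apply: (@le_trans _ _ (It (spn w) (fun c => ((2 / M) ^+ n)%:E *
       (dball r (dinf (z + (-1) ^+ b *: vecn c w)))%:E) c)%E).
  apply: le_It => c'; first by rewrite -EFinM lee_fin mulr_ge0 ?Q_ge0 ?dball_ge0.
  rewrite -!EFinM lee_fin /dball; have [dr|_] := leP (dinf _) r; last by rewrite !mulr0.
  rewrite !mulr1; apply: le_trans (Q_le_dinf _ h0) _.
  have hd : M / 2 <= h + dinf (vecn c' w).
    have := dinfD (z + (-1) ^+ b *: vecn c' w) (- ((-1) ^+ b *: vecn c' w)).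
    rewrite addrK dinfN dinf_sign => zd.
    have := dinf_ge0 (vecn c' w); have := dinf_ge0 z.
    move: ME; rewrite maxEle; case: ifP => _; lra.
  rewrite -exprVn lerXn2r ?nnegrE ?invr_ge0 ?divr_ge0 ?(ltW M0)//.
    by rewrite addr_ge0 ?dinf_ge0 ?ltW.
  rewrite -[2 / M]invrK invfM invrK lef_pV2 ?posrE; first by rewrite mulrC.
    by rewrite (lt_le_trans _ hd)// divr_gt0.
  by rewrite mulrC divr_gt0.
have mB : fmeas (fun c => (dball r (dinf (z + (-1) ^+ b *: vecn c w)))%:E).
  apply: fmeas_EFin; apply: (fmeas_comp (f := dball r)) => //; first exact: measurable_dball.
  exact: fmeas_dinf_affine.
rewrite (@It_mull _ _ _ (fun=> ((2 / M) ^+ n)%:E))//.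
- apply: (@le_trans _ _ (((2 / M) ^+ n)%:E * ((2 * r) ^+ n)%:E)%E).
    apply: lee_wpmul2l; first by rewrite lee_fin exprn_ge0// divr_ge0 ?ltW.
    exact: It_dball.
  rewrite -EFinM lee_fin -exprMn.
  have [x0 y0] : 0 <= 2 / M * (2 * r) /\ 0 <= 32 * (2^-1 : R) ^+ j.+2.
    split; last by rewrite mulr_ge0// ltW.
    by rewrite mulr_ge0 ?divr_ge0 ?(ltW M0)// mulr_ge0.
  apply: lerXn2r => //.
  rewrite /r /= (_ : 2 / M * _ = 4 * 2^-1 ^+ j.+1 * (M / M)); last by ring.
  rewrite divff ?lt0r_neq0// mulr1 (exprS _ j.+1); have := e0 j.+1; lra.
- by move=> c'; rewrite lee_fin dball_ge0.
- by move=> c'; rewrite lee_fin exprn_ge0// divr_ge0 ?ltW.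
Qed.

(** Sum over j of (32 * 2^-j)^n * 2^(j a), the layers of the singularity weighted by the mass of the
    bump on them; a geometric series that converges because a < n. *)
Definition kerC (a : R) : R := 32 ^+ n / (1 - 2^-1 `^ (n%:R - a)).

Lemma kerC_ratio (a : R) : a < n%:R -> 0 <= (2^-1 : R) `^ (n%:R - a) < 1.
Proof.
move=> an; rewrite powR_ge0/=.
have : (2^-1 : R) `^ (n%:R - a) < 1 `^ (n%:R - a).
  by apply: gt0_ltr_powR; rewrite ?nnegrE ?subr_gt0//; lra.
by rewrite powR1.
Qed.

Lemma kerC_ge0 (a : R) : a < n%:R -> 0 <= kerC a.
Proof.
by move=> /kerC_ratio/andP[_ r1]; rewrite divr_ge0 ?exprn_ge0// subr_ge0 ltW.
Qed.

(** Smoothing |z|^-a at scale h. The maximum is kept because it is used in two ways: bounded below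
    by h it removes the singularity at the price h^-a, bounded below by [dinf z] it preserves the
    singularity for later integrations. *)
Lemma It_Q_S w h z (b : bool) (a : R) c : 0 < h <= 1 -> 0 <= a < n%:R ->
  (It (spn w) (fun c => (Q h (vecn c w))%:E * S a (dinf (z + (-1) ^+ b *: vecn c w))) c
    <= (kerC a * (Num.max h (dinf z)) `^ (- a))%:E)%E.
Proof.
move=> /andP[h0 h1] /andP[a0 an]; set M := Num.max h (dinf z).
have n0 : (0 < n)%N by rewrite -(ltr_nat R); exact: le_lt_trans a0 an.
have M0 : 0 < M by rewrite lt_max h0.
have M1 : M <= 1 by rewrite ge_max h1 dinf_le1.
have e0 i : 0 < (2^-1 : R) ^+ i by rewrite exprn_gt0.
pose F j c : \bar R := (((M * 2^-1 ^+ j) `^ (- a))%:E *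
  ((Q h (vecn c w))%:E * (dball (layer_radius M j) (dinf (z + (-1) ^+ b *: vecn c w)))%:E))%E.
have F0' j c' : (0 <= (Q h (vecn c' w))%:E * (dball (layer_radius M j) (dinf (z + (-1) ^+ b *: vecn c' w)))%:E)%E.
  by rewrite -EFinM lee_fin mulr_ge0 ?Q_ge0 ?dball_ge0.
have F0 j c' : (0 <= F j c')%E by rewrite mule_ge0// lee_fin powR_ge0.
have mF' j : fmeas (fun c => (Q h (vecn c w))%:E * (dball (layer_radius M j) (dinf (z + (-1) ^+ b *: vecn c w)))%:E)%E.
  apply: fmeasM; first by apply: fmeas_EFin; exact: fmeas_Q_vec.
  apply: fmeas_EFin; apply: (fmeas_comp (f := dball _)) => //; first exact: measurable_dball.
  exact: fmeas_dinf_affine.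
have mF j : fmeas (F j) by apply: fmeasM => //; exact: fmeas_cst.
apply: (@le_trans _ _ (It (spn w) (fun c => \sum_(0 <= j <oo) F j c) c)%E).
  apply: le_It => c'; first by rewrite mule_ge0 ?S_ge0// lee_fin Q_ge0.
  rewrite (eq_eseriesr (g := fun j => ((Q h (vecn c' w))%:E * ((M * 2^-1 ^+ j) `^ (- a) *
     dball (layer_radius M j) (dinf (z + (-1) ^+ b *: vecn c' w)))%:E)%E)); last first.
    by move=> j _; rewrite /F EFinM muleCA.
  rewrite nneseriesZl; last by move=> j _; rewrite lee_fin mulr_ge0 ?powR_ge0 ?dball_ge0.
  apply: lee_wpmul2l; first by rewrite lee_fin Q_ge0.
  by apply: S_layer; rewrite ?M0 ?dinf_ge0 ?dinf_le1.
rewrite It_nneseries//.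
apply: (@le_trans _ _ (\sum_(0 <= j <oo) (32 ^+ n * M `^ (- a) * (2^-1 `^ (n%:R - a)) ^+ j)%:E)%E).
  apply: lee_nneseries => [j _ _|j _]; first exact: It_ge0.
  rewrite (@It_mull _ _ _ (fun=> ((M * 2^-1 ^+ j) `^ (- a))%:E))//; last first.
    by move=> c'; rewrite lee_fin powR_ge0.
  apply: (@le_trans _ _ (((M * 2^-1 ^+ j) `^ (- a))%:E * ((32 * 2^-1 ^+ j) ^+ n)%:E)%E).
    by apply: lee_wpmul2l; [rewrite lee_fin powR_ge0|exact: It_Q_dball].
  rewrite -EFinM lee_fin powRM ?(ltW M0) ?(ltW (e0 j))// exprMn.
  rewrite -(powRX (n%:R - a) j)//.
  rewrite addrC powRD; last by rewrite lt0r_neq0 ?implybT.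
  rewrite powR_mulrn ?(ltW (e0 j))//.
  by rewrite le_eqVlt; apply/orP; left; apply/eqP; ring.
apply: le_trans (geometric_series_le _ (kerC_ratio an)) _.
  by rewrite mulr_ge0 ?powR_ge0 ?exprn_ge0.
by rewrite lee_fin /kerC mulrAC.
Qed.

End KernelBound.

Section Locality.
Context {R : realType} {I : eqType}.
Implicit Types (c : I -> R) (F G : (I -> R) -> \bar R).

Definition agree (s : seq I) c c' := forall i, i \notin s -> c' i = c i.

Lemma agree_upd s i c c' y : agree s (upd c i y) c' -> agree (i :: s) c c'.
Proof.
by move=> H j; rewrite inE negb_or => /andP[ji js]; rewrite H// /upd (negbTE ji).
Qed.

(** The comparison is only asked of the families that the integration reaches: unchanged outside
    [s], with values in the unit interval on [s]. The estimates of the kernels hold only there. *)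
Lemma le_It_on s F G c :
  (forall c', agree s c c' -> (forall i, i \in s -> 0 <= c' i < 1) ->
     (0 <= F c')%E /\ (F c' <= G c')%E) ->
  ((0 <= It s F c)%E /\ (It s F c <= It s G c)%E).
Proof.
elim: s c => [|i s IH] c FG /=; first by apply: FG => // i.
have H y : `[0, 1[%classic y ->
    (0 <= It s F (upd c i y))%E /\ (It s F (upd c i y) <= It s G (upd c i y))%E.
  rewrite /= in_itv /= => y01; apply: IH => c' ac' c01; apply: FG; first exact: agree_upd ac'.
  move=> j; rewrite inE; have [js _|js] := boolP (j \in s); first exact: c01.
  by rewrite orbF => /eqP ->; have [is'|is'] := boolP (i \in s); [exact: c01|rewrite (ac' i)// /upd eqxx].
split; first by apply: integral_ge0 => y /H[].
by apply: le_Op => y /H[].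
Qed.

Lemma eq_It_on s F G c : (forall c', agree s c c' -> F c' = G c') -> It s F c = It s G c.
Proof.
elim: s c => [|i s IH] c FG /=; first by apply: FG => // i.
apply: eq_integral => y _; apply: IH => c' ac'; apply: FG; exact: agree_upd ac'.
Qed.

End Locality.

(** * Integrating out the contracting edges *)

Section Elimination.
Context {R : realType} {n : nat} {V : finType}.
Implicit Types (c : V * nat -> R) (w : V) (z : 'rV[R]_n) (ws : seq V) (sg : V -> R).
Local Notation vecn := (@vec R n V).
Local Notation spn := (@sp n V).
Variable h : V -> R.
Hypothesis h01 : forall w, 0 < h w <= 1.
Hypothesis n0 : (0 < n)%N.

Definition sps ws : seq (V * nat) := flatten [seq spn w | w <- ws].

Lemma sps_cat ws1 ws2 : sps (ws1 ++ ws2) = sps ws1 ++ sps ws2.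
Proof. by rewrite /sps map_cat flatten_cat. Qed.

Lemma perm_sps ws1 ws2 : perm_eq ws1 ws2 -> perm_eq (sps ws1) (sps ws2).
Proof. by move=> p; apply: perm_flatten; exact: perm_map. Qed.

Lemma mem_sps (i : V * nat) ws : i \in sps ws -> i.1 \in ws.
Proof. by move/flattenP => [_ /mapP[w ws_w ->]] /mapP[k _ ->]. Qed.

Lemma mem_sp (i : V * nat) w : i \in spn w -> i.1 = w.
Proof. by move=> /mapP[k _ ->]. Qed.

Lemma vec_upd c (i : V * nat) y w : w != i.1 -> vecn (upd c i y) w = vecn c w.
Proof.
move=> wi; apply/rowP => k; rewrite !mxE /upd; case: eqP => // E.
by move: wi; rewrite -E eqxx.
Qed.

Lemma vec_agree s c c' w : agree s c c' -> (forall i, i \in s -> i.1 != w) ->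
  vecn c' w = vecn c w.
Proof.
move=> ac sw; apply/rowP => k; rewrite !mxE ac//; apply/negP => /sw.
by rewrite eqxx.
Qed.

(** The argument of the singularity of a contracting edge in terms of the increments: [z] will be
    the difference of two root positions, and [sg w] the coefficient of the increment of [w]. *)
Definition lin z sg c : 'rV[R]_n := z + \sum_(w : V) sg w *: vecn c w.

Definition sign0 (x : R) := (x == 0) || (x == 1) || (x == -1).

Lemma fmeas_lin z sg i : fmeas (fun c => lin z sg c ord0 i).
Proof.
rewrite (_ : (fun c => _) = fun c => z ord0 i + \sum_(w : V) sg w * vecn c w ord0 i).
  apply: fmeasD_real; first exact: fmeas_cst.
  apply: fmeas_sum_real => w; apply: fmeasM_real; first exact: fmeas_cst.
  exact: fmeas_vec.
by apply/funext => c; rewrite !mxE summxE; congr (_ + _); apply: eq_bigr => w _; rewrite !mxE.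
Qed.

Lemma fmeas_S_lin a z sg : fmeas (fun c => S a (dinf (lin z sg c))).
Proof.
apply: (fmeas_comp (f := S a)) => //; first exact: measurable_S.
apply: fmeas_dinf; exact: fmeas_lin.
Qed.

Lemma lin_upd z sg c (i : V * nat) y : sg i.1 = 0 -> lin z sg (upd c i y) = lin z sg c.
Proof.
move=> si; congr (_ + _); apply: eq_bigr => w _.
by have [->|wi] := eqVneq w i.1; [rewrite si !scale0r|rewrite vec_upd].
Qed.

Definition drop_sg (s : pred V) sg : V -> R := fun w => if s w then 0 else sg w.

Lemma lin_split z sg c p : lin z sg c = lin z (drop_sg (pred1 p) sg) c + sg p *: vecn c p.
Proof.
rewrite /lin -addrA; congr (_ + _).
rewrite (bigD1 p)//= [in RHS](bigD1 p)//= /drop_sg /= eqxx scale0r add0r addrC.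
by congr (_ + _); apply: eq_bigr => w /negbTE wp; rewrite wp.
Qed.

Lemma It_pivot p a z sg c : sg p = 1 \/ sg p = -1 -> 0 <= a < n%:R ->
  (It (spn p) (fun c => (Q (h p) (vecn c p))%:E * S a (dinf (lin z sg c))) c
    <= (kerC (n := n) a * (Num.max (h p) (dinf (lin z (drop_sg (pred1 p) sg) c))) `^ (- a))%:E)%E.
Proof.
move=> sp1 a0.
have [b sb] : exists b : bool, sg p = (-1) ^+ b.
  by case: sp1 => ->; [exists false|exists true].
apply: le_trans (It_Q_S p (lin z (drop_sg (pred1 p) sg) c) b c (h01 p) a0).
rewrite (eq_It_on (G := fun c' => ((Q (h p) (vecn c' p))%:E *
   S a (dinf (lin z (drop_sg (pred1 p) sg) c + (-1) ^+ b *: vecn c' p)))%E))//.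
move=> c' ac; rewrite (lin_split z sg c' p) sb; congr (_ * S a (dinf (_ + _)))%E.
congr (_ + _); apply: eq_bigr => w _; rewrite /drop_sg /=.
case: eqVneq => [_|wp]; first by rewrite !scale0r.
rewrite (vec_agree ac)// => i /mem_sp ->.
by rewrite eq_sym.
Qed.

(** Price of one vertex in the terminal integration: 16^n, the mass of the bump, if its increment
    does not occur in the remaining singularity, and [kerC th] if it does. *)
Definition termC (th : R) : R := Num.max (16 ^+ n) (kerC (n := n) th).

Lemma termC_ge1 th : 1 <= termC th.
Proof. by rewrite le_max exprn_ege1//; lra. Qed.

Definition Qprod ws c : \bar R := (\prod_(w <- ws) (Q (h w) (vecn c w))%:E)%E.

Lemma Q_ge0E w c : (0 <= (Q (h w) (vecn c w))%:E)%E.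
Proof. by rewrite lee_fin Q_ge0//; case/andP: (h01 w). Qed.

Lemma Qprod_ge0 ws c : (0 <= Qprod ws c)%E.
Proof. by apply: prode_ge0 => w _; exact: Q_ge0E. Qed.

Lemma fmeas_QE w : fmeas (fun c => (Q (h w) (vecn c w))%:E).
Proof. by apply: fmeas_EFin; exact: fmeas_Q_vec. Qed.

Lemma fmeas_Qprod ws : fmeas (Qprod ws).
Proof. by apply: fmeas_prod => w; exact: fmeas_QE. Qed.

Lemma Qprod_upd ws c (i : V * nat) y : i.1 \notin ws -> Qprod ws (upd c i y) = Qprod ws c.
Proof.
move=> iw; apply: eq_big_seq => w ww; rewrite vec_upd//.
by apply: contraNneq iw => <-.
Qed.

Lemma Q_upd w c (i : V * nat) y : i.1 != w ->
  (Q (h w) (vecn (upd c i y) w))%:E = (Q (h w) (vecn c w))%:E.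
Proof. by move=> iw; rewrite vec_upd// eq_sym. Qed.

(** Each integration keeps a singularity of the same exponent, by the lower bound [dinf z] of the
    maximum in [It_Q_S]. When all of [ws] is integrated, their coefficients have been erased from
    the argument. *)
Lemma It_terminal ws th z sg c : uniq ws -> 0 <= th < n%:R ->
  (forall w, sign0 (sg w)) ->
  (It (sps ws) (fun c => Qprod ws c * S th (dinf (lin z sg c))) c
   <= (termC th ^+ size ws)%:E * S th (dinf (lin z (drop_sg (mem ws) sg) c)))%E.
Proof.
move=> uws th0; elim: ws sg c uws => [|w ws IH] sg c /=.
  move=> _ _; rewrite mul1e /Qprod big_nil mul1e.
  suff -> : drop_sg (mem [::]) sg = sg by [].
  by apply/funext => w; rewrite /drop_sg.
move=> /andP[wws uws] s0.
pose F c := (Qprod ws c * S th (dinf (lin z sg c)))%E.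
have F0 c' : (0 <= F c')%E by rewrite /F mule_ge0 ?Qprod_ge0 ?S_ge0.
have mF : fmeas F by apply: fmeasM; [exact: fmeas_Qprod|exact: fmeas_S_lin].
rewrite [sps _]/sps /= It_cat -/(sps ws).
set K := termC th; have K1 : 1 <= K := termC_ge1 th.
have Kk : 0 <= K ^+ size ws by rewrite exprn_ge0// (le_trans ler01).
pose sg' := drop_sg (mem ws) sg.
apply: (@le_trans _ _ (It (spn w) (fun c => (K ^+ size ws)%:E *
   ((Q (h w) (vecn c w))%:E * S th (dinf (lin z sg' c)))) c)%E).
  apply: le_It => c'.
    by apply: It_ge0 => c''; rewrite mule_ge0 ?Qprod_ge0 ?S_ge0.
  rewrite (@eq_It _ _ _ _ (fun c => ((Q (h w) (vecn c w))%:E * F c)%E)); last first.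
    by move=> c''; rewrite /F /Qprod big_cons muleA.
  rewrite It_mull//; first last.
  - move=> i c'' y /mem_sps iws; rewrite Q_upd//.
    by apply: contraNneq wws => <-.
  - by move=> c''; exact: Q_ge0E.
  rewrite muleCA; apply: lee_wpmul2l; first exact: Q_ge0E.
  exact: IH.
rewrite (@It_mull _ _ _ (fun=> (K ^+ size ws)%:E))//; first last.
- by apply: fmeasM; [exact: fmeas_QE|exact: fmeas_S_lin].
- by move=> c'; rewrite mule_ge0 ?S_ge0 ?Q_ge0E.
rewrite exprSr EFinM -muleA; apply: lee_wpmul2l; first by rewrite lee_fin.
have -> : drop_sg (mem (w :: ws)) sg = drop_sg (pred1 w) sg'.
  by apply/funext => v; rewrite /drop_sg /= inE; case: eqVneq.
have sgw : sg' w = sg w by rewrite /sg' /drop_sg /= (negbTE wws).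
set L := lin z (drop_sg (pred1 w) sg') c.
have [/eqP sw0|sw] := boolP (sg w == 0).
  have -> : sg' = drop_sg (pred1 w) sg'.
    by apply/funext => v; rewrite /drop_sg /=; case: eqVneq => // ->; rewrite -sw0 -sgw.
  rewrite (eq_It_on (G := fun c' => (S th (dinf L) * (Q (h w) (vecn c' w))%:E)%E)); last first.
    move=> c' ac; rewrite muleC; congr (S th (dinf _) * _)%E.
    congr (_ + _); apply: eq_bigr => v _; rewrite /drop_sg /=.
    case: eqVneq => [_|vw]; first by rewrite !scale0r.
    by rewrite (vec_agree ac)// => i /mem_sp ->; rewrite eq_sym.
  rewrite (@It_mull _ _ _ (fun=> S th (dinf L)))//; first last.
  - by move=> c'; exact: S_ge0.
  - exact: fmeas_QE.
  - by move=> c'; exact: Q_ge0E.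
  rewrite muleC; apply: lee_wpmul2r; first exact: S_ge0.
  have /andP[hw0 _] := h01 w; apply: le_trans (It_Q w c n0 hw0) _.
  by rewrite lee_fin le_max lexx.
apply: (le_trans (It_pivot z c _ th0)).
  rewrite sgw; move: (s0 w) sw; rewrite /sign0 => /orP[/orP[->//|/eqP]|/eqP]; tauto.
rewrite -/L /S; case: eqVneq => [_|dL].
  by rewrite gt0_muley ?leey// lte_fin (lt_le_trans ltr01).
have /andP[_ thn] := th0; have /andP[th00 _] := th0.
rewrite -EFinM lee_fin ler_pM ?powR_ge0 ?kerC_ge0//.
  by rewrite le_max lexx orbT.
apply: powR_le_neg => //; last by rewrite le_max lexx orbT.
by rewrite lt_def dL dinf_ge0.
Qed.

End Elimination.

Section EliminationMany.
Context {R : realType} {n : nat} {V : finType} {E : eqType}.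
Implicit Types (c : V * nat -> R) (w : V) (z : 'rV[R]_n) (ws : seq V) (es : seq E).
Local Notation vecn := (@vec R n V).
Local Notation spn := (@sp n V).
Local Notation spsn := (@sps n V).
Local Notation Qprodn := (@Qprod R n V).
Variable h : V -> R.
Hypothesis h01 : forall w, 0 < h w <= 1.
Hypothesis n0 : (0 < n)%N.

Lemma lin0 z sg c : (forall w, sg w = 0) -> lin z sg c = z.
Proof.
by move=> s0; rewrite /lin big1 ?addr0// => w _; rewrite s0 scale0r.
Qed.

(** At [p] the exponent is split as a = (a - th) + th: the first part is estimated by the scale
    [h p], the second by the distance that remains. The other vertices then carry the exponent th
    along. *)
Lemma It_terminal_pivot ws p th a z (sg : V -> R) c : uniq ws -> p \in ws ->
  sg p = 1 \/ sg p = -1 -> (forall w, sign0 (sg w)) ->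
  0 <= th <= a -> a < n%:R ->
  (It (spsn ws) (fun c => Qprodn h ws c * S a (dinf (lin z sg c))) c
   <= (kerC (n := n) a * h p `^ (- (a - th)) * termC (n := n) th ^+ size ws)%:E
      * S th (dinf (lin z (drop_sg (mem ws) sg) c)))%E.
Proof.
move=> uws pws sp s0 /andP[th0 tha] an.
have a0 : 0 <= a := le_trans th0 tha.
have a0n : 0 <= a < n%:R by rewrite a0.
have th0n : 0 <= th < n%:R by rewrite th0 (le_lt_trans tha).
have /andP[hp0 hp1] := h01 p.
set ws1 := rem p ws.
have pw : perm_eq ws (ws1 ++ [:: p]) by rewrite perm_sym perm_catC perm_sym perm_to_rem.
have uws1 : uniq ws1 by exact: rem_uniq.
have pws1 : p \notin ws1 by rewrite mem_rem_uniq// inE eqxx.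
pose G c := (S a (dinf (lin z sg c))).
have mG : fmeas G by exact: fmeas_S_lin.
have F0 c' : (0 <= Qprodn h ws c' * G c')%E by rewrite mule_ge0 ?Qprod_ge0 ?S_ge0.
have mF : fmeas (fun c => Qprodn h ws c * G c)%E by apply: fmeasM => //; exact: fmeas_Qprod.
rewrite (It_perm F0 mF (perm_sps pw)) sps_cat It_cat.
set B := kerC a * h p `^ (- (a - th)).
have B0 : 0 <= B by rewrite mulr_ge0 ?kerC_ge0 ?powR_ge0.
pose sg' := drop_sg (pred1 p) sg.
apply: (@le_trans _ _ (It (spsn ws1) (fun c => B%:E * (Qprodn h ws1 c * S th (dinf (lin z sg' c)))) c)%E).
  apply: le_It => c'; first exact: It_ge0.
  rewrite {1}/sps /= cats0.
  rewrite (@eq_It _ _ _ _ (fun c => (Qprodn h ws1 c * ((Q (h p) (vecn c p))%:E * G c))%E)); last first.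
    move=> c''; rewrite /Qprod (perm_big _ pw)/= big_cat /= big_seq1.
    by rewrite muleA.
  rewrite It_mull//; first last.
  - by move=> i c'' y /mem_sp ip; rewrite Qprod_upd// ip.
  - by move=> c''; exact: Qprod_ge0.
  - by apply: fmeasM => //; exact: fmeas_QE.
  - by move=> c''; rewrite mule_ge0 ?S_ge0 ?Q_ge0E.
  rewrite muleCA; apply: lee_wpmul2l; first exact: Qprod_ge0.
  apply: (le_trans (It_pivot h01 z c' sp a0n)).
  rewrite -/sg' /S; case: eqVneq => [_|dL].
    rewrite /B; have [->|k0] := eqVneq (@kerC R n a) 0.
      by rewrite !mul0r mul0e.
    by rewrite gt0_muley ?leey// lte_fin mulr_gt0 ?powR_gt0// lt_def k0 kerC_ge0.
  rewrite -EFinM lee_fin /B -[leRHS]mulrA; apply: ler_wpM2l; first exact: kerC_ge0.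
  set M := Num.max _ _; have M0 : 0 < M by rewrite lt_max hp0.
  rewrite {1}(_ : - a = - (a - th) + - th); last by ring.
  rewrite powRD; last by rewrite lt0r_neq0 ?implybT.
  apply: ler_pM; rewrite ?powR_ge0//; apply: powR_le_neg => //.
  - by rewrite le_max lexx.
  - by rewrite subr_ge0.
  - by rewrite lt_def dL dinf_ge0.
  - by rewrite le_max lexx orbT.
clear F0 mF mG; clearbody B.
have mT : fmeas (fun c => Qprodn h ws1 c * S th (dinf (lin z sg' c)))%E.
  by apply: fmeasM; [exact: fmeas_Qprod|exact: fmeas_S_lin].
have T0 c' : (0 <= Qprodn h ws1 c' * S th (dinf (lin z sg' c')))%E.
  by rewrite mule_ge0 ?Qprod_ge0 ?S_ge0.
rewrite (It_mull (K := fun=> B%:E) c T0 mT)//.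
rewrite EFinM -muleA; apply: lee_wpmul2l => //.
have s0' w : sign0 (sg' w) by rewrite /sg' /drop_sg; case: ifP => //; rewrite /sign0 eqxx.
apply: (le_trans (It_terminal h01 n0 z c uws1 th0n s0')).
have -> : drop_sg (mem ws1) sg' = drop_sg (mem ws) sg.
  apply/funext => w; rewrite /sg' /drop_sg /= mem_rem_uniq// inE /=.
  by have [->|wp] := eqVneq w p; rewrite /= ?pws ?eqxx.
apply: lee_wpmul2r; first exact: S_ge0.
rewrite lee_fin; apply: ler_weXn2l; first exact: termC_ge1.
by rewrite size_rem// leq_pred.
Qed.

Variables (a : E -> R) (zz : E -> 'rV[R]_n) (sg : E -> V -> R) (pv : E -> V).
Variable Phi : (V * nat -> R) -> \bar R.
Hypothesis Phi0 : forall c, (0 <= Phi c)%E.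
Hypothesis mPhi : fmeas Phi.

Definition Sprod es c : \bar R := (\prod_(e <- es) S (a e) (dinf (lin (zz e) (sg e) c)))%E.

Lemma Sprod_ge0 es c : (0 <= Sprod es c)%E.
Proof. by apply: prode_ge0 => e _; exact: S_ge0. Qed.

Lemma fmeas_Sprod es : fmeas (Sprod es).
Proof. by apply: fmeas_prod => e; exact: fmeas_S_lin. Qed.

(** The pairwise hypothesis is triangularity: an earlier edge has coefficient 0 at the pivot of a
    later one. Hence the increment at the pivot of the last edge occurs in no other singularity and
    not in [Phi], and its integration leaves a constant; the induction removes edges from the end of
    the list. *)
Lemma It_eliminate es ws c : uniq ws ->
  (forall e, e \in es -> [/\ pv e \in ws, sg e (pv e) = 1 \/ sg e (pv e) = -1,
     0 <= a e < n%:R &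
     forall (i : V * nat) c y, i.1 = pv e -> Phi (upd c i y) = Phi c]) ->
  pairwise (fun e e' => sg e (pv e') == 0) es ->
  (It (spsn ws) (fun c => Qprodn h ws c * (Sprod es c * Phi c)) c
   <= (\prod_(e <- es) (kerC (n := n) (a e) * h (pv e) `^ (- a e)))%:E *
      It (spsn [seq w <- ws | w \notin map pv es])
         (fun c => Qprodn h [seq w <- ws | w \notin map pv es] c * Phi c) c)%E.
Proof.
elim/last_ind: es ws c => [|es e IH] ws c uws esP pw.
  rewrite big_nil mul1e (eq_filter (a2 := xpredT)) ?filter_predT//.
  rewrite (@eq_It _ _ _ _ (fun c => (Qprodn h ws c * Phi c))%E)//.
  by move=> c'; rewrite /Sprod big_nil mul1e.
move: pw; rewrite pairwise_rcons => /andP[/allP ep pw].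
have eres : e \in rcons es e by rewrite mem_rcons mem_head.
have [pws sp a01 Pp] := esP e eres; set p := pv e in pws sp Pp ep.
have /andP[a0 an] := a01; have /andP[hp0 hp1] := h01 p.
set ws1 := rem p ws.
have pw' : perm_eq ws (ws1 ++ [:: p]) by rewrite perm_sym perm_catC perm_sym perm_to_rem.
have uws1 : uniq ws1 by exact: rem_uniq.
have pws1 : p \notin ws1 by rewrite mem_rem_uniq// inE eqxx.
have mQS : fmeas (fun c => (Q (h p) (vecn c p))%:E * S (a e) (dinf (lin (zz e) (sg e) c)))%E.
  by apply: fmeasM; [exact: fmeas_QE|exact: fmeas_S_lin].
have QS0 c' : (0 <= (Q (h p) (vecn c' p))%:E * S (a e) (dinf (lin (zz e) (sg e) c')))%E.
  by rewrite mule_ge0 ?S_ge0 ?Q_ge0E.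
have KE i c'' y : i \in spn p ->
    (Qprodn h ws1 (upd c'' i y) * (Sprod es (upd c'' i y) * Phi (upd c'' i y)) =
     Qprodn h ws1 c'' * (Sprod es c'' * Phi c''))%E.
  move=> /mem_sp ip; rewrite (Pp i c'' y ip) Qprod_upd; last by rewrite ip.
  have -> : Sprod es (upd c'' i y) = Sprod es c''; last by [].
  apply: eq_big_seq => e' e'es; rewrite lin_upd; first by [].
  by rewrite ip; apply/eqP; exact: ep.
have F0 es' ws' c' : (0 <= Qprodn h ws' c' * (Sprod es' c' * Phi c'))%E.
  by rewrite !mule_ge0 ?Qprod_ge0 ?Sprod_ge0.
have mF es' ws' : fmeas (fun c => Qprodn h ws' c * (Sprod es' c * Phi c))%E.
  apply: fmeasM; first exact: fmeas_Qprod.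
  by apply: fmeasM => //; exact: fmeas_Sprod.
rewrite (It_perm (F0 _ _) (mF _ _) (perm_sps pw')) sps_cat It_cat.
pose B : R := @kerC R n (a e) * h p `^ (- a e).
have B0 : 0 <= B by rewrite mulr_ge0 ?kerC_ge0 ?powR_ge0.
apply: (@le_trans _ _ (It (spsn ws1) (fun c => B%:E * (Qprodn h ws1 c * (Sprod es c * Phi c))) c)%E).
  apply: le_It => c'; first by apply: It_ge0; exact: F0.
  rewrite {1}/sps /= cats0.
  rewrite (@eq_It _ _ _ _ (fun c => ((Qprodn h ws1 c * (Sprod es c * Phi c)) *
     ((Q (h p) (vecn c p))%:E * S (a e) (dinf (lin (zz e) (sg e) c))))%E)); last first.
    move=> c''; rewrite /Qprod (perm_big _ pw')/= big_cat /= big_seq1.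
    rewrite /Sprod -cats1 big_cat big_seq1 /= -!muleA; congr (_ * _)%E.
    by rewrite muleCA; congr (_ * _)%E; rewrite muleA muleC.
  rewrite (It_mull c' QS0 mQS (F0 es ws1) KE).
  rewrite muleC; apply: lee_wpmul2r; first exact: F0.
  apply: (le_trans (It_pivot h01 (zz e) c' sp a01)).
  rewrite lee_fin; apply: ler_wpM2l; first exact: kerC_ge0.
  by apply: powR_le_neg => //; rewrite le_max lexx.
have -> : \prod_(e <- rcons es e) (@kerC R n (a e) * h (pv e) `^ (- a e)) =
    B * \prod_(e <- es) (@kerC R n (a e) * h (pv e) `^ (- a e)).
  by rewrite -cats1 big_cat big_seq1 /= mulrC.
clear QS0 mQS KE; clearbody B.
have B0E (c' : V * nat -> R) : (0 <= B%:E)%E by rewrite lee_fin.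
rewrite (It_mull (K := fun=> B%:E) c (F0 es ws1) (mF es ws1) B0E (fun _ _ _ _ => erefl)).
have esP' e' : e' \in es -> [/\ pv e' \in ws1, sg e' (pv e') = 1 \/ sg e' (pv e') = -1,
     0 <= a e' < n%:R &
     forall (i : V * nat) c y, i.1 = pv e' -> Phi (upd c i y) = Phi c].
  move=> e'es; have /esP[q1 q2 q3 q4] : e' \in rcons es e by rewrite mem_rcons inE e'es orbT.
  (* A pivot shared with the removed edge would have coefficient 0 by triangularity and 1 or -1 by
     assumption. *)
  split=> //; rewrite mem_rem_uniq// inE /= q1 andbT; apply/eqP => qE.
  have := ep _ e'es; rewrite -qE => /eqP s0; move: q2; rewrite s0.
  by case=> /eqP; rewrite eq_sym ?oppr_eq0 oner_eq0.
rewrite EFinM -muleA; apply: lee_wpmul2l; first exact: B0E.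
apply: le_trans (IH ws1 c uws1 esP' pw) _; rewrite -cats1.
have -> // : [seq w <- ws1 | w \notin map pv es] = [seq w <- ws | w \notin map pv (es ++ [:: e])].
rewrite /ws1 rem_filter// -filter_predI; apply: eq_filter => w /=.
by rewrite map_cat mem_cat negb_or /= inE.
Qed.

End EliminationMany.

(** * Passage from positions to increments along the trees *)

Section Shear.
Context {R : realType} {I : eqType}.
Implicit Types (c : I -> R) (F : (I -> R) -> \bar R) (s : seq I).
Local Notation D := `[0%R, 1%R[%classic.
Variable tau : I -> I.

(** No element is followed in the list by its image under [t]. Since the head of the list is the
    outermost integral, the position of a parent is fixed when its child is integrated. *)
Fixpoint topo (J : eqType) (t : J -> J) (s : seq J) : bool :=
  if s is i :: s' then [&& i \notin s', t i != i, t i \notin s' & topo t s'] else true.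

(* The substitution x_w = x_(tau w) + y_w. *)
Fixpoint shear s c : I -> R :=
  if s is i :: s' then shear s' (upd c i (c i + c (tau i))) else c.

Lemma shear_notin s c j : j \notin s -> shear s c j = c j.
Proof.
elim: s c => //= i s IH c; rewrite inE negb_or => /andP[ji js].
by rewrite IH// /upd (negbTE ji).
Qed.

Lemma shear_in s c j : topo tau s -> j \in s -> shear s c j = c j + shear s c (tau j).
Proof.
elim: s c => //= i s IH c /and4P[ins ti ts tops]; rewrite inE.
have [-> _|ji /= js] := eqVneq j i.
  by rewrite !shear_notin// /upd eqxx (negbTE ti).
by rewrite IH// {1}/upd (negbTE ji).
Qed.

Lemma It_commute s F (phi : (I -> R) -> (I -> R)) c :
  (forall c j y, j \in s -> phi (upd c j y) = upd (phi c) j y) ->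
  It s F (phi c) = It s (F \o phi) c.
Proof.
elim: s c => //= i s IH c H; apply: eq_integral => y _.
rewrite -H ?mem_head// IH// => c' j y' js.
by rewrite H// inE js orbT.
Qed.

Lemma It_periodic s F i : i \notin s ->
  (forall c, F (upd c i (c i + 1)) = F c) ->
  forall c, It s F (upd c i (c i + 1)) = It s F c.
Proof.
move=> ins pF c.
rewrite (It_commute F (phi := fun c => upd c i (c i + 1))).
  by apply: eq_It => c' /=; exact: pF.
move=> c' j y js; have ji : j != i by apply: contraNneq ins => <-.
have E : upd c' j y i = c' i by rewrite /upd eq_sym (negbTE ji).
by rewrite E upd_swap.
Qed.

Lemma fmeas_shear s F : fmeas F -> fmeas (fun c => F (shear s c)).
Proof.
elim: s F => //= i s IH F mF; apply: (fmeas_upd (F := fun c => F (shear s c))).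
  exact: IH.
by apply: fmeasD_real; exact: fmeas_coord.
Qed.

(** The new coordinate may leave the unit interval, but the function integrated is periodic in it,
    so that each single integral is invariant under translation by the value at the parent. *)
Lemma It_shear s F c : (forall c, 0 <= F c)%E -> fmeas F -> topo tau s ->
  (forall c i, i \in s -> F (upd c i (c i + 1)) = F c) ->
  It s F c = It s (fun c => F (shear s c)) c.
Proof.
move=> F0 mF; elim: s c => //= i s IH c /and4P[ins ti ts tops] pF.
have pF' c' j : j \in s -> F (upd c' j (c' j + 1)) = F c'.
  by move=> js; apply: pF; rewrite inE js orbT.
pose G y := It s F (upd c i y).
have G0 y : (0 <= G y)%E by exact: It_ge0.
have mG : measurable_fun setT G by apply: fmeas_updy; exact: fmeas_It.
have pG y : G (y + 1) = G y.
  rewrite /G -(upd_upd c i y (y + 1)).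
  have := @It_periodic s F i ins (fun c => pF c i (mem_head _ _)) (upd c i y).
  by rewrite (_ : upd c i y i = y)// /upd eqxx.
rewrite /Op -/G -(integral_periodic (c (tau i)) mG G0 pG).
apply: eq_integral => y _; rewrite /G IH//.
(* The translation of coordinate [i] is moved inside the integrals over [s]. It commutes with them
   because neither [i] nor [tau i] lies in [s]. *)
pose phi c := upd c i (c i + c (tau i)).
have -> : upd c i (c (tau i) + y) = phi (upd c i y).
  have E1 : upd c i y i = y by rewrite /upd eqxx.
  have E2 : upd c i y (tau i) = c (tau i) by rewrite /upd (negbTE ti).
  by rewrite /phi E1 E2 upd_upd addrC.
rewrite It_commute// => c' j y' js; rewrite /phi.
have ji : j != i by apply: contraNneq ins => <-.
have jt : j != tau i by apply: contraNneq ts => <-.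
have E1 : upd c' j y' i = c' i by rewrite /upd eq_sym (negbTE ji).
have E2 : upd c' j y' (tau i) = c' (tau i) by rewrite /upd eq_sym (negbTE jt).
by rewrite E1 E2 upd_swap.
Qed.

End Shear.

Section TopologicalOrder.
Context {n : nat} {V : finType}.
Variable par : V -> V.

Definition parc (i : V * nat) : V * nat := (par i.1, i.2).

Lemma topo_sps (ws : seq V) : topo par ws -> topo parc (@sps n V ws).
Proof.
elim: ws => //= w ws IH /and4P[wws pw pws tws].
rewrite /sps /= -/(sps ws).
suff H ks : uniq ks -> topo parc ([seq (w, i.+1) | i <- ks] ++ @sps n V ws).
  exact/H/iota_uniq.
elim: ks => [_|k ks IHk /= /andP[kks uks]]; first exact: IH.
have nin (v : V) j : v \notin ws -> (v, j) \notin @sps n V ws.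
  by move=> vws; apply: contra vws => /mem_sps.
rewrite IHk// andbT !mem_cat !negb_or !nin// !andbT; apply/and3P; split.
- by apply: contra kks => /mapP[i iks [->]].
- by apply: contraNneq pw => -[->].
- by apply/negP => /mapP[i _ [pwE _]]; move: pw; rewrite pwE eqxx.
Qed.

Lemma sorted_topo (dep : V -> nat) (ws : seq V) : uniq ws ->
  path.sorted (fun u v => (dep u <= dep v)%N) ws ->
  (forall w, w \in ws -> (dep (par w) < dep w)%N) -> topo par ws.
Proof.
elim: ws => //= w ws IH /andP[wws uws] srt H.
have tr : transitive (fun u v : V => (dep u <= dep v)%N) by move=> a b c; exact: leq_trans.
have Hw := H w (mem_head _ _).
rewrite wws IH//=; last 2 first.
- exact: path_sorted srt.
- by move=> v vws; apply: H; rewrite inE vws orbT.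
rewrite andbT; apply/andP; split; first by apply: contraTneq Hw => ->; rewrite ltnn.
apply/negP => pws; have /allP/(_ _ pws) := order_path_min tr srt.
by rewrite leqNgt Hw.
Qed.

End TopologicalOrder.

(** * Time integrals *)

Section BetaIntegral.
Context {R : realType}.
Local Notation mu := (@lebesgue_measure R).
Local Notation D := `[0%R, 1%R[%classic.

Definition tk (lam eta p t : R) : R :=
  if 0 < t < p then t `^ lam * (p - t) `^ eta else 0.

Lemma tk_ge0 lam eta p t : 0 <= tk lam eta p t.
Proof. by rewrite /tk; case: ifP => // _; rewrite mulr_ge0 ?powR_ge0. Qed.

Lemma fmeas_tk (I : eqType) lam eta (f g : (I -> R) -> R) :
  fmeas f -> fmeas g -> fmeas (fun c => tk lam eta (f c) (g c)).
Proof.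
move=> mf mg d T h mh; have mf' := mf d T h mh; have mg' := mg d T h mh.
apply: measurable_fun_ifT.
- apply: measurable_and; first by apply: measurable_fun_ltr => //; exact: measurable_cst.
  exact: measurable_fun_ltr.
- apply: measurable_funM.
    exact: (measurableT_comp (measurable_powR lam) mg').
  apply: (measurableT_comp (measurable_powR eta)).
  exact: measurable_funB.
- exact: measurable_cst.
Qed.

Definition affine_time (b : bool) (p t : R) : R := if b then p - t else t.

Lemma measurable_affine_time b p : measurable_fun setT (affine_time b p).
Proof.
case: b; last exact: measurable_id.
by apply: measurable_funB; [exact: measurable_cst|exact: measurable_id].
Qed.

Lemma integral_affine_ball b (p r : R) : 0 <= r ->
  (\int[mu]_(t in D) (if (0 <= affine_time b p t <= r)%R then 1 else 0) <= r%:E)%E.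
Proof.
move=> r0; pose x := if b then p - r else 0; pose A := `[x, (x + r)%R]%classic.
apply: (@le_trans _ _ (\int[mu]_(t in D) (\1_A t)%:E)%E).
  apply: le_integral_nonmeas => t _; case: ifP => // H; rewrite ?lee_fin ?ler0n//.
  rewrite indicE mem_set// /A /= in_itv /= /x.
  by move: H; rewrite /affine_time; case: (b) => /andP[? ?]; apply/andP; split; lra.
have mA : measurable (A : set R) by exact: measurable_itv.
rewrite integral_indic//.
apply: (@le_trans _ _ (mu A)).
  by apply: le_measure; rewrite ?inE//; apply: measurableI.
rewrite lebesgue_measure_itv/= lte_fin.
by case: ifP => _; rewrite -?EFinB lee_fin//; lra.
Qed.

Definition powC (a : R) : R := 2 / (1 - 2^-1 `^ (1 - a)).

Lemma powC_ge0 a : a < 1 -> 0 <= powC a.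
Proof.
move=> a1; have /andP[_ r1] := @kerC_ratio R 1%N a a1.
by rewrite divr_ge0// subr_ge0 ltW.
Qed.

(** [S_layer] with M = p. On the range 0 to p every layer lies in an interval of length 2 p 2^-j,
    including layer 0, whose radius 1 is cut down to p; the series 2 p^(1-a) 2^(-j(1-a)) converges
    because a < 1. *)
Lemma integral_affine_S b (p a : R) : 0 < p <= 1 -> 0 <= a < 1 ->
  (\int[mu]_(t in D) (if (0 <= affine_time b p t <= p)%R then S a (affine_time b p t) else 0)
    <= (powC a * p `^ (1 - a))%:E)%E.
Proof.
move=> /andP[p0 p1] /andP[a0 a1].
have e0 i : 0 < (2^-1 : R) ^+ i by rewrite exprn_gt0.
pose F j t : \bar R := (((p * 2^-1 ^+ j) `^ (- a))%:E *
   (if (0 <= affine_time b p t <= 2 * p * 2^-1 ^+ j)%R then 1 else 0))%E.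
have F0 j t : (0 <= F j t)%E.
  by rewrite mule_ge0// ?lee_fin ?powR_ge0//; case: ifP.
have mind r : measurable_fun setT (fun t => if (0 <= affine_time b p t <= r)%R then 1%E else 0%E : \bar R).
  apply: measurable_fun_ifT; [|exact: measurable_cst|exact: measurable_cst].
  by apply: measurable_and; apply: measurable_fun_ler; try exact: measurable_cst;
     exact: measurable_affine_time.
have mF j : measurable_fun setT (F j).
  by apply: emeasurable_funM; [exact: measurable_cst|exact: mind].
apply: (@le_trans _ _ (\int[mu]_(t in D) \sum_(0 <= j <oo) F j t)%E).
  apply: le_integral_nonmeas => t _; first by case: ifP => // _; exact: S_ge0.
  case: ifP => [/andP[u0 up]|_]; last by apply: nneseries_ge0.
  have u01 : 0 <= affine_time b p t <= 1 by rewrite u0 (le_trans up).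
  have p01 : 0 < p <= 1 by rewrite p0.
  apply: (le_trans (S_layer p01 u01 a0)).
  apply: lee_nneseries => j _; first by move=> _; rewrite lee_fin mulr_ge0 ?powR_ge0 ?dball_ge0.
  rewrite EFinM; apply: lee_wpmul2l; first by rewrite lee_fin powR_ge0.
  rewrite /dball u0 /=; have [ur|_] := leP (affine_time b p t) (layer_radius p j); last first.
    by rewrite mulr0n; case: ifP.
  rewrite (_ : _ <= _)//; case: j ur => [_|j /= ur]; first by rewrite expr0 mulr1; lra.
  by rewrite exprS; lra.
have mFD j : measurable_fun (D : set R) (F j) by apply: measurable_funS (mF j).
rewrite integral_nneseries//.
apply: (@le_trans _ _ (\sum_(0 <= j <oo) ((2 * p `^ (1 - a)) * (2^-1 `^ (1 - a)) ^+ j)%:E)%E).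
  apply: lee_nneseries => [j _ _|j _]; first by apply: integral_ge0.
  have mindD r : measurable_fun (D : set R) (fun t : R => if (0 <= affine_time b p t <= r)%R then 1%E else 0%E : \bar R).
    by apply: measurable_funS (mind r).
  rewrite ge0_integralZl//;
    do ?[exact: mindD|by move=> t _; case: ifP|by rewrite lee_fin powR_ge0].
  apply: (@le_trans _ _ (((p * 2^-1 ^+ j) `^ (- a))%:E * (2 * p * 2^-1 ^+ j)%:E)%E).
    apply: lee_wpmul2l; first by rewrite lee_fin powR_ge0.
    by apply: integral_affine_ball; rewrite !mulr_ge0// ltW.
  rewrite -EFinM lee_fin powRM ?(ltW p0) ?(ltW (e0 j))//.
  rewrite -(powRX (1 - a) j)// addrC !powRD ?lt0r_neq0 ?implybT//.
  rewrite !powRr1 ?(ltW p0) ?(ltW (e0 j))//.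
  by rewrite le_eqVlt; apply/orP; left; apply/eqP; ring.
have r01 : 0 <= (2^-1 : R) `^ (1 - a) < 1 := @kerC_ratio R 1%N a a1.
apply: le_trans (geometric_series_le _ r01) _.
  by rewrite mulr_ge0 ?powR_ge0.
by rewrite lee_fin /powC mulrAC.
Qed.

Definition negp (x : R) : R := Num.max 0 (- x).

Definition betaC (lam eta : R) : R :=
  2 `^ `|eta| * powC (negp lam) + 2 `^ `|lam| * powC (negp eta).

Lemma negp01 x : -1 < x -> 0 <= negp x < 1.
Proof. by move=> x1; rewrite /negp le_max lexx gt_max ltr01/=; lra. Qed.

Lemma powR_half (p x s : R) : 0 < p -> p / 2 <= x <= p -> x `^ s <= 2 `^ `|s| * p `^ s.
Proof.
move=> p0 /andP[px xp]; have x0 : 0 < x by lra.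
have [s0|s0] := leP 0 s.
  apply: (@le_trans _ _ (p `^ s)).
    by apply: ge0_ler_powR; rewrite ?nnegrE// ltW.
  rewrite ler_peMl ?powR_ge0//.
  have : (2 : R) `^ 0 <= 2 `^ `|s| by apply: ler_powR; rewrite ?normr_ge0//; lra.
  by rewrite powRr0.
rewrite (ltr0_norm s0).
have -> : 2 `^ (- s) * p `^ s = (p / 2) `^ s.
  by rewrite powRM ?(ltW p0)// mulrC -powR_inv1// -powRrM mulN1r.
rewrite -[s]opprK; apply: powR_le_neg => //; first by rewrite divr_gt0.
by rewrite oppr_ge0 ltW.
Qed.

(** Cut at p/2: on each half one factor is comparable to a power of p, and only the other can be
    singular. [negp] is the negative part of an exponent; a positive remainder is bounded by the
    corresponding power of p. *)
Lemma tk_le lam eta p t : 0 < p -> -1 < lam -> -1 < eta ->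
  ((tk lam eta p t)%:E <=
   (2 `^ `|eta| * p `^ (eta + (lam + negp lam)))%:E *
     (if (0 <= affine_time false p t <= p)%R then S (negp lam) (affine_time false p t) else 0) +
   (2 `^ `|lam| * p `^ (lam + (eta + negp eta)))%:E *
     (if (0 <= affine_time true p t <= p)%R then S (negp eta) (affine_time true p t) else 0))%E.
Proof.
move=> p0 l1 e1.
have pos x y : (0 <= (2 `^ x * p `^ y)%:E)%E by rewrite lee_fin mulr_ge0 ?powR_ge0.
have pos2 b z : (0 <= (if (0 <= affine_time b p t <= p)%R then S z (affine_time b p t) else 0))%E.
  by case: ifP => // _; exact: S_ge0.
rewrite /tk; case: ifP => [/andP[t0 tp]|_]; last by rewrite adde_ge0// mule_ge0.
have tp' : t <= p := ltW tp.
have pt0 : 0 < p - t by rewrite subr_gt0.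
have aux (x s : R) : 0 < x <= p -> -1 < s -> x `^ s <= p `^ (s + negp s) * x `^ (- negp s).
  move=> /andP[x0 xp] s1.
  have -> : x `^ s = x `^ (s + negp s) * x `^ (- negp s).
    by rewrite -powRD ?lt0r_neq0 ?implybT// addrK.
  apply: ler_wpM2r; first exact: powR_ge0.
  apply: ge0_ler_powR; rewrite ?nnegrE ?(ltW x0) ?(ltW p0)//.
  by rewrite /negp; case: (lerP 0 (- s)); lra.
have [th|th] := leP t (p / 2).
  apply: le_trans (leeDl _ (mule_ge0 (pos _ _) (pos2 _ _))).
  rewrite /affine_time (ltW t0) tp' /S (gt_eqF t0) -EFinM lee_fin.
  rewrite powRD ?lt0r_neq0 ?implybT//.
  have H1 : (p - t) `^ eta <= 2 `^ `|eta| * p `^ eta by apply: powR_half => //; apply/andP; split; lra.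
  have H2 := aux t lam; rewrite t0 tp' in H2; have {}H2 := H2 isT l1.
  apply: le_trans (ler_pM (powR_ge0 _ _) (powR_ge0 _ _) H2 H1) _.
  by rewrite le_eqVlt; apply/orP; left; apply/eqP; ring.
apply: le_trans (leeDr _ (mule_ge0 (pos _ _) (pos2 _ _))).
have ptp : p - t <= p by lra.
rewrite /affine_time (ltW pt0) ptp /S (gt_eqF pt0) -EFinM lee_fin.
rewrite powRD ?lt0r_neq0 ?implybT//.
have H1 : t `^ lam <= 2 `^ `|lam| * p `^ lam by apply: powR_half => //; apply/andP; split; lra.
have H2 := aux (p - t) eta; rewrite pt0 ptp in H2; have {}H2 := H2 isT e1.
apply: le_trans (ler_pM (powR_ge0 _ _) (powR_ge0 _ _) H1 H2) _.
by rewrite le_eqVlt; apply/orP; left; apply/eqP; ring.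
Qed.

Lemma betaC_ge0 lam eta : -1 < lam -> -1 < eta -> 0 <= betaC lam eta.
Proof.
move=> l1 e1; have /andP[_ nl] := negp01 l1; have /andP[_ ne] := negp01 e1.
by rewrite addr_ge0// mulr_ge0 ?powR_ge0 ?powC_ge0.
Qed.

Lemma integral_tk lam eta p : p <= 1 -> -1 < lam -> -1 < eta ->
  (\int[mu]_(t in D) (tk lam eta p t)%:E <= (betaC lam eta * p `^ (lam + eta + 1))%:E)%E.
Proof.
move=> p1 l1 e1; have [p0|p0] := ltP 0 p; last first.
  rewrite (eq_integral (fun=> 0%E)) => [|t _]; last first.
    rewrite /tk; case: ifP => // /andP[t0 tp].
    by have := lt_le_trans (lt_trans t0 tp) p0; rewrite ltxx.
  by rewrite integral0 lee_fin mulr_ge0 ?powR_ge0 ?betaC_ge0.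
pose G b z t : \bar R := if (0 <= affine_time b p t <= p)%R then S z (affine_time b p t) else 0%E.
have G0 b z t : (0 <= G b z t)%E by rewrite /G; case: ifP => // _; exact: S_ge0.
have mG b z : measurable_fun (D : set R) (G b z).
  apply: (measurable_funS measurableT) => //; apply: measurable_fun_ifT.
  - by apply: measurable_and; apply: measurable_fun_ler; try exact: measurable_cst;
       exact: measurable_affine_time.
  - by apply: (measurableT_comp (@measurable_S R z)); exact: measurable_affine_time.
  - exact: measurable_cst.
pose K1 := 2 `^ `|eta| * p `^ (eta + (lam + negp lam)).
pose K2 := 2 `^ `|lam| * p `^ (lam + (eta + negp eta)).
have K10 : (0 <= K1%:E)%E by rewrite lee_fin mulr_ge0 ?powR_ge0.
have K20 : (0 <= K2%:E)%E by rewrite lee_fin mulr_ge0 ?powR_ge0.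
apply: (@le_trans _ _ (\int[mu]_(t in D) (K1%:E * G false (negp lam) t + K2%:E * G true (negp eta) t))%E).
  apply: le_integral_nonmeas => t _; first by rewrite lee_fin tk_ge0.
  exact: tk_le.
have mKG K b z : measurable_fun (D : set R) (fun t => K%:E * G b z t)%E.
  by apply: emeasurable_funM => //; exact: measurable_cst.
rewrite ge0_integralD//; do ?[exact: mKG|by move=> *; rewrite mule_ge0].
rewrite !ge0_integralZl//; do ?exact: mG.
have pp : 0 < p <= 1 by rewrite p0.
apply: (@le_trans _ _ (K1%:E * (powC (negp lam) * p `^ (1 - negp lam))%:E +
   K2%:E * (powC (negp eta) * p `^ (1 - negp eta))%:E)%E).
  by apply: leeD; apply: lee_wpmul2l => //; apply: integral_affine_S => //; exact: negp01.
rewrite -!EFinM -EFinD lee_fin /betaC mulrDl /K1 /K2.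
have E (u v x y s : R) : x + y = s -> u * p `^ x * (v * p `^ y) = u * v * p `^ s.
  by move=> <-; rewrite powRD ?lt0r_neq0 ?implybT//; ring.
by rewrite !(E _ _ _ _ (lam + eta + 1)) //; ring.
Qed.

End BetaIntegral.

Section TimeElimination.
Context {R : realType} {V : finType}.
Implicit Types (c : V * nat -> R) (w v : V) (ws : seq V) (b lam : V -> R).
Variables (par : V -> V) (rt isD : pred V) (eta tau : V -> R).

Lemma topo_rcons ws w : topo par (rcons ws w) ->
  [/\ topo par ws, w \notin ws, par w != w & {in ws, forall v, par v != w}].
Proof.
elim: ws => [/and4P[_ pw _ _]|v ws IH /=]; first by split.
rewrite !mem_rcons !inE !negb_or => /and4P[/andP[vw vws] pv /andP[pvw pvws] /IH[tws wws pw H]].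
split; [by rewrite /= vws pv pvws|by rewrite wws eq_sym vw|exact: pw|].
by move=> u; rewrite inE => /orP[/eqP ->|/H].
Qed.

(** The root time [tau] is indexed by the child and not by the root, since in the second estimate
    the kernels at one root are evaluated at s for some children and at t for others. *)
Definition ptime c w : R := if rt (par w) then tau w else c (par w, 0%N).

Definition tf b c w : R :=
  if isD w then (if 0 < ptime c w then ptime c w `^ eta w else 0)
  else tk (b w) (eta w) (ptime c w) (c (w, 0%N)).

Definition tsw w : seq (V * nat) := if isD w then [::] else [:: (w, 0%N)].

Definition times ws : seq (V * nat) := flatten [seq tsw w | w <- ws].

Lemma tf_ge0 b c w : 0 <= tf b c w.
Proof.
rewrite /tf; case: ifP => _; last exact: tk_ge0.
by case: ifP => // _; exact: powR_ge0.
Qed.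

Lemma fmeas_ptime w : fmeas (fun c => ptime c w).
Proof. by rewrite /ptime; case: (rt _); [exact: fmeas_cst|exact: fmeas_coord]. Qed.

Lemma fmeas_tf b w : fmeas (fun c => tf b c w).
Proof.
rewrite /tf; case: (isD w); last by apply: fmeas_tk; [exact: fmeas_ptime|exact: fmeas_coord].
move=> d T g mg; have mp := fmeas_ptime w mg.
apply: measurable_fun_ifT; [|exact: (measurableT_comp (measurable_powR (eta w)) mp)|exact: measurable_cst].
by apply: measurable_fun_ltr => //; exact: measurable_cst.
Qed.

Lemma times_rcons ws w : times (rcons ws w) = times ws ++ tsw w.
Proof. by rewrite /times map_rcons flatten_rcons. Qed.

Definition tC lam w : R := if isD w then 1 else betaC (lam w) (eta w).

Lemma tk_shift (bw E e p t : R) : tk bw e p t * t `^ E = tk (bw + E) e p t.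
Proof.
rewrite /tk; case: ifP => [/andP[t0 _]|_]; last by rewrite mul0r.
by rewrite powRD ?lt0r_neq0 ?implybT//; ring.
Qed.

(** The last vertex of a topological order has no child in the list; its Beta integral is a power of
    the time of its parent, with exponent lam + eta + 1, which is added to the exponent of the
    parent or, at a root, put aside. A Dirac vertex has no integral and gives the power eta, which
    is the same formula with lam = -1: so the value -1 of its exponent needs no separate
    treatment. *)
Lemma It_time ws b lam c : topo par ws ->
  {in ws, forall w, ~~ rt w} ->
  {in ws, forall w, rt (par w) || (par w \in ws)} ->
  {in ws, forall w, ~~ isD (par w)} ->
  {in ws, forall w, lam w = b w + \sum_(v <- ws | par v == w) (lam v + eta v + 1)} ->
  {in ws, forall w, if isD w then lam w = -1 else -1 < lam w /\ -1 < eta w} ->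
  {in ws, forall w, tau w <= 1} ->
  (It (times ws) (fun c => \prod_(w <- ws) (tf b c w)%:E) c <=
   ((\prod_(w <- ws) tC lam w) *
     \prod_(w <- ws | rt (par w)) tau w `^ (lam w + eta w + 1))%:E)%E.
Proof.
elim/last_ind: ws b c => [|ws w IH] b c; first by rewrite /times /= !big_nil mul1r.
move=> tw nrt prt nD lamE lamP tau1.
have [tws wws pw pws] := topo_rcons tw.
have ww : w \in rcons ws w by rewrite mem_rcons mem_head.
have sub v : v \in ws -> v \in rcons ws w by rewrite mem_rcons inE => ->; rewrite orbT.
have lamw : lam w = b w.
  rewrite lamE// big_rcons /= (negbTE pw) big_seq_cond big1 ?addr0//.
  by move=> v /andP[vws /eqP pvE]; move: (pws _ vws); rewrite pvE eqxx.
set Ew := lam w + eta w + 1.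
have tC0 : 0 <= tC lam w.
  by rewrite /tC; have := lamP w ww; case: ifP => [_ _|_ [l1 e1]]; [exact: ler01|exact: betaC_ge0].
(* The exponent of the parent after it has absorbed the integral over the time of [w]. *)
pose b' v := if v == par w then b v + Ew else b v.
pose Kr : R := tC lam w * (if rt (par w) then tau w `^ Ew else 1).
have Kr0 : 0 <= Kr by rewrite mulr_ge0//; case: ifP => // _; exact: powR_ge0.
rewrite times_rcons It_cat.
have P0 b0 ws0 c0 : (0 <= \prod_(v <- ws0) (tf b0 c0 v)%:E)%E.
  by apply: prode_ge0 => v _; rewrite lee_fin tf_ge0.
have mP b0 ws0 : fmeas (fun c => \prod_(v <- ws0) (tf b0 c v)%:E)%E.
  by apply: fmeas_prod => v; apply: fmeas_EFin; exact: fmeas_tf.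
have step : (It (times ws) (It (tsw w) (fun c => \prod_(v <- rcons ws w) (tf b c v)%:E)) c <=
  It (times ws) (fun c => Kr%:E * \prod_(v <- ws) (tf b' c v)%:E) c)%E.
  apply: (proj2 (le_It_on _)) => c' ac c01; split; first exact: It_ge0.
  have p1 : ptime c' w <= 1.
    rewrite /ptime; case: ifPn => rtp; first exact: tau1.
    have pin : par w \in ws.
      by have := prt w ww; rewrite (negbTE rtp) /= mem_rcons inE (negbTE pw).
    have /c01/andP[_ /ltW//] : (par w, 0%N) \in times ws.
    apply/flattenP; exists (tsw (par w)); first exact: map_f.
    by rewrite /tsw (negbTE (nD w ww)) mem_head.
  have inner : (It (tsw w) (fun c => \prod_(v <- rcons ws w) (tf b c v)%:E) c' <=
      (\prod_(v <- ws) (tf b c' v)%:E) * (tC lam w * ptime c' w `^ Ew)%:E)%E.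
    rewrite (@eq_It _ _ _ _ (fun c => ((\prod_(v <- ws) (tf b c v)%:E) * (tf b c w)%:E)%E)); last first.
      by move=> c''; rewrite -cats1 big_cat big_seq1.
    have := lamP w ww; rewrite /tsw /tC; case: ifP => Dw.
      move=> lw; rewrite /= mul1r; apply: lee_wpmul2l => //.
      rewrite lee_fin /tf Dw /Ew lw (_ : -1 + eta w + 1 = eta w); last by ring.
      by case: ifP => // _; exact: powR_ge0.
    move=> [l1 e1]; rewrite It_mull//; first last.
    - move=> i c'' y; rewrite inE => /eqP ->; apply: eq_big_seq => v vws.
      have vw : (v, 0%N) == (w, 0%N) = false.
        by apply/eqP => -[vE]; move: wws; rewrite -vE vws.
      have pvw : (par v, 0%N) == (w, 0%N) = false.
        by apply/eqP => -[vE]; move: (pws v vws); rewrite vE eqxx.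
      by rewrite /tf /ptime /upd vw pvw.
    - by apply: fmeas_EFin; exact: fmeas_tf.
    - by move=> c''; rewrite lee_fin tf_ge0.
    apply: lee_wpmul2l => //=; rewrite /Op.
    apply: le_trans (integral_tk p1 l1 e1); rewrite le_eqVlt; apply/orP; left; apply/eqP.
    apply: eq_integral => y _; rewrite /tf Dw /ptime lamw.
    have pww : (par w, 0%N) == (w, 0%N) = false by apply/eqP => -[/eqP]; rewrite (negbTE pw).
    by rewrite /upd pww eqxx.
  apply: (le_trans inner).
  have E1 : (\prod_(v <- ws) (tf b c' v)%:E * (ptime c' w `^ Ew)%:E <=
      (if rt (par w) then tau w `^ Ew else 1)%:E * \prod_(v <- ws) (tf b' c' v)%:E)%E.
    rewrite /ptime; case: ifPn => rtp.
      rewrite muleC; apply: lee_wpmul2l; first by rewrite lee_fin powR_ge0.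
      rewrite le_eqVlt; apply/orP; left; apply/eqP; apply: eq_big_seq => v vws.
      rewrite /tf /b'; case: eqVneq => // vE.
      by move: (nrt v (sub v vws)); rewrite vE rtp.
    have pin : par w \in ws.
      by have := prt w ww; rewrite (negbTE rtp) /= mem_rcons inE (negbTE pw).
    have uws : uniq ws by move: tws; clear; elim: (ws) => //= x s IHs /and4P[-> _ _ /IHs].
    rewrite mul1e !(bigD1_seq (par w))//= muleAC -EFinM.
    rewrite {1}/tf (negbTE (nD w ww)) tk_shift.
    rewrite le_eqVlt; apply/orP; left; apply/eqP; congr (_ * _)%E.
      by rewrite /tf (negbTE (nD w ww)) /b' eqxx.
    by apply: eq_bigr => v /negbTE vp; rewrite /tf /b' vp.
  rewrite EFinM muleCA /Kr [(tC lam w * (if _ then _ else _))%:E]EFinM -muleA.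
  by apply: lee_wpmul2l; rewrite ?lee_fin.
apply: (le_trans step).
rewrite (@It_mull _ _ _ (fun=> Kr%:E))//.
have lamE' : {in ws, forall v, lam v = b' v + \sum_(u <- ws | par u == v) (lam u + eta u + 1)}.
  move=> v vws; rewrite lamE ?sub// big_rcons /= /b' [v == _]eq_sym.
  by have [_|_] := eqVneq (par w) v; rewrite /Ew; ring.
apply: (@le_trans _ _ (Kr%:E * ((\prod_(w <- ws) tC lam w) *
     \prod_(w <- ws | rt (par w)) tau w `^ (lam w + eta w + 1))%:E)%E).
  apply: lee_wpmul2l => //; apply: IH => // v vws; do ?[by apply: nD; exact: sub
    |by apply: nrt; exact: sub|by apply: lamP; exact: sub|by apply: tau1; exact: sub].
  have := prt v (sub v vws); rewrite mem_rcons inE => /orP[->//|/orP[/eqP pvE|->]]; last by rewrite orbT.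
  by move: (pws v vws); rewrite pvE eqxx.
rewrite -EFinM lee_fin le_eqVlt; apply/orP; left; apply/eqP.
rewrite -cats1 !big_cat /= !big_cons !big_nil /Kr /Ew; case: ifP => _; ring.
Qed.

End TimeElimination.

(** * Heat kernel bounds *)

Section QuadraticDerivative.
Context {R : realType}.
Implicit Types (f g : R -> R).

(** Quadratic remainders with summable constants can be added up, so this criterion differentiates a
    series term by term without a discussion of uniform convergence. *)
Lemma is_derive_quad (f : R -> R) (x d K : R) :
  (forall t, `|t| <= 1 -> `|f (x + t) - f x - t * d| <= K * t ^+ 2) ->
  is_derive x 1 f d.
Proof.
move=> H; have K0 : 0 <= K.
  have := H 1; rewrite normr1 lexx => /(_ isT); rewrite expr1n mulr1.
  exact: le_trans (normr_ge0 _).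
have cv : h^-1 *: (f (h *: 1 + x) - f x) @[h --> 0^'] --> d.
  apply/cvgrPdist_le => e e0.
  have d0 : 0 < Num.min 1 (e / (K + 1)).
    by rewrite lt_min ltr01 divr_gt0// ltr_wpDl.
  exists (Num.min 1 (e / (K + 1))) => //= t; rewrite /ball_ /= sub0r normrN lt_min => /andP[t1 te] t0.
  have -> : d - t^-1 *: (f (t *: 1 + x) - f x) = - (t^-1 * (f (x + t) - f x - t * d)).
    rewrite /GRing.scale /= mulr1 [t + x]addrC; field.
    exact: t0.
  rewrite normrN normrM normfV.
  have nt0 : 0 < `|t| by rewrite normr_gt0.
  rewrite ler_pdivrMl//; apply: le_trans (H t (ltW t1)) _.
  rewrite -real_normK ?num_real// expr2 mulrCA; apply: ler_wpM2l; first exact: ltW.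
  move: te; rewrite ltr_pdivlMr ?ltr_wpDl//.
  have := normr_ge0 t; nra.
apply: DeriveDef; first by apply/cvg_ex; exists d.
exact: cvg_lim cv.
Qed.

Lemma MVT_norm f f' (a b : R) : (forall x : R, is_derive x (1:R) f (f' x)) ->
  exists2 c, `|c - a| <= `|b - a| /\ `|c - b| <= `|b - a| & f b - f a = f' c * (b - a).
Proof.
move=> df.
have cf x : {for x, continuous f}.
  by apply: differentiable_continuous; apply/derivable1_diffP; have [] := df x.
have [ab|ba] := leP a b.
  have [c|c cab ->] := MVT_segment ab (fun x _ => df x).
    exact: continuous_subspaceT.
  exists c => //; move: cab; rewrite in_itv /= => /andP[ac cb].
  by split; rewrite ler_norml [`|b - a|]ger0_norm ?subr_ge0//; apply/andP; split; lra.
have [c|c cab E] := MVT_segment (ltW ba) (fun x _ => df x).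
  exact: continuous_subspaceT.
exists c; last by rewrite -opprB E -mulrN opprB.
move: cab; rewrite in_itv /= => /andP[bc ca].
by split; rewrite ler_norml [`|b - a|]ltr0_norm ?subr_lt0//; apply/andP; split; lra.
Qed.

End QuadraticDerivative.

Section Periodization.
Context {R : realType}.
Implicit Types (f g : R -> R).

(* The terms j and -(j+1) of the sum over Z are grouped, so that the
   periodization is a series over nat. *)
Definition pterm f (u : R) (j : nat) : R := f (u + j%:R) + f (u - j.+1%:R).

Definition per f (u : R) : R := limn (series (pterm f u)).

(** Two geometric series of ratio exp (-1), one for each half of the integers. *)
Definition perC : R := 2 / (1 - expR (- 1)).

Lemma expRN1_lt1 : expR (- 1 : R) < 1.
Proof. by rewrite expR_lt1; lra. Qed.

Lemma perC_ge0 : 0 <= perC.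
Proof. by rewrite divr_ge0// subr_ge0 ltW// expRN1_lt1. Qed.

Section Bound.
Variables (f : R -> R) (K u : R).
Hypothesis fK : forall m : int, `|f (u + m%:~R)| <= K * expR (- `|u + m%:~R|).

Let K0 : 0 <= K.
Proof.
have := le_trans (normr_ge0 _) (fK 0).
by rewrite pmulr_lge0// expR_gt0.
Qed.

Lemma pterm_le j : `|pterm f u j| <= (2 * K * expR `|u|) * expR (- 1) ^+ j.
Proof.
have E v (m : int) : j%:R <= `|m%:~R : R| -> v = u + m%:~R ->
    `|f v| <= K * expR `|u| * expR (- 1) ^+ j.
  move=> jm ->; apply: le_trans (fK m) _; rewrite -mulrA; apply: ler_wpM2l => //.
  rewrite -expRM_natl -expRD ler_expR.
  have : `|m%:~R : R| <= `|u + m%:~R| + `|u|.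
    by have := ler_normB (u + m%:~R) u; rewrite addrAC subrr add0r.
  rewrite mulrN mulr1; lra.
apply: le_trans (ler_normD _ _) _.
have -> : 2 * K * expR `|u| * expR (-1) ^+ j = K * expR `|u| * expR (- 1) ^+ j + K * expR `|u| * expR (- 1) ^+ j.
  by ring.
apply: lerD; first by apply: (E _ j%:Z) => //; rewrite ger0_norm// ler0n.
apply: (E _ (- j.+1%:Z)); last by rewrite rmorphN.
by rewrite rmorphN normrN /= ger0_norm ?ler0n// ler_nat.
Qed.

Lemma per_ncvg : cvgn [normed series (pterm f u)].
Proof.
apply: (@series_le_cvg _ _ (geometric (2 * K * expR `|u|) (expR (- 1)))) => [j|j|j|].
- exact: normr_ge0.
- by rewrite /geometric /= !mulr_ge0 ?exprn_ge0 ?expR_ge0.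
- exact: pterm_le.
- by apply: is_cvg_geometric_series; rewrite ger0_norm ?expR_ge0// expRN1_lt1.
Qed.

Lemma per_cvg : cvgn (series (pterm f u)).
Proof. exact: normed_cvg per_ncvg. Qed.

Lemma per_le : `|per f u| <= perC * K * expR `|u|.
Proof.
have e1 : `|expR (- 1 : R)| < 1 by rewrite ger0_norm ?expR_ge0// expRN1_lt1.
apply: le_trans (lim_series_norm per_ncvg) _.
apply: (@le_trans _ _ (limn (series (geometric (2 * K * expR `|u|) (expR (- 1)))))).
  apply: lim_series_le; [exact: per_ncvg|exact: is_cvg_geometric_series|exact: pterm_le].
have /cvg_lim -> // := @cvg_geometric_series R (2 * K * expR `|u|) _ e1.
by rewrite /perC le_eqVlt; apply/orP; left; apply/eqP; ring.
Qed.

End Bound.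

Definition expdec f (C : R) := forall v, `|f v| <= C * expR (- `|v|).

Lemma expdec_cvg f C u : expdec f C -> cvgn (series (pterm f u)).
Proof. by move=> fC; apply: (@per_cvg f C u) => m; exact: fC. Qed.

(** The remainder [g] of order one of f is, by two applications of the mean value theorem, t times
    c1 - v times a value of f'' at distance at most 1. It is thus O(t^2) with the same exponential
    decay, up to a factor exp 1, and its periodisation is the remainder of [per f]. *)
Lemma per_derive f f' f'' C : (forall x : R, is_derive x (1:R) f (f' x)) ->
  (forall x : R, is_derive x (1:R) f' (f'' x)) -> expdec f C -> expdec f' C -> expdec f'' C ->
  forall u : R, is_derive u (1:R) (per f) (per f' u).
Proof.
move=> df df' Ef Ef' Ef'' u.
have C0 : 0 <= C.
  have := le_trans (normr_ge0 _) (Ef 0); by rewrite pmulr_lge0// expR_gt0.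
apply: (@is_derive_quad _ _ _ _ (perC * (C * expR 1) * expR `|u|)) => t t1.
pose g v := f (v + t) - f v - t * f' v.
have gE v : `|g v| <= (C * expR 1 * t ^+ 2) * expR (- `|v|).
  have [c1 [cv1 _] E1] := MVT_norm v (v + t) df.
  have [c2 [cv2 _] E2] := MVT_norm v c1 df'.
  rewrite [v + t - v]addrAC subrr add0r in cv1 E1.
  have -> : g v = f'' c2 * (c1 - v) * t by rewrite /g E1 -E2; ring.
  rewrite !normrM -[t ^+ 2]real_normK ?num_real// expr2.
  have c2v : expR (- `|c2|) <= expR 1 * expR (- `|v|).
    rewrite -expRD ler_expR.
    have : `|v| <= `|c2 - v| + `|c2|.
      by have := ler_normB (c2 - v) c2; rewrite [c2 - v - c2]addrAC subrr add0r normrN.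
    lra.
  have H1 : `|f'' c2| <= C * (expR 1 * expR (- `|v|)).
    by apply: le_trans (Ef'' c2) _; apply: ler_wpM2l.
  apply: (@le_trans _ _ (C * (expR 1 * expR (- `|v|)) * `|t| * `|t|)).
    by apply: ler_wpM2r => //; apply: ler_pM.
  by rewrite le_eqVlt; apply/orP; left; apply/eqP; ring.
have -> : per f (u + t) - per f u - t * per f' u = per g u.
  have ct : cvgn (series (pterm f (u + t))) by exact: expdec_cvg Ef.
  have c0 : cvgn (series (pterm f u)) by exact: expdec_cvg Ef.
  have c1 : cvgn (series (pterm f' u)) by exact: expdec_cvg Ef'.
  rewrite /per.
  have -> : pterm g u = pterm f (u + t) - pterm f u - t *: pterm f' u.
    apply/funext => j; rewrite /pterm /g.
    rewrite !fctE /GRing.scale /=.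
    have -> : u + t + j%:R = u + j%:R + t by ring.
    have -> : u + t - j.+1%:R = u - j.+1%:R + t by ring.
    by ring.
  rewrite lim_seriesB; [|exact: is_cvg_seriesB|exact: is_cvg_seriesZ].
  by rewrite lim_seriesB// lim_seriesZ.
apply: le_trans (per_le _) _; first by move=> m; exact: gE.
by rewrite le_eqVlt; apply/orP; left; apply/eqP; ring.
Qed.

End Periodization.

Section GaussianPolynomials.
Context {R : realType}.
Implicit Types (p : {poly R}) (h u v z : R).

(* The derivatives of the Gaussian at time t = h^2 are
   h^-(k+1) P_k(u / h) exp (- (u / h)^2 / 4), with P_(k+1) = pstep P_k. *)
Definition gz p z : R := p.[z] * expR (- (z ^+ 2 / 4)).

Definition pstep p : {poly R} := p^`() - 2^-1 *: ('X * p).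

Lemma is_derive_gz p z : is_derive z (1 : R) (gz p) (gz (pstep p) z).
Proof.
have dq : is_derive z (1 : R) (fun z : R => - (z ^+ 2 / 4)) (- (z / 2)).
  apply: is_derive_eq; rewrite /GRing.scale /=; by field.
have de : is_derive z (1 : R) (expR \o (fun z : R => - (z ^+ 2 / 4))) (expR (- (z ^+ 2 / 4)) * - (z / 2)).
  exact: (is_derive1_comp (is_derive_expR _) dq).
have -> : gz p = horner p * (expR \o (fun z : R => - (z ^+ 2 / 4))) by [].
apply: is_derive_eq; rewrite /GRing.scale /= /gz /pstep !hornerE /=; by field.
Qed.

Lemma horner_le_expR p : exists2 C, 0 <= C & forall z, `|p.[z]| <= C * expR `|z|.
Proof.
exists (\sum_(i < size p) `|p`_i| * (i`!)%:R); first by apply: sumr_ge0 => i _; rewrite mulr_ge0.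
move=> z; rewrite horner_coef; apply: le_trans (ler_norm_sum _ _ _) _.
rewrite mulr_suml; apply: ler_sum => i _; rewrite normrM -mulrA; apply: ler_wpM2l => //.
rewrite normrX; case: (i : nat) => [|j].
  by rewrite expr0 fact0 mul1r -expR0 ler_expR.
have := expR_ge1Dxn j (normr_ge0 z).
have f0 : 0 < (j.+1`!)%:R :> R by rewrite ltr0n fact_gt0.
move=> H; rewrite mulrC -ler_pdivrMr//; apply: le_trans H; lra.
Qed.

(** The rate 4 leaves room for later losses: half of it is given up when h is replaced by h' >= h/2,
    and the remaining 2 is divided between the decay in [distZ] and the convergence of the lattice
    sum. *)
Lemma gz_decay p : exists2 C, 0 <= C & forall z, `|gz p z| <= C * expR (- (4 * `|z|)).
Proof.
have [C C0 HC] := horner_le_expR p.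
(* From (|z| - 10)^2 >= 0: the sum |z| - z^2/4 is at most 25 - 4 |z|. *)
exists (C * expR 25) => [|z]; first by rewrite mulr_ge0 ?expR_ge0.
rewrite normrM [`|expR _|]ger0_norm ?expR_ge0//.
apply: (@le_trans _ _ (C * expR `|z| * expR (- (z ^+ 2 / 4)))).
  by apply: ler_wpM2r; rewrite ?expR_ge0.
rewrite -[leLHS]mulrA -[leRHS]mulrA -!expRD; apply: ler_wpM2l => //; rewrite ler_expR.
have zz : z ^+ 2 = `|z| ^+ 2 by rewrite real_normK ?num_real.
have := sqr_ge0 (`|z| - 10); rewrite zz; nra.
Qed.

Definition trm p (k : nat) h u : R := h^-1 ^+ k.+1 * gz p (u / h).

Lemma is_derive_trm p k h u : is_derive u (1 : R) (trm p k h) (trm (pstep p) k.+1 h u).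
Proof.
have dg := is_derive_gz p (u / h).
have dd : is_derive u (1 : R) (fun u : R => u / h) h^-1.
  by apply: is_derive_eq; rewrite /GRing.scale /=; ring.
have dc : is_derive u (1 : R) (gz p \o (fun u : R => u / h)) (gz (pstep p) (u / h) * h^-1).
  exact: (@is_derive1_comp R (gz p) (fun u : R => u / h) u _ _ dg dd).
have -> : trm p k h = h^-1 ^+ k.+1 *: (gz p \o (fun u : R => u / h)) by [].
apply: is_derive_eq; rewrite /GRing.scale /= /trm (exprSr _ k.+1) -[RHS]mulrA.
by congr (_ * _); rewrite mulrC.
Qed.

Lemma trm_decay p k : exists2 C, 0 <= C &
  forall h u, 0 < h -> `|trm p k h u| <= C * h^-1 ^+ k.+1 * expR (- (4 * (`|u| / h))).
Proof.
have [C C0 HC] := gz_decay p; exists C => // h u h0.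
rewrite normrM [`|h^-1 ^+ _|]ger0_norm ?exprn_ge0 ?invr_ge0 ?(ltW h0)//.
rewrite [C * _]mulrC -mulrA; apply: ler_wpM2l; first by rewrite exprn_ge0// invr_ge0 ltW.
by apply: le_trans (HC _) _; rewrite normrM normfV (gtr0_norm h0).
Qed.

Lemma trm_expdec p k h : 0 < h <= 1 -> exists C, expdec (trm p k h) C.
Proof.
move=> /andP[h0 h1]; have [C C0 HC] := trm_decay p k.
exists (C * h^-1 ^+ k.+1) => v; apply: le_trans (HC h v h0) _.
apply: ler_wpM2l; first by rewrite mulr_ge0 ?exprn_ge0 ?invr_ge0 ?(ltW h0).
rewrite ler_expR lerN2 -[leLHS]mul1r; apply: ler_pM => //; first by lra.
by rewrite ler_pdivlMr// ler_piMr.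
Qed.

Lemma expdec_le f (C C' : R) : C <= C' -> expdec f C -> expdec f C'.
Proof.
by move=> CC Hf v; apply: le_trans (Hf v) _; apply: ler_wpM2r; rewrite ?expR_ge0.
Qed.

Lemma per_trm_derive p k h u : 0 < h <= 1 ->
  is_derive u (1 : R) (per (trm p k h)) (per (trm (pstep p) k.+1 h) u).
Proof.
move=> h01.
have [C0 H0] := trm_expdec p k h01; have [C1 H1] := trm_expdec (pstep p) k.+1 h01.
have [C2 H2] := trm_expdec (pstep (pstep p)) k.+2 h01.
have m0 : C0 <= Num.max C0 (Num.max C1 C2) by rewrite le_max lexx.
have m1 : C1 <= Num.max C0 (Num.max C1 C2) by rewrite !le_max lexx orbT.
have m2 : C2 <= Num.max C0 (Num.max C1 C2) by rewrite !le_max lexx !orbT.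
exact: (@per_derive R (trm p k h) (trm (pstep p) k.+1 h) (trm (pstep (pstep p)) k.+2 h)
  (Num.max C0 (Num.max C1 C2)) (is_derive_trm p k h) (is_derive_trm (pstep p) k.+1 h)
  (expdec_le m0 H0) (expdec_le m1 H1) (expdec_le m2 H2) u).
Qed.

Definition decC (M : nat) : R := @perC R * (M`!%:R * expR 1) * expR 1.

Lemma decC_ge0 M : 0 <= decC M.
Proof. by rewrite !mulr_ge0 ?perC_ge0 ?expR_ge0 ?ler0n. Qed.

(** One term of the exponential series at 1 + x, namely (1 + x)^M / M! <= exp (1 + x). *)
Lemma expRN_le_powR (M : nat) (x : R) : 0 <= x ->
  expR (- x) <= M`!%:R * expR 1 * (1 + x) `^ (- M%:R).
Proof.
move=> x0; have x1 : 0 < 1 + x by rewrite ltr_wpDr.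
have f0 : 0 < (M`!)%:R :> R by rewrite ltr0n fact_gt0.
rewrite powR_invn ?(ltW x1)// ler_pdivlMr ?exprn_gt0//.
rewrite -(ler_pM2l (expR_gt0 x)) mulrA -expRD subrr expR0 mul1r.
rewrite mulrCA -expRD [x + 1]addrC; case: M f0 => [|M] f0.
  by rewrite expr0 fact0 mul1r -[leLHS]expR0 ler_expR ltW.
have := expR_ge1Dxn M (ltW x1) => H; rewrite mulrC -ler_pdivrMr//.
by apply: le_trans H; lra.
Qed.

(** Of the rate 2, one unit bounds every term by exp (- distZ u / h), because |u + m| >= distZ u;
    the other is at least |u + m| as h <= 1 and makes the series converge. *)
Lemma per_le_decay (f : R -> R) (K h u : R) (M : nat) : 0 < h <= 1 -> `|u| <= 1 ->
  (forall v, `|f v| <= K * expR (- (2 * (`|v| / h)))) ->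
  `|per f u| <= decC M * K * (1 + distZ u / h) `^ (- M%:R).
Proof.
move=> /andP[h0 h1] u1 fK.
have K0 : 0 <= K.
  have := le_trans (normr_ge0 _) (fK 0); by rewrite pmulr_lge0// expR_gt0.
have d0 : 0 <= distZ u / h by rewrite divr_ge0 ?distZ_ge0 ?ltW.
have fb (m : int) : `|f (u + m%:~R)| <= (K * expR (- (distZ u / h))) * expR (- `|u + m%:~R|).
  apply: le_trans (fK _) _; rewrite -mulrA -expRD; apply: ler_wpM2l => //.
  rewrite ler_expR -opprD lerN2 mulr_natl mulr2n; apply: lerD.
    rewrite ler_pM2r ?invr_gt0//.
    by have := distZ_le u (- m); rewrite rmorphN opprK.
  by rewrite ler_pdivlMr// ler_piMr.
apply: le_trans (per_le fb) _.
have H := expRN_le_powR M d0.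
have E1 : expR `|u| <= expR 1 by rewrite ler_expR.
apply: (@le_trans _ _ (perC * (K * (M`!%:R * expR 1 * (1 + distZ u / h) `^ (- M%:R))) * expR 1)).
  apply: ler_pM => //; rewrite ?mulr_ge0 ?perC_ge0 ?expR_ge0//.
  by apply: ler_wpM2l; [exact: perC_ge0|exact: ler_wpM2l].
by rewrite /decC le_eqVlt; apply/orP; left; apply/eqP; ring.
Qed.

Lemma theta_bound p k (M : nat) : exists2 C, 0 <= C & forall h u, 0 < h <= 1 -> `|u| <= 1 ->
  `|per (trm p k h) u| <= C * h^-1 ^+ k * qk M h u.
Proof.
have [C C0 HC] := trm_decay p k; exists (decC M * C); first by rewrite mulr_ge0 ?decC_ge0.
move=> h u h01 u1; have /andP[h0 h1] := h01.
have fK v : `|trm p k h v| <= (C * h^-1 ^+ k.+1) * expR (- (2 * (`|v| / h))).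
  apply: le_trans (HC h v h0) _; apply: ler_wpM2l.
    by rewrite mulr_ge0 ?exprn_ge0 ?invr_ge0 ?(ltW h0).
  have : 0 <= `|v| / h by rewrite divr_ge0 ?(ltW h0).
  by rewrite ler_expR; lra.
apply: le_trans (per_le_decay M h01 u1 fK) _.
by rewrite /qk exprS le_eqVlt; apply/orP; left; apply/eqP; ring.
Qed.

(** Mean value theorem in the inverse scale s = 1/h: the function s^(k+1) gz p (v s) has derivative
    s^k gz q (v s), so that the difference of two scales is again a Gaussian times a polynomial. As
    h <= 2 h', all intermediate s are comparable to 1/h'. *)
Lemma theta_lip p k (M : nat) : exists2 C, 0 <= C & forall h h' u, 0 < h' -> h' <= h ->
  h <= 2 * h' -> h <= 1 -> `|u| <= 1 ->
  `|per (trm p k h) u - per (trm p k h') u| <= C * ((h - h') / h') * h'^-1 ^+ k * qk M h' u.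
Proof.
pose q : {poly R} := k.+1%:R *: p + 'X * pstep p.
have [C C0 HC] := gz_decay q.
exists (decC M * C); first by rewrite mulr_ge0 ?decC_ge0.
move=> h h' u h'0 hh h2 h1 u1; have h0 : 0 < h := lt_le_trans h'0 hh.
have h'01 : 0 < h' <= 1 by rewrite h'0 (le_trans hh).
have h01 : 0 < h <= 1 by rewrite h0.
pose f v := trm p k h v - trm p k h' v.
have fE v : `|f v| <= (C * ((h - h') / h') * h'^-1 ^+ k.+1) * expR (- (2 * (`|v| / h'))).
  pose F (s : R) := s ^+ k.+1 * gz p (v * s).
  have dF (s : R) : is_derive s (1 : R) F (s ^+ k * gz q (v * s)).
    have dg := is_derive_gz p (v * s).
    have dd : is_derive s (1 : R) (fun s : R => v * s) v.
      by apply: is_derive_eq; rewrite /GRing.scale /=; ring.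
    have dc : is_derive s (1 : R) (gz p \o (fun s : R => v * s)) (gz (pstep p) (v * s) * v).
      exact: (@is_derive1_comp R (gz p) (fun s : R => v * s) s _ _ dg dd).
    have dX : is_derive s (1 : R) ((fun s : R => s) ^+ k.+1) ((k.+1%:R * s ^+ k) *: (1 : R)).
      exact: is_deriveX.
    have dM := is_deriveM dX dc.
    have EF : F = (fun s : R => s) ^+ k.+1 * (gz p \o (fun s : R => v * s)).
      by apply/funext => x; rewrite /F !fctE; congr (_ * _); rewrite exprfctE.
    have Ed : s ^+ k * gz q (v * s) = ((fun s : R => s) ^+ k.+1) s *: (gz (pstep p) (v * s) * v) +
        (gz p \o (fun s : R => v * s)) s *: ((k.+1%:R * s ^+ k) *: (1 : R)).
      rewrite exprfctE /GRing.scale /= /gz /q !hornerE /= [s ^+ k.+1]exprS.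
      move: (k.+1%:R : R) (s ^+ k) (p.[v * s]) (p^`().[v * s]) (expR _) => N x a b y.
      by ring.
    by rewrite EF Ed; exact: dM.
  have [s [s1 s2] Es] := MVT_norm h'^-1 h^-1 dF.
  have -> : f v = s ^+ k * gz q (v * s) * (h^-1 - h'^-1) by rewrite -Es.
  have i0 : 0 < h'^-1 by rewrite invr_gt0.
  have hi : h^-1 <= h'^-1 by rewrite lef_pV2.
  have hi2 : h'^-1 / 2 <= h^-1.
    by rewrite -invfM lef_pV2 ?posrE ?mulr_gt0// mulrC.
  have sB : h^-1 <= s <= h'^-1.
    move: s1 s2; rewrite [`|h^-1 - _|]ler0_norm ?subr_le0// !ler_norml.
    by move=> /andP[? ?] /andP[? ?]; apply/andP; split; lra.
  have /andP[sl sr] := sB; have s0 : 0 <= s by lra.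
  rewrite (normrM (s ^+ k * _)) (normrM (s ^+ k)) [`|s ^+ k|]ger0_norm ?exprn_ge0//.
  have dl : `|h^-1 - h'^-1| <= (h - h') / h' * h'^-1.
    rewrite ler0_norm ?subr_le0// opprB.
    have -> : h'^-1 - h^-1 = (h - h') / h' * h^-1 by field; rewrite !lt0r_neq0.
    by apply: ler_wpM2l => //; rewrite divr_ge0 ?subr_ge0// ltW.
  have gl : `|gz q (v * s)| <= C * expR (- (2 * (`|v| / h'))).
    apply: le_trans (HC _) _; apply: ler_wpM2l => //; rewrite ler_expR lerN2.
    rewrite normrM (ger0_norm s0); have := normr_ge0 v; nra.
  have sk : s ^+ k <= h'^-1 ^+ k by rewrite lerXn2r ?nnegrE// ltW.
  apply: (@le_trans _ _ (h'^-1 ^+ k * (C * expR (- (2 * (`|v| / h')))) * ((h - h') / h' * h'^-1))).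
    have A1 : s ^+ k * `|gz q (v * s)| <= h'^-1 ^+ k * (C * expR (- (2 * (`|v| / h')))).
      by apply: ler_pM; rewrite ?exprn_ge0.
    by apply: ler_pM; rewrite ?mulr_ge0 ?exprn_ge0.
  by rewrite exprS le_eqVlt; apply/orP; left; apply/eqP; ring.
have -> : per (trm p k h) u - per (trm p k h') u = per f u.
  have [C1 H1] := trm_expdec p k h01; have [C2 H2] := trm_expdec p k h'01.
  rewrite /per -lim_seriesB; [|exact: expdec_cvg H1|exact: expdec_cvg H2].
  congr (limn (series _)); apply/funext => j; rewrite /pterm /f !fctE /=; ring.
apply: le_trans (per_le_decay M h'01 u1 fE) _.
by rewrite /qk exprS le_eqVlt; apply/orP; left; apply/eqP; ring.
Qed.

End GaussianPolynomials.

(** * The heat kernel as a product of one-dimensional periodisations *)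

Section LatticeSum.
Context {R : realType} {n : nat}.
Implicit Types (x y : 'rV[R]_n).

(** Parametrises the integers from -(N+1) to N in the same way as [pterm] groups them, so that sums
    over boxes become products of partial sums of one-dimensional series. *)
Definition zint (N : nat) (z : 'I_N.+1 * bool) : int := if z.2 then Negz z.1 else Posz z.1.

Lemma zint_inj N : injective (@zint N).
Proof.
move=> [i b] [j b']; rewrite /zint /=; case: b; case: b' => // -[ij]; congr (_, _); exact: val_inj.
Qed.

Definition boxpt N (g : {ffun 'I_n -> 'I_N.+1 * bool}) : 'rV[int]_n := \row_i zint (g i).

Lemma boxpt_inj N : injective (@boxpt N).
Proof.
move=> g g' /rowP H; apply/ffunP => i; have := H i.
by rewrite !mxE; exact: zint_inj.
Qed.

Definition box N : seq 'rV[int]_n := [seq boxpt g | g <- enum {ffun 'I_n -> 'I_N.+1 * bool}].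

Lemma box_uniq N : uniq (box N).
Proof. by rewrite map_inj_uniq ?enum_uniq//; exact: boxpt_inj. Qed.

Lemma mem_box N (m : 'rV[int]_n) : (forall i, `|m ord0 i|%N <= N)%N -> m \in box N.
Proof.
move=> mN; apply/mapP.
exists [ffun i => match m ord0 i with Posz j => (inord j, false) | Negz j => (inord j, true) end].
  by rewrite mem_enum.
apply/rowP => i; rewrite !mxE ffunE; have := mN i.
case E : (m ord0 i) => [j|j] jN; rewrite /zint /= inordK//.
by apply: leq_trans jN _.
Qed.

Lemma pterm_sum (f : R -> R) (u : R) N :
  series (pterm f u) N.+1 = \sum_(z : 'I_N.+1 * bool) f (u + (zint z)%:~R).
Proof.
rewrite /series /= big_mkord -(pair_bigA _ (fun i b => f (u + (zint (i, b))%:~R))) /=.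
apply: eq_bigr => i _; rewrite big_bool /= /zint /= NegzE rmorphN addrC.
by [].
Qed.

Lemma sum_box (f : R -> R) x N :
  \sum_(m <- box N) \prod_i f ((x + map_mx intr m) ord0 i) =
  \prod_i series (pterm f (x ord0 i)) N.+1.
Proof.
under [RHS]eq_bigr do rewrite pterm_sum.
rewrite bigA_distr_bigA /= big_map big_enum; apply: eq_bigr => g _.
by apply: eq_bigr => i _; rewrite !mxE.
Qed.

Lemma cvg_prod_series (f : R -> R) x : (forall u, cvgn (series (pterm f u))) ->
  \prod_i series (pterm f (x ord0 i)) N.+1 @[N --> \oo] --> \prod_i per f (x ord0 i).
Proof.
move=> cf; elim: (index_enum _) => [|i s IH].
  by under eq_fun do rewrite big_nil; rewrite big_nil; exact: cvg_cst.
under eq_fun do rewrite big_cons; rewrite big_cons; apply: cvgM => //.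
by have := cf (x ord0 i); rewrite (cvg_shiftS (series (pterm f (x ord0 i)))).
Qed.

(** Every finite set of lattice points lies in a box, and the boxes exhaust the lattice; the sum
    over a box is a product of partial sums, which increase to [per f]. *)
Lemma esum_lattice (f : R -> R) x : (forall u, 0 <= f u) ->
  (forall u, cvgn (series (pterm f u))) ->
  (\esum_(m in [set: 'rV[int]_n]) (\prod_i f ((x + map_mx intr m) ord0 i))%:E
    = (\prod_i per f (x ord0 i))%:E)%E.
Proof.
move=> f0 cf; set F := fun m : 'rV[int]_n => (\prod_i f ((x + map_mx intr m) ord0 i))%:E.
have F0 m : (0 <= F m)%E by rewrite lee_fin prodr_ge0.
have S0 u N : 0 <= series (pterm f u) N.
  by rewrite /series /= sumr_ge0// => i _; rewrite addr_ge0.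
have Sle u N : series (pterm f u) N <= per f u.
  apply: nondecreasing_cvgn_le; last exact: cf.
  by apply/nondecreasing_seqP => k; rewrite /series /= big_nat_recr//= lerDl addr_ge0.
have sumE N : (\sum_(m \in [set` box N]) F m = (\prod_i series (pterm f (x ord0 i)) N.+1)%:E)%E.
  by rewrite -fsbig_seq ?box_uniq// sumEFin sum_box.
have up : (\esum_(m in [set: 'rV[int]_n]) F m <= (\prod_i per f (x ord0 i))%:E)%E.
  apply: ge_ereal_sup => _ [X [finX _] <-].
  have [s Xs] := (finite_seqP X).1 finX.
  pose N := (\max_(m <- s) \max_(i < n) `|m ord0 i|)%N.
  apply: (@le_trans _ _ (\sum_(m \in [set` box N]) F m)%E).
    have finB : finite_set [set` box N] by apply/finite_seqP; exists (box N).
    apply: lee_fsum_nneg_subset => //.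
    move=> m mX; rewrite inE /=; apply: mem_box => i.
    apply: (@leq_trans (\max_(i < n) `|m ord0 i|)%N); first exact: leq_bigmax.
    rewrite /N; apply: (@leq_bigmax_seq _ _ xpredT (fun m : 'rV[int]_n => \max_(i < n) `|m ord0 i|)%N m) => //.
    by move: mX; rewrite Xs inE.
  by rewrite sumE lee_fin; apply: ler_prod => i _; rewrite S0 Sle.
apply/eqP; rewrite eq_le up /=.
have Ege0 : (0 <= \esum_(m in [set: 'rV[int]_n]) F m)%E by apply: esum_ge0.
have Efin : \esum_(m in [set: 'rV[int]_n]) F m \is a fin_num.
  by rewrite ge0_fin_numE//; apply: le_lt_trans up _; exact: ltry.
rewrite -(fineK Efin) lee_fin.
have /cvg_lim <- // := @cvg_prod_series f x cf.
apply: limr_le; first by apply/cvg_ex; eexists; exact: cvg_prod_series.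
apply: nearW => N; rewrite -lee_fin (fineK Efin) -sumE.
apply: esum_ge; exists [set` box N] => //.
by split => //; apply/finite_seqP; exists (box N).
Qed.

End LatticeSum.

Section HeatKernelProduct.
Context {R : realType} {n : nat}.
Implicit Types (x y : 'rV[R]_n) (h r : R).

Definition hpoly0 : {poly R} := ((4 * pi) `^ (- 2^-1))%:P.

(** The k-th derivative in u of the heat kernel of the circle at time h^2, a Jacobi theta function;
    [hpoly0] is the constant (4 pi)^(-1/2). *)
Definition theta (k : nat) h : R -> R := per (trm (iter k pstep hpoly0) k h).

Lemma gauss_prod r y : 0 < r -> gauss r y = \prod_i trm hpoly0 0 (Num.sqrt r) (y ord0 i).
Proof.
move=> r0; set h := Num.sqrt r; have h0 : 0 < h by rewrite sqrtr_gt0.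
have hr : h ^+ 2 = r by rewrite sqr_sqrtr// ltW.
have pi4 : 0 <= 4 * pi :> R by rewrite mulr_ge0// pi_ge0.
rewrite /trm /gz /gauss big_split /= prodr_const card_ord.
under [X in _ = _ * X]eq_bigr do rewrite hornerC.
rewrite big_split /= prodr_const card_ord mulrA -exprMn; congr (_ * _).
  have -> : - (n%:R / 2) = - 2^-1 * n%:R :> R by ring.
  rewrite powRrM powR_mulrn ?powR_ge0//; congr (_ ^+ _).
  rewrite powRM// ?(ltW r0)// mulrC; congr (_ * _).
  by rewrite powRN powR12_sqrt// ltW.
rewrite -expR_sum; congr expR; rewrite /sqnorm -sumrN mulr_suml.
apply: eq_bigr => i _; rewrite exprMn exprVn hr; field; exact: lt0r_neq0.
Qed.

Lemma theta_cvg k h u : 0 < h <= 1 -> cvgn (series (pterm (trm (iter k pstep hpoly0) k h) u)).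
Proof. by move=> h01; have [C HC] := trm_expdec (iter k pstep hpoly0) k h01; exact: expdec_cvg HC. Qed.

Lemma sqrt01 r : 0 < r <= 1 -> 0 < Num.sqrt r <= 1.
Proof. by move=> /andP[r0 r1]; rewrite sqrtr_gt0 r0 -sqrtr1 ler_wsqrtr. Qed.

Lemma heatG_prod r x : 0 < r <= 1 -> heatG r x = \prod_i theta 0 (Num.sqrt r) (x ord0 i).
Proof.
move=> r01; have h01 := sqrt01 r01; have /andP[r0 _] := r01; have /andP[h0 _] := h01.
rewrite /heatG.
rewrite (eq_esum (b := fun m => (\prod_i trm hpoly0 0 (Num.sqrt r) ((x + map_mx intr m) ord0 i))%:E)).
  rewrite esum_lattice// => u; last exact: (@theta_cvg 0).
  by rewrite /trm /gz hornerC !mulr_ge0 ?powR_ge0 ?expR_ge0// expr1 invr_ge0 ltW.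
by move=> m _; rewrite gauss_prod.
Qed.

Lemma theta_derive k h u : 0 < h <= 1 -> is_derive u (1 : R) (theta k h) (theta k.+1 h u).
Proof. by move=> h01; exact: per_trm_derive. Qed.

Definition thetaprod (m : 'I_n -> nat) h x : R := \prod_i theta (m i) h (x ord0 i).

Lemma eq_thetaprod (m m' : 'I_n -> nat) h : m =1 m' -> thetaprod m h = thetaprod m' h.
Proof. by move=> /funext ->. Qed.

Lemma pderiv_thetaprod (m : 'I_n -> nat) h i : 0 < h <= 1 ->
  pderiv i (thetaprod m h) = thetaprod (fun j => m j + (j == i))%N h.
Proof.
move=> h01; apply/funext => x; rewrite /pderiv.
pose c := \prod_(j | j != i) theta (m j) h (x ord0 j).
have dd : is_derive (0 : R) (1 : R) (fun t : R => x ord0 i + t) 1.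
  by apply: is_derive_eq; ring.
have dg : is_derive (x ord0 i + 0) (1 : R) (theta (m i) h) (theta (m i).+1 h (x ord0 i)).
  by rewrite addr0; exact: theta_derive.
have dc := @is_derive1_comp R (theta (m i) h) (fun t : R => x ord0 i + t) 0 _ _ dg dd.
have -> : (fun t => thetaprod m h (x + t *: delta_mx ord0 i)) =
    c *: (theta (m i) h \o (fun t : R => x ord0 i + t)).
  apply/funext => t; rewrite /thetaprod (bigD1 i)//= !mxE !eqxx /= mulr1 mulrC.
  rewrite fctE /GRing.scale /=; congr (_ * _); apply: eq_bigr => j /negbTE ji.
  by rewrite !mxE ji andbF mulr0 addr0.
have dZ := is_deriveZ c dc.
rewrite derive1E (@derive_val _ _ _ _ _ _ _ dZ) /GRing.scale /= mulr1.
rewrite /thetaprod (bigD1 i)//= eqxx addn1 mulrC; congr (_ * _).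
by apply: eq_bigr => j /negbTE ->; rewrite addn0.
Qed.

Lemma kderiv_heatG r (k : 'I_n -> nat) x : 0 < r <= 1 ->
  kderiv k (heatG r) x = thetaprod k (Num.sqrt r) x.
Proof.
move=> r01; have h01 := sqrt01 r01; set h := Num.sqrt r in h01 *.
have -> : heatG r = thetaprod (fun=> 0%N) h by apply/funext => y; exact: heatG_prod.
have itE (m : 'I_n -> nat) i q : iter q (pderiv i) (thetaprod m h) =
    thetaprod (fun j => m j + (j == i) * q)%N h.
  elim: q => [|q IH]; first by apply: eq_thetaprod => j; rewrite muln0 addn0.
  rewrite iterS IH (pderiv_thetaprod _ _ h01); apply: eq_thetaprod => j.
  by rewrite mulnS addnAC addnA.
rewrite /kderiv.
suff H s : uniq s -> foldr (fun i g => iter (k i) (pderiv i) g) (thetaprod (fun=> 0%N) h) s =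
    thetaprod (fun j => (j \in s) * k j)%N h.
  rewrite (H _ (enum_uniq _)) (@eq_thetaprod _ k)// => j.
  by rewrite mem_enum mul1n.
elim: s => [_|i s IH /= /andP[ins us]] /=; first exact: eq_thetaprod.
rewrite (IH us) itE; apply: eq_thetaprod => j; rewrite inE.
by have [->|ji] := eqVneq j i; rewrite ?(negbTE ins) ?mul0n ?addn0 ?mul1n.
Qed.

End HeatKernelProduct.

Section KernelMajorant.
Context {R : realType} {n : nat}.
Implicit Types (x y : 'rV[R]_n) (h r : R).

Definition maj (e r : R) y : R := if 0 < r then r `^ e * Q (Num.sqrt r) y else 0.

Lemma maj_ge0 e r y : 0 <= maj e r y.
Proof.
rewrite /maj; case: ifP => // r0.
by rewrite mulr_ge0 ?powR_ge0// Q_ge0// sqrtr_gt0.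
Qed.

Lemma sqrt_powV r (m : nat) : 0 < r -> (Num.sqrt r)^-1 ^+ m = r `^ (- (m%:R / 2)).
Proof.
move=> r0; have -> : - (m%:R / 2) = 2^-1 * (- m%:R) :> R by ring.
by rewrite powRrM powR12_sqrt ?(ltW r0)// powR_invn ?sqrtr_ge0// exprVn.
Qed.

Lemma sqrt_powV_prod r (k : 'I_n -> nat) : 0 < r ->
  \prod_i (Num.sqrt r)^-1 ^+ k i = r `^ (- ((ksize k)%:R / 2)).
Proof. by move=> r0; rewrite prodrXr -/(ksize k) sqrt_powV. Qed.

Lemma theta_prod_bound (k : 'I_n -> nat) : exists2 C : R, 0 <= C &
  forall r y, 0 < r <= 1 -> (forall i, `|y ord0 i| <= 1) ->
  `|thetaprod k (Num.sqrt r) y| <= C * r `^ (- ((ksize k)%:R / 2)) * Q (Num.sqrt r) y.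
Proof.
have H i := theta_bound (iter (k i) pstep (@hpoly0 R)) (k i) n.+1.
have /choice[C CP] : forall i, exists D, 0 <= D /\ forall h u, 0 < h <= 1 -> `|u| <= 1 ->
    `|theta (k i) h u| <= D * h^-1 ^+ k i * qk n.+1 h u.
  move=> i; have [D D0 HD] := H i; by exists D.
exists (\prod_i C i) => [|r y r01 y1].
  by apply: prodr_ge0 => i _; have [] := CP i.
have h01 := sqrt01 r01; have /andP[r0 _] := r01.
rewrite -sqrt_powV_prod// /thetaprod normr_prod /Q -!big_split /=.
by apply: ler_prod => i _; rewrite normr_ge0 /=; apply: (CP i).2.
Qed.

Lemma kfac_bound (gam : R) (k : 'I_n -> nat) : exists2 C : R, 0 <= C &
  forall r y, r <= 1 -> (forall i, `|y ord0 i| <= 1) ->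
  `|kfac gam k r y| <= C * maj (gam - (ksize k)%:R / 2) r y.
Proof.
have [C C0 HC] := theta_prod_bound k; exists C => // r y r1 y1.
rewrite /kfac /maj; case: ifP => r0; last by rewrite normr0 mulr0.
have r01 : 0 < r <= 1 by rewrite r0.
rewrite kderiv_heatG// normrM ger0_norm ?powR_ge0//.
apply: le_trans (ler_wpM2l (powR_ge0 r gam) (HC r y r01 y1)) _.
rewrite powRD ?lt0r_neq0 ?implybT//.
by rewrite le_eqVlt; apply/orP; left; apply/eqP; ring.
Qed.

Lemma prod_diff (I : Type) (s : seq I) (A B M : I -> R) (d : R) : 0 <= d ->
  (forall i, `|A i| <= M i) -> (forall i, `|B i| <= M i) ->
  (forall i, `|A i - B i| <= d * M i) ->
  `|\prod_(i <- s) A i - \prod_(i <- s) B i| <= (size s)%:R * d * \prod_(i <- s) M i.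
Proof.
move=> d0 HA HB HAB; have M0 i : 0 <= M i := le_trans (normr_ge0 _) (HA i).
elim: s => [|i s IH]; first by rewrite !big_nil subrr normr0 !mul0r.
rewrite !big_cons.
have -> : A i * \prod_(j <- s) A j - B i * \prod_(j <- s) B j =
   A i * (\prod_(j <- s) A j - \prod_(j <- s) B j) + (A i - B i) * \prod_(j <- s) B j by ring.
have PB : `|\prod_(j <- s) B j| <= \prod_(j <- s) M j.
  by rewrite normr_prod; apply: ler_prod => j _; rewrite normr_ge0 HB.
apply: le_trans (ler_normD _ _) _; rewrite !normrM.
apply: (@le_trans _ _ (M i * ((size s)%:R * d * \prod_(j <- s) M j) + d * M i * \prod_(j <- s) M j)).
  by apply: lerD; apply: ler_pM.
by rewrite /= -natr1 le_eqVlt; apply/orP; left; apply/eqP; ring.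
Qed.

(** Telescoping over the coordinates. With h = sqrt r, the relative increment d of the scale is at
    most that of the time and at most 1, so the factors at both scales are bounded by twice the
    majorant at h'. The second conclusion moves the bound at r to the earlier time r'. *)
Lemma theta_prod_lip (k : 'I_n -> nat) : exists2 C : R, 0 <= C &
  forall r r' y, 0 < r' -> r' <= r -> r <= 2 * r' -> r <= 1 -> (forall i, `|y ord0 i| <= 1) ->
  `|thetaprod k (Num.sqrt r) y - thetaprod k (Num.sqrt r') y| <=
     C * ((r - r') / r') * (r' `^ (- ((ksize k)%:R / 2)) * Q (Num.sqrt r') y) /\
  `|thetaprod k (Num.sqrt r) y| <= C * (r' `^ (- ((ksize k)%:R / 2)) * Q (Num.sqrt r') y).
Proof.
have H1 i := theta_bound (iter (k i) pstep (@hpoly0 R)) (k i) n.+1.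
have H2 i := theta_lip (iter (k i) pstep (@hpoly0 R)) (k i) n.+1.
pose PC i (D : R) := [/\ 0 <= D, forall h u, 0 < h <= 1 -> `|u| <= 1 ->
  `|theta (k i) h u| <= D * h^-1 ^+ k i * qk n.+1 h u & forall h h' u, 0 < h' -> h' <= h ->
  h <= 2 * h' -> h <= 1 -> `|u| <= 1 ->
  `|theta (k i) h u - theta (k i) h' u| <= D * ((h - h') / h') * h'^-1 ^+ k i * qk n.+1 h' u].
have /choice[C CP] : forall i, exists D, PC i D.
  move=> i.
  have [D1 D10 HD1] := H1 i; have [D2 D20 HD2] := H2 i.
  exists (D1 + D2); split.
  - by rewrite addr_ge0.
  - move=> h u h01 u1; have /andP[h0 _] := h01; apply: le_trans (HD1 h u h01 u1) _.
    apply: ler_wpM2r; first exact: qk_ge0.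
    apply: ler_wpM2r; first by rewrite exprn_ge0// invr_ge0 ltW.
    by rewrite lerDl.
  - move=> h h' u h'0 hh h2 h1 u1; apply: le_trans (HD2 h h' u h'0 hh h2 h1 u1) _.
    apply: ler_wpM2r; first exact: qk_ge0.
    apply: ler_wpM2r; first by rewrite exprn_ge0// invr_ge0 ltW.
    apply: ler_wpM2r; first by rewrite divr_ge0 ?subr_ge0// ltW.
    by rewrite lerDr.
have C0 i : 0 <= C i by have [] := CP i.
pose M0 := \prod_i (2 * C i).
have M00 : 0 <= M0 by apply: prodr_ge0 => i _; rewrite mulr_ge0.
exists ((n%:R + 1) * M0); first by rewrite mulr_ge0// addr_ge0.
move=> r r' y r'0 rr r2 r1 y1; set h := Num.sqrt r; set h' := Num.sqrt r'.
have r0 : 0 < r := lt_le_trans r'0 rr.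
have h'0 : 0 < h' by rewrite sqrtr_gt0.
have hh : h' <= h by rewrite ler_wsqrtr.
have hr : h ^+ 2 = r by rewrite sqr_sqrtr// ltW.
have hr' : h' ^+ 2 = r' by rewrite sqr_sqrtr// ltW.
have h1 : h <= 1 by rewrite -sqrtr1 ler_wsqrtr.
have h2 : h <= 2 * h' by rewrite -ler_sqr ?nnegrE ?mulr_ge0 ?sqrtr_ge0// exprMn hr hr'; lra.
have h'01 : 0 < h' <= 1 by rewrite h'0 (le_trans hh).
pose d := (h - h') / h'.
have d0 : 0 <= d by rewrite divr_ge0 ?subr_ge0// ltW.
have d1 : d <= 1 by rewrite ler_pdivrMr//; lra.
have dr : d <= (r - r') / r'.
  rewrite /d ler_pdivrMr// mulrAC ler_pdivlMr// -hr -hr'.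
  have -> : (h ^+ 2 - h' ^+ 2) * h' = (h - h') * (h' ^+ 2 + h * h') by ring.
  by apply: ler_wpM2l; rewrite ?subr_ge0// lerDl mulr_ge0 ?(ltW h'0)// (le_trans _ hh)// ltW.
pose M i := 2 * C i * (h'^-1 ^+ k i * qk n.+1 h' (y ord0 i)).
have q0 i : 0 <= h'^-1 ^+ k i * qk n.+1 h' (y ord0 i).
  by rewrite mulr_ge0 ?qk_ge0// exprn_ge0// invr_ge0 ltW.
have ME : \prod_i M i = M0 * (r' `^ (- ((ksize k)%:R / 2)) * Q h' y).
  by rewrite /M big_split /= -/M0 big_split /= sqrt_powV_prod.
have HB i : `|theta (k i) h' (y ord0 i)| <= C i * (h'^-1 ^+ k i * qk n.+1 h' (y ord0 i)).
  by rewrite mulrA; have [_ H _] := CP i; exact: H.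
have HD i : `|theta (k i) h (y ord0 i) - theta (k i) h' (y ord0 i)| <=
    d * (C i * (h'^-1 ^+ k i * qk n.+1 h' (y ord0 i))).
  have [_ _ H] := CP i; apply: le_trans (H h h' _ h'0 hh h2 h1 (y1 i)) _.
  by rewrite le_eqVlt; apply/orP; left; apply/eqP; rewrite /d; ring.
have X0 i : 0 <= C i * (h'^-1 ^+ k i * qk n.+1 h' (y ord0 i)) by rewrite mulr_ge0.
have HA i : `|theta (k i) h (y ord0 i)| <= M i.
  have -> : theta (k i) h (y ord0 i) = (theta (k i) h (y ord0 i) - theta (k i) h' (y ord0 i))
     + theta (k i) h' (y ord0 i) by rewrite subrK.
  apply: le_trans (ler_normD _ _) _.
  apply: le_trans (lerD (HD i) (HB i)) _; rewrite /M -mulrA.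
  have := X0 i; nra.
have M1 i : C i * (h'^-1 ^+ k i * qk n.+1 h' (y ord0 i)) <= M i.
  by rewrite /M -mulrA; have := X0 i; lra.
have N0 : 0 <= r' `^ (- ((ksize k)%:R / 2)) * Q h' y.
  by rewrite mulr_ge0 ?powR_ge0 ?Q_ge0.
split.
  apply: le_trans (@prod_diff _ (index_enum 'I_n) _ _ M d d0 HA _ _) _.
  - by move=> i; exact: le_trans (HB i) (M1 i).
  - by move=> i; apply: le_trans (HD i) _; exact: ler_wpM2l.
  have -> : size (index_enum 'I_n) = n by rewrite /index_enum -enumT size_enum_ord.
  rewrite ME mulrA; apply: ler_wpM2r => //.
  apply: (@le_trans _ _ ((n%:R + 1) * M0 * d)).
    rewrite -subr_ge0 (_ : _ - _ = M0 * d); first exact: mulr_ge0.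
    by ring.
  by apply: ler_wpM2l => //; rewrite mulr_ge0// addr_ge0.
rewrite /thetaprod normr_prod.
apply: (@le_trans _ _ (\prod_i M i)); first by apply: ler_prod => i _; rewrite normr_ge0 HA.
rewrite ME; apply: ler_wpM2r => //; rewrite ler_peMl// lerDr; exact: ler0n.
Qed.

(** By homogeneity everything depends on t = r / r' between 1 and 2, where the mean value theorem
    applies to the power function. *)
Lemma powR_lip (g : R) : exists2 C : R, 0 <= C & forall r r', 0 < r' -> r' <= r -> r <= 2 * r' ->
  `|r `^ g - r' `^ g| <= C * ((r - r') / r') * r' `^ g /\ r `^ g <= C * r' `^ g.
Proof.
pose C := `|g| * 2 `^ `|g - 1| + 2 `^ `|g|.
exists C => [|r r' r'0 rr r2]; first by rewrite addr_ge0// mulr_ge0 ?powR_ge0.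
have r0 : 0 < r := lt_le_trans r'0 rr.
pose t := r / r'.
have t1 : 1 <= t by rewrite ler_pdivlMr// mul1r.
have t2 : t <= 2 by rewrite ler_pdivrMr.
have t0 : 0 < t by lra.
have rE : r `^ g = t `^ g * r' `^ g.
  by rewrite -powRM ?(ltW t0) ?(ltW r'0)// /t divfK// lt0r_neq0.
have pb (s x : R) : 1 <= x -> x <= 2 -> x `^ s <= 2 `^ `|s|.
  move=> x1 x2; apply: (@le_trans _ _ (x `^ `|s|)).
    by apply: ler_powR => //; exact: ler_norm.
  by apply: ge0_ler_powR; rewrite ?nnegrE//; lra.
split; last first.
  rewrite rE; apply: ler_wpM2r; first exact: powR_ge0.
  by apply: le_trans (pb g t t1 t2) _; rewrite lerDr mulr_ge0 ?powR_ge0.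
have -> : r `^ g - r' `^ g = (t `^ g - 1) * r' `^ g by rewrite rE; ring.
rewrite normrM [`|r' `^ g|]ger0_norm ?powR_ge0//; apply: ler_wpM2r; first exact: powR_ge0.
have -> : (r - r') / r' = t - 1 by rewrite /t; field; exact: lt0r_neq0.
have [x||x] := @MVT_segment R (fun x : R => x `^ g) (fun x : R => g * x `^ (g - 1)) 1 t t1.
- rewrite in_itv /= => /andP[x1 _]; have x0 : 0 < x by lra.
  exact: is_derive1_powR.
- apply: derivable_within_continuous => x; rewrite in_itv /= => /andP[x1 _].
  have x0 : 0 < x by lra.
  by have [] := is_derive1_powR g x0.
rewrite in_itv /= powR1 => /andP[x1 xt] ->.
rewrite normrM [`|t - 1|]ger0_norm ?subr_ge0//; apply: ler_wpM2r; first by rewrite subr_ge0.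
rewrite normrM [`|x `^ _|]ger0_norm ?powR_ge0//.
apply: (@le_trans _ _ (`|g| * 2 `^ `|g - 1|)); last by rewrite lerDl powR_ge0.
by apply: ler_wpM2l => //; apply: pb => //; lra.
Qed.

Lemma maj_shift (e ka r d : R) y : 0 <= ka <= 1 -> 0 < r -> r <= 2 * d ->
  maj e r y <= 2 * (d `^ ka * maj (e - ka) r y).
Proof.
move=> /andP[k0 k1] r0 rd; rewrite /maj r0.
have q0 : 0 <= Q (Num.sqrt r) y by rewrite Q_ge0// sqrtr_gt0.
have d0 : 0 < d by lra.
have -> : r `^ e = r `^ ka * r `^ (e - ka).
  by rewrite -powRD ?lt0r_neq0 ?implybT//; congr powR; ring.
have rk : r `^ ka <= 2 * d `^ ka.
  apply: (@le_trans _ _ ((2 * d) `^ ka)).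
    by apply: ge0_ler_powR; rewrite ?nnegrE//; lra.
  rewrite powRM ?(ltW d0)//; apply: ler_wpM2r; first exact: powR_ge0.
  have : (2 : R) `^ ka <= 2 `^ 1 by apply: ler_powR => //; lra.
  by rewrite powRr1.
rewrite mulrA [leRHS](_ : _ = (2 * d `^ ka) * r `^ (e - ka) * Q (Num.sqrt r) y); last by ring.
by apply: ler_wpM2r => //; apply: ler_wpM2r => //; exact: powR_ge0.
Qed.

(** Interpolation. If r is at least 2 r', or r' <= 0, both elapsed times are at most twice their
    difference d, and the trivial bounds suffice after trading ka powers of time for d^ka. Otherwise
    the kernel is Lipschitz in the relative increment d / r'. *)
Lemma kfac_diff (gam ka : R) (k : 'I_n -> nat) : 0 <= ka <= 1 -> exists2 C : R, 0 <= C &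
  forall r r' y, r' <= r -> r <= 1 -> (forall i, `|y ord0 i| <= 1) ->
  `|kfac gam k r y - kfac gam k r' y| <= C * (r - r') `^ ka *
    (maj (gam - (ksize k)%:R / 2 - ka) r y + maj (gam - (ksize k)%:R / 2 - ka) r' y).
Proof.
move=> ka01; have /andP[ka0 ka1] := ka01; set e := gam - _.
have [C1 C10 H1] := kfac_bound gam k; have [C2 C20 H2] := theta_prod_lip k.
have [C3 C30 H3] := powR_lip gam.
exists (2 * C1 + 2 * C3 * C2) => [|r r' y rr r1 y1]; first by rewrite addr_ge0// !mulr_ge0.
have m0 s : 0 <= maj (e - ka) s y by exact: maj_ge0.
set d := r - r'; have d0 : 0 <= d by rewrite subr_ge0.
have P0 : 0 <= d `^ ka := powR_ge0 _ _.
have far : (r <= 2 * d) -> r' <= 2 * d -> `|kfac gam k r y - kfac gam k r' y| <=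
    2 * C1 * (d `^ ka * (maj (e - ka) r y + maj (e - ka) r' y)).
  move=> rd rd'; apply: le_trans (ler_normB _ _) _.
  have sh s : s <= 2 * d -> maj e s y <= 2 * (d `^ ka * maj (e - ka) s y).
    move=> sd; have [s0|s0] := ltP 0 s; first exact: maj_shift.
    by rewrite /maj ltNge s0 /= !mulr0.
  apply: (@le_trans _ _ (C1 * maj e r y + C1 * maj e r' y)).
    by apply: lerD; apply: H1 => //; exact: le_trans rr r1.
  rewrite -mulrDr [leRHS](_ : _ = C1 * (2 * (d `^ ka * maj (e - ka) r y) + 2 * (d `^ ka * maj (e - ka) r' y))); last by ring.
  by apply: ler_wpM2l => //; apply: lerD; exact: sh.
have T0 : 0 <= d `^ ka * (maj (e - ka) r y + maj (e - ka) r' y) by rewrite mulr_ge0// addr_ge0.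
have [r'0|r'0] := leP r' 0.
  have [r0|r0] := leP r 0.
    rewrite /kfac !ltNge r0 r'0 /= subrr normr0 -mulrA.
    by rewrite mulr_ge0// addr_ge0// !mulr_ge0.
  have f1 : r <= 2 * d by move: r'0 r0; rewrite /d; clear; lra.
  have f2 : r' <= 2 * d by move: r'0 r0; rewrite /d; clear; lra.
  apply: (le_trans (far f1 f2)).
  by rewrite -[leRHS]mulrA; apply: ler_wpM2r => //; rewrite lerDl !mulr_ge0.
have [r2|r2] := leP (2 * r') r.
  have f1 : r <= 2 * d by move: r2 r'0; rewrite /d; clear; lra.
  have f2 : r' <= 2 * d by move: r2 r'0; rewrite /d; clear; lra.
  apply: (le_trans (far f1 f2)).
  by rewrite -[leRHS]mulrA; apply: ler_wpM2r => //; rewrite lerDl !mulr_ge0.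
have r0 : 0 < r := lt_le_trans r'0 rr.
have [A1 A2] := H2 r r' y r'0 rr (ltW r2) r1 y1.
have [B1 B2] := H3 r r' r'0 rr (ltW r2).
have r'2 : r' <= 2 * r' by move: r'0; clear; lra.
have [_ A3] := H2 r' r' y r'0 (lexx _) r'2 (le_trans rr r1) y1.
rewrite /kfac r0 r'0 !kderiv_heatG ?r0 ?r'0 ?(le_trans rr r1)//.
set X := thetaprod _ _ _ in A1 A2 *; set X' := thetaprod _ _ _ in A1 A3 *.
set N := r' `^ _ * Q _ _ in A1 A2 A3.
have N0 : 0 <= N by rewrite mulr_ge0 ?powR_ge0// Q_ge0// sqrtr_gt0.
set dl := d / r' in A1 B1.
have dl0 : 0 <= dl by rewrite divr_ge0// ltW.
have dl1 : dl <= 1 by rewrite ler_pdivrMr// /d; move: r2; clear; lra.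
have -> : r `^ gam * X - r' `^ gam * X' = r `^ gam * (X - X') + (r `^ gam - r' `^ gam) * X' by ring.
have g0 : 0 <= r' `^ gam := powR_ge0 _ _.
have K : `|r `^ gam * (X - X') + (r `^ gam - r' `^ gam) * X'| <=
    2 * C3 * C2 * dl * (r' `^ gam * N).
  apply: le_trans (ler_normD _ _) _; rewrite !normrM [`|r `^ gam|]ger0_norm ?powR_ge0//.
  apply: (@le_trans _ _ ((C3 * r' `^ gam) * (C2 * dl * N) + (C3 * dl * r' `^ gam) * (C2 * N))).
    by apply: lerD; apply: ler_pM; rewrite ?powR_ge0.
  by rewrite le_eqVlt; apply/orP; left; apply/eqP; ring.
apply: (le_trans K).
(* A relative increment in the unit interval is at most its power ka, since ka <= 1. *)
have dlk : dl <= d `^ ka * r' `^ (- ka).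
  have -> : d `^ ka * r' `^ (- ka) = dl `^ ka.
    by rewrite /dl powRM ?invr_ge0 ?(ltW r'0)// -powR_inv1 ?(ltW r'0)// -powRrM mulN1r.
  have [->|dln] := eqVneq dl 0; first exact: powR_ge0.
  have dlp : 0 < dl <= 1 by rewrite lt_def dln dl0.
  by apply: ger1_powR.
have -> : r' `^ gam * N = r' `^ ka * maj (e - ka) r' y.
  rewrite /maj r'0 /N !mulrA -!powRD ?lt0r_neq0 ?implybT//; congr (powR _ _ * _).
  by rewrite /e; ring.
apply: (@le_trans _ _ (2 * C3 * C2 * (d `^ ka * maj (e - ka) r' y))).
  rewrite -[leLHS]mulrA; apply: ler_wpM2l; first by rewrite !mulr_ge0.
  rewrite mulrA; apply: ler_wpM2r => //.
  apply: (@le_trans _ _ (d `^ ka * r' `^ (- ka) * r' `^ ka)).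
    by apply: ler_wpM2r; rewrite ?powR_ge0.
  by rewrite -mulrA -powRD ?addNr ?powRr0 ?mulr1// lt0r_neq0// implybT.
rewrite -[leRHS]mulrA; apply: ler_pM; rewrite ?mulr_ge0//.
  by rewrite lerDr !mulr_ge0.
by apply: ler_wpM2l => //; rewrite lerDr.
Qed.

End KernelMajorant.

(** * Forests and pivots *)

Section ForestCombinatorics.
Context {V : finType}.
Variables (par : V -> V) (rho rhob : V).
Hypothesis forest : is_forest par rho rhob.
Local Notation br := (branch par).
Local Notation Vs := (Vstar rho rhob).
Local Notation isr := (is_root rho rhob).

(** The bound on the number of iterations in [branch] is harmless: an orbit of [par] has at most
    #|V| points, so a reachable vertex is reached within that many steps. *)
Lemma branchP v w : reflect (exists k, iter k par w = v) (w \in br v).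
Proof.
apply: (iffP idP); rewrite inE.
  by case/existsP => k /eqP; exists k.
case=> k E; have /iter_findex F : fconnect par w v by rewrite -E fconnect_iter.
have lt : (findex par w v < #|V|.+1)%N.
  by rewrite ltnS (leq_trans (ltnW (findex_max _)))// ?max_card// -E fconnect_iter.
by apply/existsP; exists (Ordinal lt); rewrite /= F.
Qed.

Lemma branch_refl v : v \in br v.
Proof. by apply/branchP; exists 0%N. Qed.

Lemma branch_trans u v w : u \in br v -> v \in br w -> u \in br w.
Proof.
move=> /branchP[k <-] /branchP[l <-]; apply/branchP; exists (l + k)%N.
exact: iterD.
Qed.

Lemma branch_par v w : par w \in br v -> w \in br v.
Proof. by move=> /branchP[k E]; apply/branchP; exists k.+1; rewrite iterSr. Qed.

Lemma mem_branch_par w : w \in br (par w).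
Proof. exact/branch_par/branch_refl. Qed.

Lemma branch_cases v w : w \in br v -> w = v \/ par w \in br v.
Proof.
move=> /branchP[[|k] E]; [by left|right]; apply/branchP; exists k.
by rewrite -iterSr.
Qed.

Lemma branch_linear u v w : u \in br v -> u \in br w -> v \in br w \/ w \in br v.
Proof.
move=> /branchP[k <-] /branchP[l <-]; have [kl|lk] := leqP k l.
  by left; apply/branchP; exists (l - k)%N; rewrite -iterD subnK.
by right; apply/branchP; exists (k - l)%N; rewrite -iterD subnK// ltnW.
Qed.

Lemma root_reached v : exists k, isr (iter k par v).
Proof. by case: forest => _ _ _; apply. Qed.

Definition dep v : nat := ex_minn (root_reached v).

Lemma par_root v : isr v -> par v = v.
Proof. by case: forest => _ pr prb _ /orP[/eqP ->|/eqP ->]. Qed.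

Lemma mem_Vs v : (v \in Vs) = ~~ isr v.
Proof. by rewrite inE. Qed.

Lemma dep_par v : v \in Vs -> (dep (par v) < dep v)%N.
Proof.
rewrite mem_Vs /dep => vr; case: ex_minnP => k pk mk; case: ex_minnP => l pl ml.
case: l pl ml => [|l] pl ml; first by rewrite pl in vr.
by rewrite ltnS; apply: mk; rewrite -iterSr.
Qed.

Lemma branch_root v w : isr w -> w \in br v -> w = v.
Proof.
move=> wr /branchP[k <-]; elim: k => //= k <-.
by rewrite par_root.
Qed.

Lemma branch_dep v w : w \in br v -> (dep v <= dep w)%N.
Proof.
move=> /branchP[k <-]; elim: k => //= k IH; apply: leq_trans IH.
have [vs|] := boolP (iter k par w \in Vs); first by rewrite ltnW// dep_par.
by rewrite mem_Vs negbK => /par_root ->.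
Qed.

Lemma branch_proper_dep v w : w \in br v -> w != v -> (dep v < dep w)%N.
Proof.
move=> wv wNv; have wVs : w \in Vs.
  by rewrite mem_Vs; apply: contra wNv => /branch_root/(_ wv) ->.
have [E|pw] := branch_cases wv; first by rewrite E eqxx in wNv.
by apply: leq_ltn_trans (branch_dep pw) _; exact: dep_par.
Qed.

Lemma branch_anti v w : w \in br v -> v \in br w -> v = w.
Proof.
move=> wv vw; apply/eqP; apply: contraT => vNw.
have := branch_proper_dep vw vNw; rewrite ltnNge branch_dep//.
Qed.

Lemma branch_Vs v w : v \in Vs -> w \in br v -> w \in Vs.
Proof.
move=> vs wv; rewrite mem_Vs; apply/negP => wr.
by move: vs; rewrite -(branch_root wr wv) mem_Vs wr.
Qed.

Lemma branch_child v u : u \in br v -> u != v ->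
  exists2 c, c \in children par rho rhob v & u \in br c.
Proof.
move=> /branchP[k]; elim: k u => [u /= -> /eqP//|k IH u]; rewrite iterSr => E uv.
have [Ep|pNv] := eqVneq (par u) v.
  exists u; last exact: branch_refl.
  rewrite inE Ep eqxx andbT; apply: contra uv => ur.
  by rewrite -Ep par_root.
by have [c cv uc] := IH _ E pNv; exists c => //; exact: branch_par.
Qed.

Lemma child_Vs c v : c \in children par rho rhob v -> c \in Vs /\ par c = v.
Proof. by rewrite inE => /andP[cr /eqP]; rewrite mem_Vs. Qed.

Lemma child_branch c v u : c \in children par rho rhob v -> u \in br c ->
  u \in br v /\ u != v.
Proof.
move=> /child_Vs[cs pc] uc; have cv : c \in br v by rewrite -pc mem_branch_par.
split; first exact: branch_trans uc cv.
apply/eqP => E; have := branch_dep uc; rewrite E -pc leqNgt dep_par//.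
Qed.

Lemma child_unique c c' v u : c \in children par rho rhob v ->
  c' \in children par rho rhob v -> u \in br c -> u \in br c' -> c = c'.
Proof.
move=> cv c'v uc uc'.
have aux d d' : d \in children par rho rhob v -> d' \in children par rho rhob v ->
    d \in br d' -> d = d'.
  move=> /child_Vs[ds pd] /child_Vs[d's pd'] dd'.
  have [//|pdd'] := branch_cases dd'.
  by have := branch_dep pdd'; rewrite pd -pd' leqNgt dep_par.
have [cc'|c'c] := branch_linear uc uc'; first exact: aux.
by apply/esym; apply: aux.
Qed.

Lemma sum_branch_children (R : realType) (f : V -> R) v :
  \sum_(u in br v :\ v) f u =
  \sum_(c in children par rho rhob v) \sum_(u in br c) f u.
Proof.
under [RHS]eq_bigr do rewrite big_mkcond /=.
rewrite exchange_big /= [LHS]big_mkcond /=; apply: eq_bigr => u _.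
rewrite in_setD1; case: ifPn => [/andP[uv ubr]|].
  have [c cv uc] := branch_child ubr uv.
  rewrite (bigD1 c)//= uc big1 ?addr0// => c' /andP[c'v c'c].
  by case: ifPn => // uc'; rewrite (child_unique c'v cv uc' uc) eqxx in c'c.
rewrite negb_and negbK => H; rewrite big1// => c cv; case: ifPn => // uc.
by have [ubr uv] := child_branch cv uc; move: H; rewrite ubr (negbTE uv).
Qed.

Lemma branch_roots_disjoint v : v \in br rho -> v \in br rhob -> False.
Proof.
case: forest => rr pr prb _ v1 v2.
have r1 : isr rho by rewrite /is_root eqxx.
have r2 : isr rhob by rewrite /is_root eqxx orbT.
have [H|H] := branch_linear v1 v2.
  by have := branch_root r1 H => E; rewrite E eqxx in rr.
by have := branch_root r2 H => E; rewrite E eqxx in rr.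
Qed.

Lemma leaf_branch u : u \in leaves par rho rhob -> br u = [set u]%SET.
Proof.
rewrite inE cards_eq0 => /eqP ch0; apply/setP => w; rewrite finset.in_set1.
apply/idP/eqP => [wu|->]; last exact: branch_refl.
apply/eqP; apply: contraT => wNu; have [c] := branch_child wu wNu.
by rewrite ch0 inE.
Qed.

End ForestCombinatorics.

Section Pivots.
Context {V : finType}.
Variables (par : V -> V) (rho rhob : V) (C : {set {set V}}) (es : seq {set V}).
Hypothesis forest : is_forest par rho rhob.
Hypothesis contr : is_contr par rho rhob C.
Hypothesis noroot : forall e, e \in C -> (rho \notin e) && (rhob \notin e).
Hypothesis es_mem : es =i C.
Hypothesis es_uniq : uniq es.
Local Notation br := (branch par).
Local Notation Vs := (Vstar rho rhob).
Local Notation depth := (dep forest).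
Implicit Types (e : {set V}) (u v w : V).

Definition crosses e w := e \in Ccross C (br w).

Lemma crossesP e w : e \in C ->
  reflect ((exists2 u, u \in e & u \in br w) /\ (exists2 u, u \in e & u \notin br w)) (crosses e w).
Proof.
move=> eC; rewrite /crosses /Ccross finset.in_setI !inE eC /= !cards_eq0.
apply: (iffP andP) => [[/finset.set0Pn[u /finset.setIP[ue uw]] /finset.set0Pn[v /finset.setIP[ve]]]
    |[[u ue uw] [v ve vw]]].
  by rewrite finset.in_setC => vw; split; [exists u|exists v].
split; apply/finset.set0Pn.
  by exists u; rewrite finset.in_setI ue.
by exists v; rewrite finset.in_setI ve finset.in_setC.
Qed.

Lemma edge_pair e u : e \in C -> u \in e -> exists2 v, v != u & e = [set u; v]%SET.
Proof.
move=> eC ue; have [/eqP/cards2P[x [y [xy E]]] _ _] := contr eC.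
move: ue; rewrite E !inE => /orP[/eqP ->|/eqP ->].
  by exists y; rewrite 1?eq_sym.
by exists x => //; rewrite finset.setUC.
Qed.

Lemma edge_leaf e u : e \in C -> u \in e -> u \in leaves par rho rhob.
Proof. by move=> eC; have [_ /fintype.subsetP H _] := contr eC; exact: H. Qed.

Lemma edge_unique e e' u : e \in C -> e' \in C -> u \in e -> u \in e' -> e = e'.
Proof.
move=> eC e'C ue ue'; apply/eqP; apply: contraT => ee'.
have [_ _ /(_ _ e'C ee')/eqP] := contr eC.
by move/cards0_eq/setP/(_ u); rewrite finset.in_setI ue ue' inE.
Qed.

Lemma edge_Vs e u : e \in C -> u \in e -> u \in Vs.
Proof.
move=> eC ue; rewrite inE /is_root negb_or; have /andP[r1 r2] := noroot eC.
by apply/andP; split; [apply: contraNneq r1 => <-|apply: contraNneq r2 => <-].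
Qed.

Lemma crosses_leaf e u : e \in C -> u \in e -> crosses e u.
Proof.
move=> eC ue; apply/crossesP => //; have [v vu E] := edge_pair eC ue.
split; first by exists u => //; exact: branch_refl.
exists v; first by rewrite E !inE eqxx orbT.
by rewrite (leaf_branch forest (edge_leaf eC ue)) inE.
Qed.

Lemma crosses_leaf_inv e e' u : e \in C -> u \in e -> e' \in C -> crosses e' u -> e' = e.
Proof.
move=> eC ue e'C /(crossesP _ e'C)[[v ve' vu] _].
move: vu; rewrite (leaf_branch forest (edge_leaf eC ue)) inE => /eqP vu.
by apply: (edge_unique (u := u)) => //; rewrite -vu.
Qed.

(* A branch is charged for the first edge of es that leaves it, and piv e u is
   the root of the outermost branch containing u that is charged for e. *)
Definition ew w : option {set V} := ohead [seq e <- es | crosses e w].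

Lemma ewP w e : ew w = Some e -> e \in C /\ crosses e w.
Proof.
rewrite /ew; case E : [seq e <- es | crosses e w] => [//|e' s] /= -[<-].
have : e' \in [seq e <- es | crosses e w] by rewrite E mem_head.
by rewrite mem_filter es_mem => /andP[].
Qed.

Lemma ew_none w : ew w = None -> Ccross C (br w) = finset.set0.
Proof.
rewrite /ew; case E : [seq e <- es | crosses e w] => [|//] _.
apply/setP => e; rewrite finset.in_set0; apply/negP => ec.
have eC : e \in C by move: ec; rewrite /Ccross finset.in_setI inE => /andP[/andP[]].
have : e \in [seq e <- es | crosses e w] by rewrite mem_filter es_mem eC /crosses ec.
by rewrite E.
Qed.

Lemma ew_leaf e u : e \in C -> u \in e -> ew u = Some e.
Proof.
move=> eC ue; case E : (ew u) => [e'|].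
  by have [e'C c'] := ewP E; rewrite (crosses_leaf_inv eC ue e'C c').
have := crosses_leaf eC ue; rewrite /crosses (ew_none E) inE; by [].
Qed.

Definition pivP e u w := [&& w \in Vs, u \in br w & ew w == Some e].

Definition piv e u : V := [arg min_(w < u | pivP e u w) depth w].

Lemma pivP_self e u : e \in C -> u \in e -> pivP e u u.
Proof. by move=> eC ue; rewrite /pivP (edge_Vs eC ue) branch_refl (ew_leaf eC ue) eqxx. Qed.

Lemma piv_spec e u : e \in C -> u \in e ->
  [/\ piv e u \in Vs, u \in br (piv e u), ew (piv e u) = Some e &
      forall w, w \in Vs -> u \in br w -> ew w = Some e -> w \in br (piv e u)].
Proof.
move=> eC ue; rewrite /piv; case: arg_minnP; first exact: pivP_self.
move=> p /and3P[pVs up /eqP ep] pm; split=> // w wVs uw ewe.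
have := pm w; rewrite /pivP wVs uw ewe eqxx => /(_ isT) dpw.
have [pw|//] := branch_linear up uw.
apply/branchP; exists 0%N => /=; apply/eqP; apply: contraT => wp.
by have := branch_proper_dep forest pw; rewrite eq_sym wp => /(_ isT); rewrite ltnNge dpw.
Qed.

(** The branch at the pivot is crossed by e, so it contains only one of the two endpoints, and it
    contains u. *)
Lemma piv_endpoint e u v : e \in C -> u \in e -> v \in e -> v \in br (piv e u) -> v = u.
Proof.
move=> eC ue ve vp; have [_ up ep _] := piv_spec eC ue.
have [_ /(crossesP _ eC)[_ [x xe xp]]] := ewP ep.
have [w wu E] := edge_pair eC ue.
apply/eqP; apply: contraT => vu.
have vw : v = w by move: ve; rewrite {1}E !inE (negbTE vu) /= => /eqP.
have [xE|xE] : x = u \/ x = w.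
  by move: xe; rewrite {1}E !inE => /orP[/eqP|/eqP]; [left|right].
- by rewrite xE up in xp.
- by rewrite xE -vw vp in xp.
Qed.

(** A branch is charged for a single edge, which recovers e from the pivot; the endpoint inside the
    branch then recovers u. *)
Lemma piv_inj e e' u u' : e \in C -> u \in e -> e' \in C -> u' \in e' ->
  piv e u = piv e' u' -> e = e' /\ u = u'.
Proof.
move=> eC ue e'C ue' E.
have [_ up ep _] := piv_spec eC ue; have [_ up' ep' _] := piv_spec e'C ue'.
have ee' : e = e' by move: ep; rewrite E ep' => -[].
split=> //; apply/esym; apply: (piv_endpoint eC ue); first by rewrite ee'.
by rewrite E.
Qed.

(** The coefficient of the increment y_w in x_u - x_v, as x_u is the position of its root plus the
    increments of the non-root vertices on its path. It is nonzero exactly when w is not a root and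
    only one of u, v lies in its branch. *)
Definition esgn (R : realType) (uv : V * V) (w : V) : R :=
  if w \in Vs then (uv.1 \in br w)%:R - (uv.2 \in br w)%:R else 0.

Lemma esgn_sign0 (R : realType) uv w : sign0 (esgn R uv w).
Proof.
rewrite /sign0 /esgn; case: ifP => _; last by rewrite eqxx.
by case: (_ \in _); case: (_ \in _); rewrite ?subrr ?subr0 ?sub0r eqxx ?orbT.
Qed.

Lemma esgn_nocross (R : realType) u v w : [set u; v]%SET \in C ->
  ~~ crosses [set u; v]%SET w -> esgn R (u, v) w = 0.
Proof.
move=> eC nc; rewrite /esgn /=; case: ifP => // _.
suff -> : (u \in br w) = (v \in br w) by rewrite subrr.
have ue : u \in [set u; v]%SET by rewrite !inE eqxx.
have ve : v \in [set u; v]%SET by rewrite !inE eqxx orbT.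
apply/idP/idP => H; apply: contraNT nc => H'; apply/crossesP => //.
  by split; [exists u|exists v].
by split; [exists v|exists u].
Qed.

Lemma esgn_cross (R : realType) u v w : [set u; v]%SET \in C -> w \in Vs ->
  crosses [set u; v]%SET w -> esgn R (u, v) w = 1 \/ esgn R (u, v) w = -1.
Proof.
move=> eC wV /(crossesP _ eC)[[x xe xw] [y ye yw]].
have -> : esgn R (u, v) w = (u \in br w)%:R - (v \in br w)%:R by rewrite /esgn wV.
have in2 (z : V) : z \in [set u; v]%SET -> z = u \/ z = v.
  by rewrite !inE => /orP[/eqP|/eqP]; [left|right].
have [xE|xE] := in2 x xe; have [yE|yE] := in2 y ye; rewrite xE in xw; rewrite yE in yw.
- by rewrite xw in yw.
- by left; rewrite xw (negbTE yw) subr0.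
- by right; rewrite xw (negbTE yw) sub0r.
- by rewrite xw in yw.
Qed.

(** The hypothesis says that e is the first edge of the list crossing the branch at [p e]; an
    earlier edge therefore does not cross it. *)
Lemma pivot_triangular (p : {set V} -> V) (s : seq {set V}) : uniq s ->
  (forall e, e \in s -> ohead [seq e' <- s | crosses e' (p e)] = Some e) ->
  pairwise (fun e e' => ~~ crosses e (p e')) s.
Proof.
elim: s => //= e s IH /andP[es' us] H.
have nc e' : e' \in s -> ~~ crosses e (p e').
  move=> e's; apply/negP => ec; have := H e'; rewrite inE e's orbT ec => /(_ isT) [ee'].
  by rewrite ee' e's in es'.
apply/andP; split; first by apply/allP.
apply: IH => // e' e's; have := H e'; rewrite inE e's orbT (negbTE (nc _ e's)).
exact.
Qed.

End Pivots.

Section Shares.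
Context {R : realType} {V : finType}.
Variables (par : V -> V) (rho rhob : V) (C : {set {set V}}) (es : seq {set V}).
Hypothesis forest : is_forest par rho rhob.
Hypothesis contr : is_contr par rho rhob C.
Hypothesis noroot : forall e, e \in C -> (rho \notin e) && (rhob \notin e).
Hypothesis es_mem : es =i C.
Local Notation br := (branch par).
Local Notation Vs := (Vstar rho rhob).
Local Notation pv := (piv C es forest).
Implicit Types (e : {set V}) (u v w : V).
Variables (a a' : {set V} -> R).
Hypothesis a'0 : forall e, e \in C -> 0 <= a' e.
Hypothesis a'a : forall e, e \in C -> a' e <= a e.

(* A contracting edge charges a'/4 to its pivot on each of its two sides. *)
Definition share w : R := \sum_(e in C) \sum_(u in e | pv e u == w) a' e / 4.

Lemma setmax_ge (S : {set {set V}}) (f : {set V} -> R) e : e \in S -> f e <= setmax S f.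
Proof.
move=> eS; rewrite /setmax; case: pickP => [e0 _|/(_ e)]; last by rewrite eS.
by rewrite (bigD1 e)//= le_max lexx.
Qed.

Lemma setmin_le (S : {set {set V}}) (f : {set V} -> R) e : e \in S -> setmin S f <= f e.
Proof.
move=> eS; rewrite /setmin; case: pickP => [e0 _|/(_ e)]; last by rewrite eS.
by rewrite (bigD1 e)//= ge_min lexx.
Qed.

Lemma setmin0 (f : {set V} -> R) : setmin (finset.set0 : {set {set V}}) f = 0.
Proof. by rewrite /setmin; case: pickP => // e; rewrite inE. Qed.

Lemma setmax_ge0 (S : {set {set V}}) (f : {set V} -> R) :
  (forall e, e \in S -> 0 <= f e) -> 0 <= setmax S f.
Proof.
move=> f0; have [->|[e eS]] := set_0Vmem S.
  by rewrite /setmax; case: pickP => // e; rewrite inE.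
exact: le_trans (f0 e eS) (setmax_ge f eS).
Qed.

(** By injectivity of the pivots the double sum has at most one nonzero term, and its edge leaves
    the branch of w. *)
Lemma share_le w : w \in Vs -> share w <= setmax (Ccross C (br w)) (fun e => a e / 4).
Proof.
move=> wVs.
have [/existsP[e /andP[eC /existsP[u /andP[ue /eqP puw]]]]|N] :=
  boolP [exists e, (e \in C) && [exists u, (u \in e) && (pv e u == w)]].
  have [_ _ ep _] := piv_spec forest contr noroot es_mem eC ue.
  have [_ ec] := ewP es_mem ep.
  rewrite puw in ec.
  apply: (@le_trans _ _ (a' e / 4)); last first.
    apply: le_trans (setmax_ge (fun e => a e / 4) ec).
    by rewrite ler_pM2r ?invr_gt0// a'a.
  rewrite /share (bigD1 e)//= [X in _ + X]big1 ?addr0; last first.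
    move=> e' /andP[e'C e'e]; rewrite big1// => u' /andP[u'e' /eqP pu'].
    have [E _] := piv_inj contr noroot es_mem eC ue e'C u'e' (etrans puw (esym pu')).
    by rewrite E eqxx in e'e.
  rewrite (bigD1 u)/=; last by rewrite ue puw eqxx.
  rewrite big1 ?addr0// => u' /andP[/andP[u'e /eqP pu'] u'u].
  have [_ E] := piv_inj contr noroot es_mem eC ue eC u'e (etrans puw (esym pu')).
  by rewrite E eqxx in u'u.
rewrite /share big1 => [|e eC].
  apply: setmax_ge0 => e; rewrite /Ccross finset.in_setI inE => /andP[/andP[eC _] _].
  by rewrite divr_ge0// (le_trans (a'0 eC))// a'a.
rewrite big1// => u /andP[ue puw]; exfalso.
by move/negP: N; apply; apply/existsP; exists e; rewrite eC; apply/existsP; exists u; rewrite ue.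
Qed.

Lemma sum_share (S : {set V}) :
  \sum_(w in S) share w = \sum_(e in C) \sum_(u in e | pv e u \in S) a' e / 4.
Proof.
rewrite /share exchange_big /=; apply: eq_bigr => e _.
under eq_bigr do rewrite big_mkcondr /=.
rewrite exchange_big /= [RHS]big_mkcondr /=; apply: eq_bigr => u _.
rewrite -big_mkcondr /=; case: ifPn => pS.
  rewrite (bigD1 (pv e u))/= ?pS ?eqxx// big1 ?addr0// => w /andP[/andP[_ /eqP <-]].
  by rewrite eqxx.
by rewrite big1// => w /andP[wS /eqP E]; rewrite E wS in pS.
Qed.

Lemma sum_bcoef (v : V) :
  \sum_(l in branch_leaves par rho rhob v) bcoef C a l =
  \sum_(e in C) \sum_(u in e | u \in br v) a e.
Proof.
have bE l : bcoef C a l = \sum_(e in C | l \in e) a e.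
  rewrite /bcoef; case: pickP => [e /andP[eC le]|N].
    rewrite (bigD1 e)/= ?eC// big1 ?addr0// => e' /andP[/andP[e'C le'] e'e].
    by rewrite (edge_unique contr e'C eC le' le) eqxx in e'e.
  by rewrite big1// => e eC; have := N e; rewrite eC.
under eq_bigr do rewrite bE big_mkcondr /=.
rewrite exchange_big /=; apply: eq_bigr => e eC.
rewrite -big_mkcondr /=; apply: eq_bigl => u.
apply/idP/idP => [/andP[/finset.setIP[ub _] ue]|/andP[ue ub]]; first by rewrite ue ub.
by rewrite finset.in_setI ub ue (edge_leaf contr eC ue).
Qed.

(** A pivot strictly below v belongs to an endpoint below v. The edge for which v itself is charged
    has no such pivot: for its endpoint in the branch the outermost charged branch is at v or above.
    Its a/4 is saved, which is at least the minimum; if no edge leaves the branch, the minimum is 0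
    by convention. *)
Lemma sum_share_branch v : v \in Vs ->
  \sum_(w in br v :\ v) share w <=
  4^-1 * (\sum_(l in branch_leaves par rho rhob v) bcoef C a l)
   - setmin (Ccross C (br v)) (fun e => a e / 4).
Proof.
move=> vVs; rewrite sum_share sum_bcoef mulr_sumr.
have pvb e u : e \in C -> u \in e -> pv e u \in br v :\ v -> u \in br v /\ ew par C es v != Some e.
  move=> eC ue; rewrite in_setD1 => /andP[pNv pbr].
  have [_ up ep pm] := piv_spec forest contr noroot es_mem eC ue.
  have uv := branch_trans up pbr; split=> //; apply/eqP => E.
  have := pm v vVs uv E => vp; move: pNv; rewrite (branch_anti forest pbr vp).
  by rewrite eqxx.
have term e : e \in C -> \sum_(u in e | pv e u \in br v :\ v) a' e / 4 <=
    (if ew par C es v == Some e then 0 else 4^-1 * \sum_(u in e | u \in br v) a e).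
  move=> eC; case: ifPn => ev.
    by rewrite big1// => u /andP[ue /(pvb _ _ eC ue)[_]]; rewrite ev.
  rewrite mulr_sumr big_mkcondr /= [leRHS]big_mkcondr /=; apply: ler_sum => u ue.
  have a0 : 0 <= a e := le_trans (a'0 eC) (a'a eC).
  case: ifPn => [/(pvb _ _ eC ue)[-> _]|_].
    by rewrite mulrC; apply: ler_wpM2l => //; exact: a'a.
  by case: ifP => // _; rewrite mulr_ge0.
apply: le_trans (ler_sum _ term) _.
case E : (ew par C es v) => [e|].
  have [eC ec] := ewP es_mem E; have a0 : 0 <= a e := le_trans (a'0 eC) (a'a eC).
  rewrite (bigD1 e)//= eqxx add0r [in leRHS](bigD1 e)//=.
  have -> : \sum_(i in C | i != e) (if Some e == Some i then 0 else 4^-1 * \sum_(u in i | u \in br v) a i)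
      = \sum_(i in C | i != e) 4^-1 * \sum_(u in i | u \in br v) a i.
    apply: eq_bigr => i /andP[_ ie]; rewrite ifN//.
    by apply: contra ie => /eqP[->].
  have [[x xe xv] _] := elimT (crossesP par v eC) ec.
  have H1 : a e <= \sum_(u in e | u \in br v) a e.
    rewrite (bigD1 x)/= ?xe//; rewrite lerDl; exact: sumr_ge0.
  have := setmin_le (fun e => a e / 4) ec; lra.
by rewrite (ew_none es_mem E) setmin0 subr0.
Qed.

(** At a root nothing is saved: the pivot of each endpoint lies strictly below the root of the same
    tree. *)
Lemma sum_share_root r : is_root rho rhob r ->
  \sum_(w in br r :\ r) share w = \sum_(e in C) \sum_(u in e | u \in br r) a' e / 4.
Proof.
move=> rr; rewrite sum_share; apply: eq_bigr => e eC; apply: eq_bigl => u.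
have [ue /=|//] := boolP (u \in e).
have [pVs up _ _] := piv_spec forest contr noroot es_mem eC ue.
rewrite in_setD1; have -> /= : pv e u != r.
  by apply: contraTneq pVs => ->; rewrite inE rr.
apply/idP/idP => [|ur]; first exact: branch_trans.
have [//|rp] := branch_linear up ur.
by move: pVs; rewrite -(branch_root forest rr rp) inE rr.
Qed.

End Shares.

(** * Estimates for the vertex integrals *)

Section VertexIntegral.
Context {R : realType} {n : nat} {V : finType}.
Implicit Types (c : V * nat -> R) (w v : V) (ws : seq V).
Local Notation mu := (@lebesgue_measure R).
Variable isD : pred V.

(** Translates the nested functions of [cint], which shifts its argument at every step, into a
    family of coordinates of [w] starting at index j. The bound and the sign are proved together,
    because monotonicity of the outer integral uses both. *)
Lemma cint_le w (j m : nat) (f : (nat -> R) -> \bar R) (H : (V * nat -> R) -> \bar R) c :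
  (forall c', agree [seq (w, i) | i <- iota j m] c c' ->
    (forall i, i \in [seq (w, i) | i <- iota j m] -> 0 <= c' i < 1) ->
    (0 <= f (fun i => if (i < m)%N then c' (w, (j + i)%N) else 0%R) <= H c')%E) ->
  (0 <= cint m f <= It [seq (w, i) | i <- iota j m] H c)%E.
Proof.
elim: m j f c => [|m IH] j f c fH /=.
  by apply: fH => // i.
have step y : `[0, 1[%classic y ->
    (0 <= cint m (fun z => f (fun i => if i is k.+1 then z k else y))
     <= It [seq (w, i) | i <- iota j.+1 m] H (upd c (w, j) y))%E.
  rewrite /= in_itv /= => y01; apply: IH => c' ac' c01.
  have jn : (w, j) \notin [seq (w, i) | i <- iota j.+1 m].
    by apply/mapP => -[i]; rewrite mem_iota => /andP[ji _] [ij]; rewrite ij ltnn in ji.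
  have cj : c' (w, j) = y by rewrite ac'// /upd eqxx.
  have := fH c' (agree_upd ac').
  rewrite (_ : (fun i => _) = (fun i : nat => match i with
     | 0%N => y | k.+1 => if (k < m)%N then c' (w, (j.+1 + k)%N) else 0 end)); last first.
    by apply/funext => -[|i]; rewrite ?addn0 ?cj// ltnS addSnnS.
  apply=> i; rewrite inE => /orP[/eqP ->|]; last exact: c01.
  by rewrite cj.
apply/andP; split; first by apply: integral_ge0 => y /step/andP[].
by apply: le_integral_nonmeas => y /step/andP[].
Qed.

Lemma xint_le w (f : 'rV[R]_n -> \bar R) (H : (V * nat -> R) -> \bar R) c :
  (forall c', agree (@sp n V w) c c' -> (forall i, i \in @sp n V w -> 0 <= c' i < 1) ->
    (0 <= f (@vec R n V c' w) <= H c')%E) ->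
  (0 <= xint f <= It (@sp n V w) H c)%E.
Proof.
move=> fH.
have E : @sp n V w = [seq (w, i) | i <- iota 1 n].
  by rewrite /sp -[1%N]addn0 iotaDl -map_comp.
rewrite /xint E; apply: cint_le => c'; rewrite -E => ac c01.
have -> : \row_(i < n) (fun i => if (i < n)%N then c' (w, (1 + i)%N) else 0) i = @vec R n V c' w.
  by apply/rowP => i; rewrite !mxE ltn_ord.
exact: fH.
Qed.

Definition coords ws : seq (V * nat) := flatten [seq tsw isD w ++ @sp n V w | w <- ws].

Definition times_of (t0 : V -> R) ws c v : R :=
  if v \in ws then (if isD v then 0 else c (v, 0%N)) else t0 v.

Definition points_of (x0 : V -> 'rV[R]_n) ws c v : 'rV[R]_n :=
  if v \in ws then @vec R n V c v else x0 v.

(** The open time interval is enlarged to the half-open one used by [It]; this costs nothing since H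
    is nonnegative. *)
Lemma tint_le w (f : R -> \bar R) (H : (V * nat -> R) -> \bar R) c :
  (forall c, 0 <= H c)%E ->
  (forall c', agree (tsw isD w) c c' -> (forall i, i \in tsw isD w -> 0 <= c' i < 1) ->
    (0 <= f (if isD w then 0%R else c' (w, 0%N)) <= H c')%E) ->
  (0 <= tint (isD w) f <= It (tsw isD w) H c)%E.
Proof.
move=> H0; rewrite /tsw /tint; case: ifPn => [_|_] fH /=; first by apply: fH => // i.
have step y : `]0, 1[%classic y -> (0 <= f y <= H (upd c (w, 0%N) y))%E.
  rewrite /= in_itv /= => /andP[y0 y1].
  have := fH (upd c (w, 0%N) y).
  rewrite (_ : upd c (w, 0%N) y (w, 0%N) = y); last by rewrite /upd eqxx.
  apply.
    by move=> i; rewrite inE => iw; rewrite /upd (negbTE iw).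
  by move=> i; rewrite inE => /eqP ->; rewrite /upd eqxx (ltW y0).
apply/andP; split; first by apply: integral_ge0 => y /step/andP[].
rewrite /Op integral_mkcond [leRHS]integral_mkcond; apply: le_integral_nonmeas => y _.
  by rewrite patchE; case: ifP => // /set_mem/step/andP[].
rewrite !patchE; case: ifPn => [/set_mem y01|_]; last by case: ifP => // _; exact: H0.
have /andP[_ fy] := step y y01.
rewrite ifT//; apply/mem_set => /=; move: y01; rewrite /= !in_itv/= => /andP[/ltW -> ->//].
Qed.

Lemma vint_le ws (F : (V -> R) -> (V -> 'rV[R]_n) -> \bar R) t0 x0
    (H : (V * nat -> R) -> \bar R) c : uniq ws ->
  (forall c, 0 <= H c)%E ->
  (forall c', agree (coords ws) c c' -> (forall i, i \in coords ws -> 0 <= c' i < 1) ->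
    (0 <= F (times_of t0 ws c') (points_of x0 ws c') <= H c')%E) ->
  (0 <= vint ws isD F t0 x0 <= It (coords ws) H c)%E.
Proof.
move=> + H0; elim: ws t0 x0 c => [|w ws IH] t0 x0 c /=.
  move=> _ FH; have := FH c; rewrite /times_of /points_of /=.
  by apply.
move=> /andP[wws uws] FH.
rewrite [coords _]/coords /= -/(coords ws) !It_cat.
have ws1 i : i \in coords ws -> i.1 \in ws.
  move=> /flattenP[_ /mapP[v vws ->]]; rewrite mem_cat /tsw => /orP[].
    by case: ifP => // _; rewrite inE => /eqP ->.
  by move=> /mem_sp ->.
apply: tint_le => [c'|c1 ac1 c101]; first by do 2!apply: It_ge0.
apply: xint_le => c2 ac2 c201.
apply: IH => // c3 ac3 c301.
have keep i : i.1 = w -> c3 i = c2 i.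
  by move=> iw; apply: ac3; apply: contra wws => /ws1; rewrite iw.
have c2t : ~~ isD w -> c2 (w, 0%N) = c1 (w, 0%N).
  move=> _; apply: ac2; apply/mapP => -[i _]; case=> //.
have := FH c3.
rewrite (_ : times_of _ _ _ = times_of (upd t0 w (if isD w then 0 else c1 (w, 0%N))) ws c3); last first.
  apply/funext => v; rewrite /times_of /upd inE; case: (eqVneq v w) => [->|_] //=.
  rewrite (negbTE wws) keep//; case: ifPn => // dw; exact: c2t.
rewrite (_ : points_of _ _ _ = points_of (upd x0 w (@vec R n V c2 w)) ws c3); last first.
  apply/funext => v; rewrite /points_of /upd inE; case: (eqVneq v w) => [->|_] //=.
  by rewrite (negbTE wws); apply/rowP => i; rewrite !mxE keep.
apply.
  move=> i; rewrite /coords /= !mem_cat !negb_or => /andP[/andP[it ix] ic].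
  by rewrite ac3// ac2// ac1.
move=> i; rewrite /coords /= !mem_cat => /orP[/orP[it|ix]|ic]; last exact: c301.
  have iw : i.1 = w by move: it; rewrite /tsw; case: ifP => // _; rewrite inE => /eqP ->.
  have iE : i = (w, 0%N) by move: it; rewrite /tsw; case: ifP => // _; rewrite inE => /eqP ->.
  rewrite keep//.
  by rewrite ac2 ?c101// iE; apply/mapP => -[].
rewrite keep ?c201//; exact: mem_sp ix.
Qed.

Lemma perm_coords ws : perm_eq (coords ws) (times isD ws ++ @sps n V ws).
Proof.
elim: ws => //= w ws IH; rewrite /coords /= /times /= /sps /= -/(coords ws) -/(times isD ws) -/(sps ws).
by rewrite -!catA perm_cat2l perm_sym perm_catCA perm_cat2l perm_sym.
Qed.

End VertexIntegral.

Section SpaceBound.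
Context {R : realType} {n : nat} {V : finType}.
Variables (par : V -> V) (rho rhob : V) (C : {set {set V}}) (es : seq {set V}).
Hypothesis forest : is_forest par rho rhob.
Hypothesis contr : is_contr par rho rhob C.
Hypothesis noroot : forall e, e \in C -> (rho \notin e) && (rhob \notin e).
Hypothesis es_mem : es =i C.
Hypothesis es_uniq : uniq es.
Local Notation Vs := (Vstar rho rhob).
Local Notation pv := (piv C es forest).
Implicit Types (e : {set V}) (u v w : V) (c : V * nat -> R).
Variables (eu ev : {set V} -> V).
Hypothesis euv : forall e, e \in C -> e = [set eu e; ev e]%SET.
Variable a : {set V} -> R.
Hypothesis an : forall e, e \in C -> 0 <= a e < n%:R.
Variables (h : V -> R) (zz : {set V} -> 'rV[R]_n).
Hypothesis h01 : forall w, 0 < h w <= 1.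
Hypothesis n0 : (0 < n)%N.
Local Notation sg e := (esgn par rho rhob R (eu e, ev e)).

Lemma eu_in e : e \in C -> eu e \in e.
Proof. by move=> eC; have := finset.set21 (eu e) (ev e); rewrite -euv. Qed.

Lemma ev_in e : e \in C -> ev e \in e.
Proof. by move=> eC; have := finset.set22 (eu e) (ev e); rewrite -euv. Qed.

Lemma euv_neq e : e \in C -> eu e != ev e.
Proof.
move=> eC; have [c2 _ _] := contr eC; apply/eqP => E.
by move: c2; have := cards2 (eu e) (ev e); rewrite -euv// E eqxx => ->.
Qed.

Lemma prod_edge e (f : V -> R) : e \in C -> \prod_(u in e) f u = f (eu e) * f (ev e).
Proof.
move=> eC; rewrite (bigD1 (eu e)) ?eu_in//= (bigD1 (ev e))/=; last first.
  by rewrite ev_in// eq_sym euv_neq.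
rewrite big1 ?mulr1// => u /andP[/andP[ue]].
have : u \in [set eu e; ev e]%SET by rewrite -euv.
by rewrite !inE => /orP[] -> //=; rewrite andbF.
Qed.

(* The pivot with the larger scale is integrated, so that its gain is at most
   the geometric mean of the gains of the two pivots. *)
Definition pivot e : V :=
  if h (pv e (ev e)) <= h (pv e (eu e)) then pv e (eu e) else pv e (ev e).

Lemma pivotP e : e \in C -> pivot e \in Vs /\ ew par C es (pivot e) = Some e.
Proof.
move=> eC; rewrite /pivot; case: ifP => _.
  by have [? _ ? _] := piv_spec forest contr noroot es_mem eC (eu_in eC).
by have [? _ ? _] := piv_spec forest contr noroot es_mem eC (ev_in eC).
Qed.

Lemma pivot_gain e (x : R) : e \in C -> 0 <= x ->
  h (pivot e) `^ (- x) <= \prod_(u in e) h (pv e u) `^ (- (x / 2)).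
Proof.
move=> eC x0; rewrite (prod_edge (fun u => h (pv e u) `^ (- (x / 2))))//.
have hx w : h w `^ (- x) = h w `^ (- (x / 2)) * h w `^ (- (x / 2)).
  have /andP[hw _] := h01 w.
  rewrite -powRD; last by rewrite lt0r_neq0 ?implybT.
  by congr powR; lra.
have x2 : 0 <= x / 2 by lra.
have hp w : 0 < h w by case/andP: (h01 w).
rewrite hx /pivot; case: (lerP (h (pv e (ev e)))) => H.
  by rewrite ler_wpM2l ?powR_ge0// powR_le_neg.
by rewrite ler_wpM2r ?powR_ge0// powR_le_neg// ltW.
Qed.

Lemma sg_pivot e : e \in C -> sg e (pivot e) = 1 \/ sg e (pivot e) = -1.
Proof.
move=> eC; have [pVs /(ewP es_mem)[_ ec]] := pivotP eC.
have E := euv eC.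
move: eC ec; rewrite [X in X \in _]E [X in crosses _ _ X _]E => eC ec; exact: esgn_cross eC pVs ec.
Qed.

Lemma sg_nocross e w : e \in C -> ~~ crosses par C e w -> sg e w = 0.
Proof.
move=> eC nc; have E := euv eC.
by apply: (@esgn_nocross V par rho rhob C R); rewrite -E.
Qed.

Lemma S0_ge1 (d : R) : (1 <= S 0 d)%E.
Proof. by rewrite /S; case: ifP => _; rewrite ?leey// oppr0 powRr0. Qed.

Definition spaceC (th : R) : R := (\prod_(e in C) kerC (n := n) (a e)) * termC (n := n) th ^+ #|V|.

Lemma filter_size_le (T : finType) (A : {set T}) (p : pred T) : (size [seq w <- enum A | p w] <= #|T|)%N.
Proof. by rewrite size_filter (leq_trans (count_size _ _))// -cardE max_card. Qed.

(** If th is positive, e0 heads the list and is treated separately: the other edges are eliminated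
    with its singularity as the spectator [Phi], and then its own pivot is integrated down to the
    exponent th. If th = 0, all edges are eliminated alike. *)
Lemma space_bound (e0 : {set V}) (th : R) (z0 : 'rV[R]_n) c : 0 <= th -> th < n%:R ->
  th = 0 \/ [/\ exists es', es = e0 :: es', th <= a e0 & zz e0 = z0] ->
  (It (@sps n V (enum Vs)) (fun c => @Qprod R n V h (enum Vs) c *
       Sprod a zz (fun e => sg e) es c) c <=
   (spaceC th * \prod_(e in C) \prod_(u in e) h (pv e u) `^ (- ((a e - th *+ (e == e0)) / 2)))%:E *
     S th (dinf z0))%E.
Proof.
move=> th0 thn H.
have hp w : 0 < h w by case/andP: (h01 w).
have K1 := @termC_ge1 R n th.
have uVs : uniq (enum Vs) by exact: enum_uniq.
have tri s : uniq s -> {subset s <= C} ->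
    (forall e, e \in s -> ohead [seq e' <- s | crosses par C e' (pivot e)] = Some e) ->
    pairwise (fun e e' => sg e (pivot e') == 0) s.
  move=> us sC hs; have := pivot_triangular us hs.
  apply: (sub_in_pairwise (P := mem C)); last by apply/allP.
  by move=> e e' /= eC _ ec; rewrite sg_nocross.
have an' e : e \in C -> 0 <= a e by move=> /an/andP[].
have an2 e : e \in C -> a e < n%:R by move=> /an/andP[].
have kC0 : 0 <= \prod_(e in C) kerC (n := n) (a e).
  by apply: prodr_ge0 => e eC; rewrite kerC_ge0 ?an2.
have P0 (s : seq {set V}) : 0 <= \prod_(e <- s) h (pivot e) `^ (- a e).
  by apply: prodr_ge0 => e _; exact: powR_ge0.
have [{}H|[[es' esE] tha zE]] := H.
  rewrite H /= in th0 thn K1 *.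
  under eq_bigr do rewrite mul0rn subr0.
  (* An artificial spectator, at least 1 everywhere, which gives the remaining bumps the form
     expected by [It_terminal]. *)
  pose Phi c := S 0 (dinf (lin z0 (fun=> 0) c)).
  have Phi0 c' : (0 <= Phi c')%E by exact: S_ge0.
  have mPhi : fmeas Phi by exact: fmeas_S_lin.
  apply: (@le_trans _ _ (It (@sps n V (enum Vs)) (fun c => @Qprod R n V h (enum Vs) c *
       (Sprod a zz (fun e => sg e) es c * Phi c)) c)%E).
    apply: le_It => c'; first by rewrite mule_ge0 ?Qprod_ge0 ?Sprod_ge0.
    apply: lee_wpmul2l; first exact: Qprod_ge0.
    by apply: lee_pemulr; [exact: Sprod_ge0|exact: S0_ge1].
  apply: (le_trans (It_eliminate (pv := pivot) h01 zz Phi0 mPhi c uVs _ _)).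
  - move=> e; rewrite es_mem => eC; split.
    + by rewrite mem_enum; case: (pivotP eC).
    + exact: sg_pivot.
    + exact: an.
    + by move=> i c' y _; rewrite /Phi lin_upd.
  - apply: tri => // e; first by rewrite es_mem.
    by rewrite es_mem => eC; case: (pivotP eC) => _ <-.
  set ws := [seq w <- _ | _].
  have uws : uniq ws by rewrite filter_uniq.
  apply: (@le_trans _ _ ((\prod_(e <- es) (kerC (n := n) (a e) * h (pivot e) `^ (- a e)))%:E *
     ((termC (n := n) 0 ^+ size ws)%:E * S 0 (dinf z0)))%E).
    apply: lee_wpmul2l.
      rewrite lee_fin big_seq; apply: prodr_ge0 => e; rewrite es_mem => eC.
      by rewrite mulr_ge0 ?powR_ge0 ?kerC_ge0 ?an2.
    have := It_terminal (sg := fun=> 0) h01 n0 z0 c uws (_ : 0 <= 0 < n%:R) (fun=> _).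
    rewrite lexx thn /= => /(_ isT) T.
    apply: (le_trans (T _)); first by rewrite /sign0 eqxx.
    by rewrite lin0// => w; rewrite /drop_sg; case: ifP.
  rewrite muleA -EFinM; apply: lee_wpmul2r; first exact: S_ge0.
  have split (f : {set V} -> R) : \prod_(e in C) f e = \prod_(e <- es) f e.
    rewrite -big_enum /= (perm_big es) //=.
    by apply: uniq_perm; rewrite ?enum_uniq// => e; rewrite mem_enum es_mem.
  rewrite lee_fin /spaceC !split big_split /= -!mulrA.
  rewrite ler_wpM2l//.
    by rewrite -split.
  rewrite mulrC ler_pM//.
  - by rewrite exprn_ge0// (le_trans ler01).
  - by rewrite ler_weXn2l// filter_size_le.
  - rewrite big_seq [leRHS]big_seq; apply: ler_prod => e; rewrite es_mem => eC.
    by rewrite powR_ge0 pivot_gain ?an'.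
have e0C : e0 \in C by rewrite -es_mem esE mem_head.
have es'C e : e \in es' -> e \in C by move=> ee; rewrite -es_mem esE inE ee orbT.
have [e0es' ues'] : e0 \notin es' /\ uniq es' by apply/andP; rewrite -/(uniq (e0 :: es')) -esE.
(* A branch crossed by e0 is charged for e0, the head of the list; so e0 crosses no branch at the
   pivot of another edge. *)
have nc e : e \in es' -> ~~ crosses par C e0 (pivot e).
  move=> ee; apply/negP => X; have [_] := pivotP (es'C e ee).
  rewrite /ew esE /= X /= => -[E]; by rewrite E ee in e0es'.
pose Phi c := S (a e0) (dinf (lin (zz e0) (sg e0) c)).
have Phi0 c' : (0 <= Phi c')%E by exact: S_ge0.
have mPhi : fmeas Phi by exact: fmeas_S_lin.
rewrite (@eq_It _ _ _ _ (fun c => (@Qprod R n V h (enum Vs) c *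
       (Sprod a zz (fun e => sg e) es' c * Phi c))%E)); last first.
  by move=> c'; rewrite esE /Sprod big_cons; congr (_ * _)%E; rewrite muleC.
apply: (le_trans (It_eliminate (pv := pivot) h01 zz Phi0 mPhi c uVs _ _)).
- move=> e ee; have eC := es'C e ee; split.
  + by rewrite mem_enum; case: (pivotP eC).
  + exact: sg_pivot.
  + exact: an.
  + by move=> i c' y ip; rewrite /Phi lin_upd// ip sg_nocross// nc.
- apply: tri => // e ee; have [_] := pivotP (es'C e ee).
  by rewrite /ew esE /= (negbTE (nc e ee)).
set ws := [seq w <- _ | _].
have uws : uniq ws by rewrite filter_uniq.
have pws : pivot e0 \in ws.
  rewrite mem_filter mem_enum; have [-> E0] := pivotP e0C; rewrite andbT.
  apply/mapP => -[e ee pe]; have [_] := pivotP (es'C e ee).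
  by rewrite -pe E0 => -[E]; rewrite E ee in e0es'.
have a0n := an2 e0 e0C.
have T := It_terminal_pivot h01 n0 (zz e0) c uws pws (sg_pivot e0C)
  (esgn_sign0 par rho rhob R (eu e0, ev e0)) (_ : 0 <= th <= a e0) a0n.
rewrite th0 tha /= in T; have {}T := T isT.
(* No increment is left in the argument of e0: those in [ws] have been integrated, those at the
   other pivots and at the roots have coefficient 0. *)
rewrite [X in S th (dinf X)]lin0 in T; last first.
  move=> w; rewrite /drop_sg /=; case: ifPn => //.
  rewrite mem_filter mem_enum negb_and negbK => /orP[/mapP[e ee ->]|wV].
    by rewrite sg_nocross// nc.
  by rewrite /esgn (negbTE wV).
apply: (@le_trans _ _ ((\prod_(e <- es') (kerC (n := n) (a e) * h (pivot e) `^ (- a e)))%:E *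
  ((kerC (n := n) (a e0) * h (pivot e0) `^ (- (a e0 - th)) * termC (n := n) th ^+ size ws)%:E *
   S th (dinf z0)))%E).
  apply: lee_wpmul2l; last by rewrite -zE.
  rewrite lee_fin big_seq; apply: prodr_ge0 => e /es'C eC.
  by rewrite mulr_ge0 ?powR_ge0 ?kerC_ge0 ?an2.
rewrite muleA -EFinM; apply: lee_wpmul2r; first exact: S_ge0.
rewrite lee_fin.
have split (f : {set V} -> R) : \prod_(e in C) f e = f e0 * \prod_(e <- es') f e.
  rewrite -big_enum /= (perm_big es) /=; first by rewrite esE big_cons.
  by apply: uniq_perm; rewrite ?enum_uniq// => e; rewrite mem_enum es_mem.
rewrite /spaceC !split eqxx mulr1n big_split /=.
have regroup (x y z t u : R) : x * y * (z * t * u) = (z * x) * (t * (y * u)) by ring.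
have regroup' (x y z t u : R) : x * y * z * (t * u) = (x * y) * (t * (u * z)) by ring.
rewrite regroup regroup'.
have T0 k : 0 <= termC (n := n) th ^+ k by rewrite exprn_ge0// (le_trans ler01).
apply: ler_wpM2l.
  rewrite mulr_ge0 ?kerC_ge0 ?an2// big_seq; apply: prodr_ge0 => e /es'C eC.
  by rewrite kerC_ge0 ?an2.
apply: ler_pM; rewrite ?powR_ge0 ?mulr_ge0 ?P0 ?T0//.
  by rewrite pivot_gain// subr_ge0.
apply: ler_pM; rewrite ?P0 ?T0//; last by rewrite ler_weXn2l// filter_size_le.
rewrite big_seq [leRHS]big_seq; apply: ler_prod => e ee; rewrite powR_ge0/=.
have -> : (e == e0) = false by apply: contraNF e0es' => /eqP <-.
by rewrite mulr0n subr0 pivot_gain ?an' ?es'C.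
Qed.

End SpaceBound.

Section MeasurableMajorant.
Context {R : realType} {n : nat} {V : finType}.

Lemma fmeas_powR (I : eqType) (s : R) (f : (I -> R) -> R) : fmeas f -> fmeas (fun c => f c `^ s).
Proof. by move=> mf; apply: (fmeas_comp (f := fun x : R => x `^ s)) => //; exact: measurable_powR. Qed.

Lemma fmeas_ifpos (I : eqType) (f g : (I -> R) -> R) : fmeas f -> fmeas g ->
  fmeas (fun c => if 0 < f c then g c else 0).
Proof.
move=> mf mg d T h mh; have mf' := mf d T h mh; have mg' := mg d T h mh.
apply: measurable_fun_ifT; [|exact: mg'|exact: measurable_cst].
by apply: measurable_fun_ltr => //; exact: measurable_cst.
Qed.

(** The scale is itself a function of the times, so measurability is needed jointly in time and
    space; the square root is rewritten as a power, for which it is known. *)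
Lemma fmeas_maj (e : R) (r : (V * nat -> R) -> R) (y : (V * nat -> R) -> 'rV[R]_n) :
  fmeas r -> (forall i, fmeas (fun c => y c ord0 i)) -> fmeas (fun c => maj e (r c) (y c)).
Proof.
move=> mr my.
rewrite (_ : (fun c => _) = fun c => if 0 < r c then r c `^ e *
   \prod_(i < n) (r c `^ (- 2^-1) *
      (1 + distZ (y c ord0 i) * r c `^ (- 2^-1)) `^ (- n.+1%:R)) else 0); last first.
  apply/funext => c; rewrite /maj; case: ifPn => // r0.
  have -> : r c `^ (- 2^-1) = (Num.sqrt (r c))^-1 by rewrite powRN powR12_sqrt// ltW.
  by [].
have mh : fmeas (fun c => r c `^ (- 2^-1)) by exact: fmeas_powR.
apply: fmeas_ifpos => //; apply: fmeasM_real; first exact: fmeas_powR.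
apply: fmeas_prod_real => i; apply: fmeasM_real => //.
apply: fmeas_powR; apply: fmeasD_real; first exact: fmeas_cst.
apply: fmeasM_real => //.
by apply: (fmeas_comp (f := distZ)) => //; exact: measurable_distZ.
Qed.

Lemma QN h (y : 'rV[R]_n) : Q h (- y) = Q h y.
Proof. by apply: eq_bigr => i _; rewrite /qk mxE distZN. Qed.

Lemma Q_periodic h (y : 'rV[R]_n) (m : 'I_n -> int) :
  Q h (y + \row_i (m i)%:~R) = Q h y.
Proof. by apply: eq_bigr => i _; rewrite /qk !mxE distZ_addz. Qed.

Lemma dinf_periodic (y : 'rV[R]_n) (m : 'I_n -> int) :
  dinf (y + \row_i (m i)%:~R) = dinf y.
Proof. by rewrite /dinf; apply: eq_bigr => i _; rewrite !mxE distZ_addz. Qed.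

Lemma vec_diff_add1 (c : V * nat -> R) (i : V * nat) u v : exists m : 'I_n -> int,
  @vec R n V (upd c i (c i + 1)) u - vec (upd c i (c i + 1)) v
  = (vec c u - vec c v) + \row_k (m k)%:~R.
Proof.
exists (fun k => ((u, k.+1) == i)%:Z - ((v, k.+1) == i)%:Z).
apply/rowP => k; rewrite !mxE /upd rmorphB /=.
by case: eqP => [->|_]; case: eqP => [->|_] /=; rewrite ?mulr1n ?mulr0n; ring.
Qed.

End MeasurableMajorant.

Section ShearedPositions.
Context {R : realType} {n : nat} {V : finType}.
Variables (par : V -> V) (rho rhob : V).
Hypothesis forest : is_forest par rho rhob.
Variable ws : seq V.
Hypothesis ws_topo : topo par ws.
Hypothesis ws_mem : ws =i Vstar rho rhob.
Implicit Types (c : V * nat -> R) (u v w : V).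
Local Notation br := (branch par).
Local Notation Vs := (Vstar rho rhob).
Local Notation vecn := (@vec R n V).
Local Notation sheared := (shear (parc par) (@sps n V ws)).

Definition tree_root u : V := if u \in br rho then rho else rhob.

Lemma mem_sps_vec (s : seq V) w (i : 'I_n) : ((w, i.+1) \in @sps n V s) = (w \in s).
Proof.
apply/idP/idP => [/mem_sps//|ws'].
apply/flattenP; exists (@sp n V w); first exact: map_f.
by apply/mapP; exists (val i) => //; rewrite mem_iota add0n ltn_ord.
Qed.

Lemma vec_shear c w : w \in Vs -> vecn (sheared c) w = vecn c w + vecn (sheared c) (par w).
Proof.
move=> wV; apply/rowP => i; rewrite !mxE shear_in//; first exact: topo_sps.
by rewrite mem_sps_vec ws_mem.
Qed.

Lemma vec_shear_root c w : w \notin Vs -> vecn (sheared c) w = vecn c w.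
Proof. by move=> wV; apply/rowP => i; rewrite !mxE shear_notin// mem_sps_vec ws_mem. Qed.

Lemma tree_root_par u : u \in Vs -> tree_root (par u) = tree_root u.
Proof.
move=> uV; rewrite /tree_root; congr (if _ then _ else _).
apply/idP/idP => [|ur]; first exact: branch_par.
case: (branch_cases ur) => // E.
by move: uV; rewrite E mem_Vs /is_root eqxx.
Qed.

(** Induction on the depth: passing from the parent to u adds exactly the increment of u, since
    every other vertex above u is already above its parent. *)
Lemma vec_shear_sum c u :
  vecn (sheared c) u = vecn c (tree_root u) + \sum_(w in Vs) (u \in br w)%:R *: vecn c w.
Proof.
have [m] := ubnP (dep forest u); elim: m u => // m IH u; rewrite ltnS => du.
have [uV|uV] := boolP (u \in Vs).
  rewrite vec_shear// IH ?tree_root_par//; last first.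
    exact: leq_trans (dep_par forest uV) du.
  rewrite addrCA; congr (_ + _).
  rewrite (bigD1 u)//= [in RHS](bigD1 u)//= branch_refl scale1r.
  have -> : par u \in br u = false.
    apply/negP => /(branch_dep forest); rewrite leqNgt.
    by rewrite (dep_par forest uV).
  rewrite scale0r add0r; congr (_ + _); apply: eq_bigr => w /andP[_ wu].
  congr ((nat_of_bool _)%:R *: _); apply/idP/idP => [|uw]; first exact: branch_par.
  by case: (branch_cases uw) => // E; rewrite E eqxx in wu.
have ru : is_root rho rhob u by rewrite mem_Vs negbK in uV.
rewrite vec_shear_root// big1 ?addr0 => [|w wV]; last first.
  case: (boolP (u \in br w)) => [uw|_]; last by rewrite scale0r.
  by rewrite (branch_Vs forest wV uw) in uV.
congr vec; rewrite /tree_root; case/orP: ru => /eqP ->; first by rewrite branch_refl.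
case: ifPn => // X; exfalso; apply: (branch_roots_disjoint forest X); exact: branch_refl.
Qed.

Lemma vec_shear_diff c u v :
  vecn (sheared c) u - vecn (sheared c) v =
  lin (vecn c (tree_root u) - vecn c (tree_root v)) (esgn par rho rhob R (u, v)) c.
Proof.
rewrite !vec_shear_sum /lin opprD addrACA; congr (_ + _).
rewrite -sumrB [RHS](bigID (mem Vs))/= [X in _ + X]big1 ?addr0; last first.
  by move=> w wV; rewrite /esgn (negbTE wV) scale0r.
by apply: eq_bigr => w wV; rewrite /esgn wV scalerBl.
Qed.

End ShearedPositions.

Section SharePowers.
Context {R : realType} {V : finType}.
Variables (par : V -> V) (rho rhob : V) (C : {set {set V}}) (es : seq {set V}).
Hypothesis forest : is_forest par rho rhob.
Hypothesis contr : is_contr par rho rhob C.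
Hypothesis noroot : forall e, e \in C -> (rho \notin e) && (rhob \notin e).
Hypothesis es_mem : es =i C.
Local Notation Vs := (Vstar rho rhob).
Local Notation pv := (piv C es forest).

Lemma powR_sum (I : finType) (P : pred I) (r : R) (f : I -> R) : 0 < r ->
  r `^ (\sum_(i | P i) f i) = \prod_(i | P i) r `^ (f i).
Proof.
move=> r0; elim/big_rec2: _ => [|i x y _ IH]; first by rewrite powRr0.
by rewrite powRD ?IH// lt0r_neq0 ?implybT.
Qed.

(** Regroups the gains by edges and endpoints instead of by vertices; each endpoint contributes at
    its pivot only. *)
Lemma prod_share (a' : {set V} -> R) (r : V -> R) : (forall w, w \in Vs -> 0 < r w) ->
  \prod_(w in Vs) r w `^ (- share C es forest a' w) =
  \prod_(e in C) \prod_(u in e) r (pv e u) `^ (- (a' e / 4)).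
Proof.
move=> r0; rewrite (eq_bigr (fun w => \prod_(e in C) \prod_(u in e)
    if pv e u == w then r w `^ (- (a' e / 4)) else 1)); last first.
  move=> w wV; rewrite /share -sumrN powR_sum ?r0//; apply: eq_bigr => e _.
  by rewrite -sumrN powR_sum ?r0// big_mkcondr.
rewrite exchange_big /=; apply: eq_bigr => e eC.
rewrite exchange_big /=; apply: eq_bigr => u ue.
have [pV _ _ _] := piv_spec forest contr noroot es_mem eC ue.
rewrite (bigD1 (pv e u))//= eqxx big1 ?mulr1// => w /andP[_ wp].
by rewrite eq_sym (negbTE wp).
Qed.

End SharePowers.

Section Majorant.
Context {R : realType} {n : nat} {V : finType}.
Variables (par : V -> V) (rho rhob : V) (C : {set {set V}}) (es : seq {set V}).
Hypothesis forest : is_forest par rho rhob.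
Hypothesis contr : is_contr par rho rhob C.
Hypothesis noroot : forall e, e \in C -> (rho \notin e) && (rhob \notin e).
Hypothesis es_mem : es =i C.
Hypothesis es_uniq : uniq es.
Local Notation Vs := (Vstar rho rhob).
Local Notation pv := (piv C es forest).
Local Notation vecn := (@vec R n V).
Local Notation root_of := (tree_root par rho rhob).
Implicit Types (e : {set V}) (u v w : V) (c : V * nat -> R).
Variables (eu ev : {set V} -> V).
Hypothesis euv : forall e, e \in C -> e = [set eu e; ev e]%SET.
Variable a : {set V} -> R.
Hypothesis an : forall e, e \in C -> 0 <= a e < n%:R.
Hypothesis n0 : (0 < n)%N.
Variables (isD : pred V) (tau g b : V -> R) (e0 : {set V}) (th : R).

(* The singularity of e0 is only integrated down from a e0 to th. *)
Definition lowered e : R := a e - th *+ (e == e0).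
Local Notation shr := (share C es forest lowered).

Definition elapsed c w : R :=
  ptime par (is_root rho rhob) tau c w - (if isD w then 0 else c (w, 0%N)).

Definition weight c w : R :=
  if isD w then 1 else if 0 < c (w, 0%N) then c (w, 0%N) `^ b w else 0.

Definition majorant c : \bar R :=
  ((\prod_(w <- enum Vs) (weight c w * maj (g w) (elapsed c w) (vecn c (par w) - vecn c w)))%:E *
   \prod_(e <- es) S (a e) (dinf (vecn c (eu e) - vecn c (ev e))))%E.

Lemma weight_ge0 c w : 0 <= weight c w.
Proof. by rewrite /weight; case: ifP => // _; case: ifP => // _; exact: powR_ge0. Qed.

Lemma majorant_ge0 c : (0 <= majorant c)%E.
Proof.
rewrite /majorant mule_ge0//; last by apply: prode_ge0 => e _; exact: S_ge0.
by rewrite lee_fin; apply: prodr_ge0 => w _; rewrite mulr_ge0 ?weight_ge0 ?maj_ge0.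
Qed.

Lemma fmeas_vec_diff u v i : fmeas (fun c => (vecn c u - vecn c v) ord0 i).
Proof.
rewrite (_ : (fun c => _) = fun c => vecn c u ord0 i - vecn c v ord0 i).
  by apply: fmeasB_real; exact: fmeas_vec.
by apply/funext => c; rewrite !mxE.
Qed.

Lemma fmeas_S_diff x u v : fmeas (fun c => S x (dinf (vecn c u - vecn c v))).
Proof.
apply: (fmeas_comp (f := S x)) => //; first exact: measurable_S.
apply: fmeas_dinf; exact: fmeas_vec_diff.
Qed.

Lemma fmeas_elapsed w : fmeas (fun c => elapsed c w).
Proof.
apply: fmeasB_real; first exact: fmeas_ptime.
by case: (isD w); [exact: fmeas_cst|exact: fmeas_coord].
Qed.

Lemma fmeas_majorant : fmeas majorant.
Proof.
apply: fmeasM; last by apply: fmeas_prod => e; exact: fmeas_S_diff.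
apply: fmeas_EFin; apply: fmeas_prod_real => w; apply: fmeasM_real; last first.
  by apply: fmeas_maj; [exact: fmeas_elapsed|exact: fmeas_vec_diff].
rewrite /weight; case: (isD w); first exact: fmeas_cst.
by apply: fmeas_ifpos; [exact: fmeas_coord|apply: fmeas_powR; exact: fmeas_coord].
Qed.

(** The default 1 makes the scale admissible for every configuration; where the elapsed time is not
    positive the factor [gains] vanishes. *)
Definition scale c w : R :=
  if 0 < elapsed c w <= 1 then Num.sqrt (elapsed c w) else 1.

Lemma scale01 c w : 0 < scale c w <= 1.
Proof. by rewrite /scale; case: ifP => [/sqrt01//|_]; rewrite ltr01 lexx. Qed.

Definition gains (f : V -> R) c w : R :=
  weight c w * (if 0 < elapsed c w then elapsed c w `^ f w else 0).

Lemma gains_ge0 (f : V -> R) c w : 0 <= gains f c w.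
Proof. by rewrite mulr_ge0 ?weight_ge0//; case: ifP => // _; exact: powR_ge0. Qed.

(** The scales are read from [c] and the points from [c']: for frozen times the space integrals act
    on the second argument only. *)
Definition positions c c' : \bar R :=
  ((\prod_(w <- enum Vs) Q (scale c w) (vecn c' (par w) - vecn c' w))%:E *
   \prod_(e <- es) S (a e) (dinf (vecn c' (eu e) - vecn c' (ev e))))%E.

Lemma positions_ge0 c c' : (0 <= positions c c')%E.
Proof.
rewrite /positions mule_ge0//; last by apply: prode_ge0 => e _; exact: S_ge0.
by rewrite lee_fin; apply: prodr_ge0 => w _; rewrite Q_ge0//; case/andP: (scale01 c w).
Qed.

Lemma fmeas_positions c : fmeas (positions c).
Proof.
apply: fmeasM; last by apply: fmeas_prod => e; exact: fmeas_S_diff.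
apply: fmeas_EFin; apply: fmeas_prod_real => w; apply: fmeas_prod_real => i.
apply: (fmeas_comp (f := qk n.+1 (scale c w))) => //; last exact: fmeas_vec_diff.
exact: measurable_qk.
Qed.

Lemma positions_periodic c c' (i : V * nat) :
  positions c (upd c' i (c' i + 1)) = positions c c'.
Proof.
have QE (w : V) : Q (scale c w) (vecn (upd c' i (c' i + 1)) (par w) - vecn (upd c' i (c' i + 1)) w)
    = Q (scale c w) (vecn c' (par w) - vecn c' w).
  by have [m ->] := @vec_diff_add1 R n V c' i (par w) w; rewrite Q_periodic.
have SE (e : {set V}) : S (a e) (dinf (vecn (upd c' i (c' i + 1)) (eu e) - vecn (upd c' i (c' i + 1)) (ev e)))
    = S (a e) (dinf (vecn c' (eu e) - vecn c' (ev e))).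
  by have [m ->] := @vec_diff_add1 R n V c' i (eu e) (ev e); rewrite dinf_periodic.
rewrite /positions; set c2 := upd c' i _ in QE SE *.
have E1 : \prod_(w <- enum Vs) Q (scale c w) (vecn c2 (par w) - vecn c2 w) =
    \prod_(w <- enum Vs) Q (scale c w) (vecn c' (par w) - vecn c' w).
  by apply: eq_bigr => w _; exact: QE.
have E2 : (\prod_(e <- es) S (a e) (dinf (vecn c2 (eu e) - vecn c2 (ev e))) =
    \prod_(e <- es) S (a e) (dinf (vecn c' (eu e) - vecn c' (ev e))))%E.
  by apply: eq_bigr => e _; exact: SE.
exact: (f_equal2 (fun x y => (x%:E * y)%E) E1 E2).
Qed.

Lemma majorant_split c c' : (forall w, c' (w, 0%N) = c (w, 0%N)) ->
  (forall w, w \in Vs -> elapsed c w <= 1) ->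
  majorant c' = ((\prod_(w <- enum Vs) gains g c w)%:E * positions c c')%E.
Proof.
move=> cc c1; rewrite /majorant /positions muleA -EFinM -big_split /=.
congr (_%:E * _)%E; rewrite big_seq [RHS]big_seq; apply: eq_bigr => w; rewrite mem_enum => wV.
have E : elapsed c' w = elapsed c w by rewrite /elapsed /ptime !cc.
have W : weight c' w = weight c w by rewrite /weight !cc.
rewrite E W /gains -mulrA; congr (_ * _).
by rewrite /maj /scale c1//; case: ifP => //= _; rewrite ?andbT ?mul0r.
Qed.

Definition root_gap : {set V} -> (V * nat -> R) -> 'rV[R]_n :=
  fun e c => vecn c (root_of (eu e)) - vecn c (root_of (ev e)).

Variable ws : seq V.
Hypothesis ws_topo : topo par ws.
Hypothesis ws_perm : perm_eq ws (enum Vs).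

Lemma ws_mem : ws =i Vs.
Proof. by move=> w; rewrite (perm_mem ws_perm) mem_enum. Qed.

Lemma root_of_notin u : root_of u \notin Vs.
Proof. by rewrite mem_Vs negbK /tree_root /is_root; case: ifP; rewrite eqxx ?orbT. Qed.

(** The integrals are put into a topological order for the change of variables and then back. The
    integrand is periodic in every coordinate because the points enter only through differences, and
    the roots are not among the integrated vertices. *)
Lemma It_positions c : 0 <= th -> th < n%:R ->
  (th = 0 \/ (exists es', es = e0 :: es') /\ th <= a e0) ->
  (It (@sps n V (enum Vs)) (positions c) c <=
    (spaceC (n := n) C a th * \prod_(e in C) \prod_(u in e) scale c (pv e u) `^ (- (lowered e / 2)))%:E *
    S th (dinf (root_gap e0 c)))%E.
Proof.
move=> th0 thn H.
have pws : perm_eq (@sps n V (enum Vs)) (@sps n V ws) by apply: perm_sps; rewrite perm_sym.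
rewrite (It_perm (@positions_ge0 c) (fmeas_positions c) pws).
rewrite (It_shear (tau := parc par) c (@positions_ge0 c) (fmeas_positions c) (@topo_sps n V par ws ws_topo)); last first.
  by move=> c' i _; exact: positions_periodic.
rewrite -(It_perm _ _ pws); first last.
- by apply: fmeas_shear; exact: fmeas_positions.
- by move=> c'; exact: positions_ge0.
rewrite (eq_It_on (G := fun c' => (@Qprod R n V (scale c) (enum Vs) c' *
   Sprod a (fun e => root_gap e c) (fun e => esgn par rho rhob R (eu e, ev e)) es c')%E)).
  have H' : th = 0 \/ [/\ exists es', es = e0 :: es', th <= a e0 & root_gap e0 c = root_gap e0 c].
    by case: H => [|[? ?]]; [left|right].
  exact: (space_bound forest contr noroot es_mem es_uniq euv an (zz := fun e => root_gap e c) (scale01 c) n0 c th0 thn H').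
move=> c' ac; rewrite /positions; congr (_ * _)%E.
  rewrite prod_EFin /Qprod big_seq [RHS]big_seq; apply: eq_bigr => w; rewrite mem_enum => wV.
  by rewrite (vec_shear ws_topo ws_mem _ wV) opprD addrCA subrr addr0 QN.
have RR u : vecn c' (root_of u) = vecn c (root_of u).
  rewrite (vec_agree ac)// => i /mem_sps; rewrite mem_enum.
  by apply: contraTneq => ->; exact: root_of_notin.
rewrite /Sprod; apply: eq_bigr => e _.
by rewrite (vec_shear_diff forest ws_topo ws_mem) !RR.
Qed.

(** The scale is the square root of the elapsed time, so a gain with exponent a'/2 in the scale has
    exponent a'/4 in time, which is what [share] records. *)
Lemma It_majorant_space c : 0 <= th -> th < n%:R ->
  (th = 0 \/ (exists es', es = e0 :: es') /\ th <= a e0) ->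
  (forall w, w \in Vs -> elapsed c w <= 1) ->
  (It (@sps n V (enum Vs)) majorant c <=
    (spaceC (n := n) C a th * \prod_(w <- enum Vs) gains (fun w => g w - shr w) c w)%:E *
    S th (dinf (root_gap e0 c)))%E.
Proof.
move=> th0 thn H c1.
have G0 : 0 <= \prod_(w <- enum Vs) gains g c w.
  by apply: prodr_ge0 => w _; exact: gains_ge0.
rewrite (eq_It_on (G := fun c' => ((\prod_(w <- enum Vs) gains g c w)%:E * positions c c')%E)); last first.
  move=> c' ac; apply: majorant_split => // w; apply: ac; apply/negP.
  by move=> /flattenP[_ /mapP[v _ ->]] /mapP[].
rewrite (It_mull (K := fun=> (\prod_(w <- enum Vs) gains g c w)%:E) c (@positions_ge0 c) (fmeas_positions c))//.
apply: (le_trans (lee_wpmul2l _ (It_positions c th0 thn H))); first by rewrite lee_fin.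
rewrite muleA -EFinM; apply: lee_wpmul2r; first exact: S_ge0.
rewrite lee_fin mulrCA; apply: ler_wpM2l.
  rewrite mulr_ge0 ?prodr_ge0//; first by move=> e /an/andP[_ ?]; exact: kerC_ge0.
  by rewrite exprn_ge0// (le_trans ler01)// termC_ge1.
(* If some elapsed time is not positive, its factor in [gains] is 0 and the left side vanishes. *)
have [/allP pos|/allPn[w wV Npos]] := boolP (all (fun w => 0 < elapsed c w) (enum Vs)); last first.
  rewrite (bigD1_seq w) ?enum_uniq//= {1}/gains (negbTE Npos) mulr0 !mul0r.
  by apply: prodr_ge0 => v _; exact: gains_ge0.
have pos' w : w \in Vs -> 0 < elapsed c w by rewrite -mem_enum => /pos.
rewrite (eq_bigr (fun e => \prod_(u in e) elapsed c (pv e u) `^ (- (lowered e / 4)))); last first.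
  move=> e eC; apply: eq_bigr => u ue.
  have [pV _ _ _] := piv_spec forest contr noroot es_mem eC ue.
  rewrite /scale pos'// c1//= -powR12_sqrt ?ltW ?pos'// -powRrM; congr powR; lra.
rewrite -(prod_share forest contr noroot es_mem)// -big_enum/= -big_split/=.
rewrite big_seq [leRHS]big_seq; apply: ler_prod => w; rewrite mem_enum => wV.
have pw := pos' w wV.
rewrite /gains pw mulr_ge0 ?powR_ge0 ?mulr_ge0 ?weight_ge0 ?powR_ge0//=.
by rewrite -mulrA -powRD// lt0r_neq0 ?implybT.
Qed.

End Majorant.

(** * Space and time integrals combined *)

Section MajorantIntegral.
Context {R : realType} {n : nat} {V : finType}.
Variables (par : V -> V) (rho rhob : V) (C : {set {set V}}) (es : seq {set V}).
Hypothesis forest : is_forest par rho rhob.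
Hypothesis contr : is_contr par rho rhob C.
Hypothesis noroot : forall e, e \in C -> (rho \notin e) && (rhob \notin e).
Hypothesis es_mem : es =i C.
Hypothesis es_uniq : uniq es.
Local Notation Vs := (Vstar rho rhob).
Local Notation vecn := (@vec R n V).
Local Notation isr := (is_root rho rhob).
Implicit Types (e : {set V}) (u v w : V) (c : V * nat -> R).
Variables (eu ev : {set V} -> V).
Hypothesis euv : forall e, e \in C -> e = [set eu e; ev e]%SET.
Variable a : {set V} -> R.
Hypothesis an : forall e, e \in C -> 0 <= a e < n%:R.
Hypothesis n0 : (0 < n)%N.
Variables (isD : pred V) (tau g b : V -> R) (e0 : {set V}) (th : R).
Hypothesis isD_leaf : forall w, w \in Vs -> ~~ isD (par w).
Hypothesis th0 : 0 <= th.
Hypothesis thn : th < n%:R.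
Hypothesis e0P : th = 0 \/ (exists es', es = e0 :: es') /\ th <= a e0.

Definition kexp w : R := g w - share C es forest (lowered a e0 th) w.

(** Closed form of the recursion in [It_time]: the exponent of the time of w once all its proper
    descendants are integrated. Each descendant brings its own weight, the exponent of its edge and
    1 from the integration. *)
Definition vexp w : R :=
  \sum_(u in branch par w) b u + \sum_(u in branch par w :\ w) (kexp u + 1).

Lemma sum_children_vexp v :
  \sum_(w in children par rho rhob v) (vexp w + kexp w + 1) =
  \sum_(u in branch par v :\ v) (b u + (kexp u + 1)).
Proof.
rewrite (sum_branch_children forest); apply: eq_bigr => w _.
rewrite big_split /= -addrA /vexp -addrA; congr (_ + _).
rewrite [RHS](bigD1 w) ?branch_refl//= [LHS]addrC; congr (_ + _).
by apply: eq_bigl => u; rewrite in_setD1 andbC.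
Qed.

Lemma vexp_rec w : vexp w = b w + \sum_(v in children par rho rhob w) (vexp v + kexp v + 1).
Proof.
rewrite sum_children_vexp big_split /= addrA /vexp; congr (_ + _).
by rewrite (bigD1 w) ?branch_refl//=; congr (_ + _); apply: eq_bigl => u; rewrite in_setD1 andbC.
Qed.

Hypothesis expP : forall w, w \in Vs ->
  if isD w then vexp w = -1 else -1 < vexp w /\ -1 < kexp w.
Hypothesis tau1 : forall w, w \in Vs -> tau w <= 1.

Lemma gains_tf c w : gains par rho rhob isD tau b kexp c w = tf par isr isD kexp tau b c w.
Proof.
rewrite /gains /elapsed /weight /tf; case: ifP => _; first by rewrite mul1r subr0.
by rewrite /tk subr_gt0; case: ifP => _; case: ifP => //= _; rewrite ?mul0r ?mulr0.
Qed.

Lemma topological_order : exists2 ws, topo par ws & perm_eq ws (enum Vs).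
Proof.
pose leD u v := (dep forest u <= dep forest v)%N.
exists (sort leD (enum Vs)); last by rewrite perm_sort.
apply: (@sorted_topo _ par (dep forest)).
- by rewrite sort_uniq enum_uniq.
- by apply: sort_sorted => u v; exact: leq_total.
- by move=> w; rewrite mem_sort mem_enum => wV; exact: dep_par.
Qed.

Lemma It_majorant c :
  (It (@coords n V isD (enum Vs)) (majorant (n := n) par rho rhob es eu ev a isD tau g b) c <=
    (spaceC (n := n) C a th * ((\prod_(w in Vs) tC isD kexp vexp w) *
       \prod_(w in Vs | isr (par w)) tau w `^ (vexp w + kexp w + 1)))%:E *
    S th (dinf (root_gap (n := n) par rho rhob eu ev e0 c)))%E.
Proof.
have [ws ws_topo ws_perm] := topological_order.
have wsV w : (w \in ws) = (w \in Vs) by rewrite (perm_mem ws_perm) mem_enum.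
have M0 := majorant_ge0 (n := n) par rho rhob es eu ev a isD tau g b.
have mM := fmeas_majorant (n := n) par rho rhob es eu ev a isD tau g b.
rewrite (It_perm M0 mM (perm_coords isD (enum Vs))) It_cat.
set M := majorant (n := n) _ _ _ _ _ _ _ _ _ _ _ in M0 mM *.
pose Sc := S th (dinf (root_gap (n := n) par rho rhob eu ev e0 c)).
have Sc0 : (0 <= Sc)%E by exact: S_ge0.
have sC0 : 0 <= spaceC (n := n) C a th.
  rewrite mulr_ge0 ?prodr_ge0//; first by move=> e /an/andP[_ ?]; exact: kerC_ge0.
  by rewrite exprn_ge0// (le_trans ler01)// termC_ge1.
have tm w : w \in Vs -> ~~ isD w -> (w, 0%N) \in times isD (enum Vs).
  move=> wV Dw; apply/flattenP; exists (tsw isD w); first by apply: map_f; rewrite mem_enum.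
  by rewrite /tsw (negbTE Dw) mem_head.
have tm0 i : i \in times isD (enum Vs) -> i.2 = 0%N.
  by move=> /flattenP[_ /mapP[w _ ->]]; rewrite /tsw; case: ifP => // _; rewrite inE => /eqP ->.
apply: (@le_trans _ _ (It (times isD (enum Vs)) (fun c' => (Sc * (spaceC (n := n) C a th)%:E) *
   \prod_(w <- ws) (tf par isr isD kexp tau b c' w)%:E) c)%E).
  apply: (le_It_on _).2 => c' ac c01; split; first exact: It_ge0.
  have X := (It_majorant_space (isD := isD) (tau := tau) forest contr noroot es_mem es_uniq euv an n0 g b ws_topo ws_perm (c := c') th0 thn e0P).
  apply: (le_trans (X _)).
    move=> w wV; rewrite /elapsed /ptime.
    have t0 : 0 <= (if isD w then 0 else c' (w, 0%N)).
      by case: ifPn => // Dw; have /andP[] := c01 _ (tm w wV Dw).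
    have p1 : (if isr (par w) then tau w else c' (par w, 0%N)) <= 1.
      case: ifPn => [_|pr]; first exact: tau1.
      have pV : par w \in Vs by rewrite mem_Vs.
      by have /andP[_ /ltW] := c01 _ (tm _ pV (isD_leaf wV)).
    by rewrite lerBlDr (le_trans p1)// lerDl.
  have vE u : vecn c' u = vecn c u by apply/rowP => i; rewrite !mxE ac//; apply/negP => /tm0.
  rewrite /root_gap !vE -/(root_gap par rho rhob eu ev e0 c) muleC -/Sc EFinM muleA.
  rewrite (perm_big _ ws_perm) /= prod_EFin.
  rewrite le_eqVlt; apply/orP; left; apply/eqP; congr (_ * _)%E.
  by apply: eq_bigr => w _; congr (_%:E); exact: gains_tf.
pose TT (c : V * nat -> R) := (\prod_(w <- ws) (tf par isr isD kexp tau b c w)%:E)%E.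
have T0 c' : (0 <= TT c')%E.
  by apply: prode_ge0 => w _; rewrite lee_fin; exact: tf_ge0.
have mT : fmeas TT by apply: fmeas_prod => w; apply: fmeas_EFin; exact: fmeas_tf.
have pt : perm_eq (times isD (enum Vs)) (times isD ws).
  by apply: perm_flatten; apply: perm_map; rewrite perm_sym.
rewrite (It_mull (K := fun=> (Sc * (spaceC (n := n) C a th)%:E)%E) (F := TT) c T0 mT)//; last first.
  by move=> _; rewrite mule_ge0.
rewrite (It_perm T0 mT pt).
have T := It_time (b := b) (lam := vexp) (eta := kexp) (rt := isr) (isD := isD) (tau := tau) c ws_topo.
apply: (le_trans (lee_wpmul2l _ (T _ _ _ _ _ _))).
- by rewrite mule_ge0.
- by move=> w; rewrite wsV mem_Vs.
- by move=> w _; rewrite wsV mem_Vs; case: (isr (par w)).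
- by move=> w; rewrite wsV; exact: isD_leaf.
- move=> w _; rewrite vexp_rec; congr (_ + _).
  rewrite (perm_big _ ws_perm)/= big_enum_cond /=; apply: eq_bigl => v.
  by rewrite inE mem_Vs.
- by move=> w; rewrite wsV; exact: expP.
- by move=> w; rewrite wsV; exact: tau1.
have E1 : \prod_(w <- ws) tC isD kexp vexp w = \prod_(w in Vs) tC isD kexp vexp w.
  by rewrite (perm_big _ ws_perm) /= big_enum.
have E2 : \prod_(w <- ws | isr (par w)) tau w `^ (vexp w + kexp w + 1) =
    \prod_(w in Vs | isr (par w)) tau w `^ (vexp w + kexp w + 1).
  by rewrite (perm_big _ ws_perm) /= big_enum_cond.
by rewrite E1 E2 -/Sc [in leRHS]EFinM [leRHS]muleC muleA.
Qed.

End MajorantIntegral.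

Section IteratedSum.
Context {R : realType} {I : eqType}.
Implicit Types (c : I -> R) (F G : (I -> R) -> \bar R).

Lemma It_add s F G : (forall c, 0 <= F c)%E -> (forall c, 0 <= G c)%E -> fmeas F -> fmeas G ->
  forall c, (It s (fun c => F c + G c) c = It s F c + It s G c)%E.
Proof.
move=> F0 G0 mF mG; elim: s => //= i s /funext IH c.
rewrite (_ : It s (fun c0 => F c0 + G c0)%E = (fun c => It s F c + It s G c)%E) //.
rewrite /Op ge0_integralD//.
- by move=> y _; exact: It_ge0.
- by apply: fmeas_updyD; exact: fmeas_It.
- by move=> y _; exact: It_ge0.
- by apply: fmeas_updyD; exact: fmeas_It.
Qed.

Lemma It_sum (J : Type) (l : seq J) s (F : J -> (I -> R) -> \bar R) :
  (forall j c, 0 <= F j c)%E -> (forall j, fmeas (F j)) ->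
  forall c, (It s (fun c => \sum_(j <- l) F j c) c = \sum_(j <- l) It s (F j) c)%E.
Proof.
move=> F0 mF; elim: l => [|j l IH] c.
  rewrite big_nil; elim: s c => [|i s IH] c /=; first by rewrite big_nil.
  rewrite /Op (eq_integral (cst 0%E)) ?integral0// => y _; exact: IH.
rewrite big_cons -IH -It_add//; last 2 first.
- by move=> c'; apply: sume_ge0.
- move=> d T g mg; apply: emeasurable_sum => j'; exact: mF.
by apply: eq_It => c'; rewrite big_cons.
Qed.

End IteratedSum.

Section VertexIntegralBound.
Context {R : realType} {n : nat} {V : finType}.
Variables (par : V -> V) (rho rhob : V) (C : {set {set V}}) (es : seq {set V}).
Hypothesis forest : is_forest par rho rhob.
Hypothesis contr : is_contr par rho rhob C.
Hypothesis noroot : forall e, e \in C -> (rho \notin e) && (rhob \notin e).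
Hypothesis es_mem : es =i C.
Hypothesis es_uniq : uniq es.
Local Notation Vs := (Vstar rho rhob).
Local Notation vecn := (@vec R n V).
Local Notation isr := (is_root rho rhob).
Implicit Types (e : {set V}) (u v w : V) (c : V * nat -> R).
Definition eu e : V := nth rho (enum e) 0.
Definition ev e : V := nth rhob (enum e) 1.

Lemma enum_edge e : e \in C -> enum e = [:: eu e; ev e].
Proof.
move=> /contr[ce _ _]; rewrite /eu /ev; move: ce; rewrite cardE.
by case: (enum e) => [|x [|y []]].
Qed.

Lemma edge_eu_ev e : e \in C -> e = [set eu e; ev e]%SET.
Proof.
move=> eC; apply/setP => u.
by rewrite -[u \in e]mem_enum enum_edge// !inE.
Qed.

Variables (a : {set V} -> R) (beta : V -> R).
Hypothesis an : forall e, e \in C -> 0 <= a e < n%:R.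
Hypothesis n0 : (0 < n)%N.
Variables (g : V -> R) (e0 : {set V}) (th : R).
Hypothesis th0 : 0 <= th.
Hypothesis thn : th < n%:R.
Hypothesis e0P : th = 0 \/ (exists es', es = e0 :: es') /\ th <= a e0.
Local Notation isD := (isDirac par rho rhob beta).
Local Notation kex := (kexp C es forest a g e0 th).
Local Notation vex := (vexp C es forest a g beta e0 th).
Hypothesis expP : forall w, w \in Vs ->
  if isD w then vex w = -1 else -1 < vex w /\ -1 < kex w.
Local Notation maj_of tau := (majorant (n := n) par rho rhob es eu ev a isD tau g beta).

Lemma parent_not_Dirac w : w \in Vs -> ~~ isD (par w).
Proof.
move=> wV; rewrite /isDirac negb_and; apply/orP; left; rewrite /Lstar finset.in_setD negb_and; apply/orP; right.
rewrite /leaves inE -lt0n; apply/card_gt0P; exists w.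
by rewrite inE eqxx andbT -mem_Vs.
Qed.

Variables (t0 : V -> R) (x0 : V -> 'rV[R]_n).
Local Notation tt c := (times_of isD t0 (enum Vs) c).
Local Notation xx c := (points_of x0 (enum Vs) c).

Definition based c := (forall r, isr r -> vecn c r = x0 r) /\
  (forall i, i \in @coords n V isD (enum Vs) -> 0 <= c i < 1).

Lemma points_vec c v : based c -> xx c v = vecn c v.
Proof.
move=> [bc _]; rewrite /points_of mem_enum; case: ifPn => //.
by rewrite mem_Vs negbK => /bc.
Qed.

Lemma gfac_weight c w : w \in Vs -> gfac par rho rhob beta w (tt c w) = weight isD beta c w.
Proof.
by move=> wV; rewrite /gfac /weight /times_of mem_enum wV; case: (isD w).
Qed.

Lemma time_elapsed tau c w : w \in Vs -> (isr (par w) -> tau w = t0 (par w)) ->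
  tt c (par w) - tt c w = elapsed par rho rhob isD tau c w.
Proof.
move=> wV tw; rewrite /elapsed /ptime /times_of !mem_enum wV mem_Vs.
by case: ifPn => [pr|]; [rewrite (negbTE (parent_not_Dirac wV)) (negbTE pr)|rewrite negbK => pr; rewrite pr tw].
Qed.

Lemma root_elapsed tau c w p : w \in Vs -> isr (par w) -> tau w = p ->
  p - tt c w = elapsed par rho rhob isD tau c w.
Proof. by move=> wV pr tw; rewrite /elapsed /ptime /times_of mem_enum wV pr tw. Qed.

Lemma cfac_le c e : based c -> e \in C ->
  ((cfac a (xx c) e)%:E <= S (a e) (dinf (vecn c (eu e) - vecn c (ev e))))%E.
Proof.
move=> bc eC; rewrite /cfac enum_edge// !points_vec// /S.
case: ifPn => [_|d0]; first exact: leey.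
rewrite lee_fin; apply: powR_le_neg; last by case/andP: (an eC).
  by rewrite lt_def d0 dinf_ge0.
exact: tnorm_ge_dinf.
Qed.

Lemma cfac_ge0 c e : 0 <= cfac a (xx c) e.
Proof. by rewrite /cfac; case: (enum e) => [|u [|v []]] //; exact: powR_ge0. Qed.

Lemma gfac_ge0 w t : 0 <= gfac par rho rhob beta w t.
Proof. by rewrite /gfac; case: ifP => // _; case: ifP => // _; exact: powR_ge0. Qed.

Lemma prod_gfac c : \prod_(w : V) gfac par rho rhob beta w (tt c w) =
  (gfac par rho rhob beta rho (t0 rho) * gfac par rho rhob beta rhob (t0 rhob)) *
  \prod_(w <- enum Vs) weight isD beta c w.
Proof.
have [rr _ _ _] := forest.
rewrite (bigD1 rho)//= (bigD1 rhob)/=; last by rewrite eq_sym.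
rewrite mulrA /times_of !mem_enum !mem_Vs /is_root !eqxx orbT /=; congr (_ * _).
rewrite big_enum /=; apply: eq_big => w; first by rewrite mem_Vs /is_root negb_or.
move=> /andP[w1 w2]; have wV : w \in Vs by rewrite mem_Vs /is_root negb_or w1.
by rewrite -gfac_weight// /times_of mem_enum wV.
Qed.

(** Distributes the product over the sums. It is an inequality because the choice functions are
    defined on all of V, while the factors at the roots are absent; these are replaced by 1. *)
Lemma prod_sum_le (J : finType) (j0 : J) (F : V -> J -> R) : (forall w j, 0 <= F w j) ->
  \prod_(w <- enum Vs) \sum_j F w j <= \sum_(f : {ffun V -> J}) \prod_(w <- enum Vs) F w (f w).
Proof.
move=> F0.
rewrite big_enum /= big_mkcond /=.
apply: (@le_trans _ _ (\prod_(w : V) \sum_j (if w \in Vs then F w j else 1))).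
  apply: ler_prod => w _; case: ifP => _; first by rewrite sumr_ge0/=.
  rewrite ler01 /= (bigD1 j0)//= lerDl; exact: sumr_ge0.
rewrite bigA_distr_bigA /=; apply: ler_sum => f _.
by rewrite big_enum /= [leRHS]big_mkcond.
Qed.

(** Common to both estimates: a kernel factor is dominated by the majorants for two possible root
    times [T false] and [T true], so the integrand is a sum of majorants over all choices of one
    time per vertex. Only the second estimate makes real use of two times. *)
Lemma integrand_le (T : bool -> V -> R) (kappa D : V -> R) c : based c ->
  (forall w, 0 <= kappa w) -> (forall w, 0 <= D w) ->
  (forall w, w \in Vs -> kappa w <= D w * \sum_(j : bool)
     maj (g w) (elapsed par rho rhob isD (T j) c w) (vecn c (par w) - vecn c w)) ->
  (((\prod_(w : V) gfac par rho rhob beta w (tt c w)) * (\prod_(e in C) cfac a (xx c) e) *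
     \prod_(w in Vs) kappa w)%:E <=
   ((gfac par rho rhob beta rho (t0 rho) * gfac par rho rhob beta rhob (t0 rhob)) *
     \prod_(w in Vs) D w)%:E *
   \sum_(f : {ffun V -> bool}) maj_of (fun w => T (f w) w) c)%E.
Proof.
move=> bc k0 D0 kD.
set G := gfac _ _ _ _ rho _ * _; have G0 : 0 <= G by rewrite mulr_ge0 ?gfac_ge0.
have gE := prod_gfac c; rewrite -/G in gE; clearbody G.
pose P := (\prod_(e <- es) S (a e) (dinf (vecn c (eu e) - vecn c (ev e))))%E.
have P0 : (0 <= P)%E by apply: prode_ge0 => e _; exact: S_ge0.
pose F w j := weight isD beta c w * maj (g w) (elapsed par rho rhob isD (T j) c w) (vecn c (par w) - vecn c w).
have F0 w j : 0 <= F w j by rewrite mulr_ge0 ?weight_ge0 ?maj_ge0.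
have cP : ((\prod_(e in C) cfac a (xx c) e)%:E <= P)%E.
  rewrite prod_EFin /P -big_enum /= (perm_big es)/=; last first.
    by apply: uniq_perm; rewrite ?enum_uniq// => e; rewrite mem_enum es_mem.
  suff [] : (0 <= \prod_(e <- es) (cfac a (xx c) e)%:E)%E /\
      (\prod_(e <- es) (cfac a (xx c) e)%:E <= P)%E by [].
  rewrite /P big_seq [X in _ /\ (_ <= X)%E]big_seq.
  apply: (big_ind2 (fun x y : \bar R => 0 <= x /\ x <= y)%E) => //.
    by move=> x1 x2 y1 y2 [? ?] [? ?]; split; [exact: mule_ge0|exact: lee_pmul].
  by move=> e; rewrite es_mem => eC; rewrite lee_fin cfac_ge0; split=> //; exact: cfac_le.
have cf0 : 0 <= \prod_(e in C) cfac a (xx c) e by apply: prodr_ge0 => e _; exact: cfac_ge0.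
set X := G * (\prod_(w in Vs) D w) * \sum_(f : {ffun V -> bool}) \prod_(w <- enum Vs) F w (f w).
have le1 : \prod_(w : V) gfac par rho rhob beta w (tt c w) * \prod_(w in Vs) kappa w <= X.
  rewrite gE /X -!mulrA; apply: ler_wpM2l => //.
  apply: (@le_trans _ _ (\prod_(w in Vs) D w * \prod_(w <- enum Vs) \sum_j F w j)); last first.
    by apply: ler_wpM2l; [exact: prodr_ge0|exact: (prod_sum_le false)].
  rewrite !big_enum /= -!big_split /=; apply: ler_prod => w wV.
  rewrite mulr_ge0 ?weight_ge0//= /F -mulr_sumr mulrCA.
  by apply: ler_wpM2l; [exact: weight_ge0|exact: kD].
apply: (@le_trans _ _ (X%:E * P)%E).
  rewrite mulrAC EFinM; apply: lee_pmul => //; rewrite lee_fin//.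
  by rewrite mulr_ge0 ?prodr_ge0// => w _; exact: gfac_ge0.
rewrite /X EFinM -muleA; apply: lee_wpmul2l.
  by rewrite lee_fin mulr_ge0// prodr_ge0.
rewrite -sumEFin ge0_sume_distrl; last first.
  by move=> f _; rewrite lee_fin; apply: prodr_ge0 => w _; exact: F0.
by apply: lee_sum.
Qed.

Definition boundC : R := #|{ffun V -> bool}|%:R *
  (spaceC (n := n) C a th * \prod_(w in Vs) tC isD kex vex w).

Lemma spaceC_ge0 : 0 <= spaceC (n := n) C a th.
Proof.
rewrite mulr_ge0 ?prodr_ge0//; first by move=> e /an/andP[_ ?]; exact: kerC_ge0.
by rewrite exprn_ge0// (le_trans ler01)// termC_ge1.
Qed.

Lemma prod_tC_ge0 : 0 <= \prod_(w in Vs) tC isD kex vex w.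
Proof.
apply: prodr_ge0 => w wV; rewrite /tC; have := expP wV; case: ifP => // _ [v1 k1].
exact: betaC_ge0.
Qed.

Lemma boundC_ge0 : 0 <= boundC.
Proof.
rewrite /boundC; apply: mulr_ge0; first exact: ler0n.
by apply: mulr_ge0; [exact: spaceC_ge0|exact: prod_tC_ge0].
Qed.

Lemma vint_bound (F : (V -> R) -> (V -> 'rV[R]_n) -> \bar R) (T : bool -> V -> R) (M B d : R) :
  0 <= M -> 0 <= B ->
  (forall c, based c -> (0 <= F (tt c) (xx c) <=
     M%:E * \sum_(f : {ffun V -> bool}) maj_of (fun w => T (f w) w) c)%E) ->
  (forall j w, w \in Vs -> T j w <= 1) ->
  (forall f : {ffun V -> bool},
     \prod_(w in Vs | isr (par w)) T (f w) w `^ (vex w + kex w + 1) <= B) ->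
  dinf (x0 (tree_root par rho rhob (eu e0)) - x0 (tree_root par rho rhob (ev e0))) = d ->
  (vint (enum Vs) isD F t0 x0 <= (boundC * M * B)%:E * S th d)%E.
Proof.
move=> M0 B0 FM T1 TB dE.
(* A base family that carries the prescribed positions of the roots; its values at integrated
   coordinates are irrelevant. *)
pose c0 (i : V * nat) : R := if i.2 is k.+1 then
  (if insub k : option 'I_n is Some k' then x0 i.1 ord0 k' else 0) else 0.
have c0E v : vecn c0 v = x0 v by apply/rowP => i; rewrite !mxE /c0 /= valK.
have cV i : i \in @coords n V isD (enum Vs) -> i.1 \in Vs.
  move=> /flattenP[s /mapP[v vV ->]]; rewrite mem_enum in vV; rewrite mem_cat /tsw => /orP[].
    by case: ifP => // _; rewrite inE => /eqP ->.
  by move=> /mem_sp ->.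
pose MM (f : {ffun V -> bool}) c := maj_of (fun w => T (f w) w) c.
pose H c := (M%:E * \sum_(f : {ffun V -> bool}) MM f c)%E.
have MM0 (f : {ffun V -> bool}) c : (0 <= MM f c)%E by exact: majorant_ge0.
have mMM (f : {ffun V -> bool}) : fmeas (MM f) by exact: fmeas_majorant.
have S0 c : (0 <= \sum_(f : {ffun V -> bool}) MM f c)%E by apply: sume_ge0.
have H0 c : (0 <= H c)%E by rewrite mule_ge0.
have /andP[_ vI] : (0 <= vint (enum Vs) isD F t0 x0 <= It (@coords n V isD (enum Vs)) H c0)%E.
  apply: vint_le => [||c' ac c01]; [exact: enum_uniq|exact: H0|].
  apply: FM; split=> // r rr; rewrite -c0E; apply/rowP => i; rewrite !mxE ac//.
  by apply/negP => /cV; rewrite /= mem_Vs rr.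
apply: (le_trans vI).
have mS : fmeas (fun c => \sum_(f : {ffun V -> bool}) MM f c)%E.
  by move=> d' T' g' mg; apply: emeasurable_sum => f; exact: mMM.
rewrite /H (It_mull (K := fun=> M%:E) _ S0 mS)//.
rewrite (@It_sum _ _ _ _ _ _ MM0 mMM) [leRHS](_ : _ = (M%:E * \sum_(f : {ffun V -> bool})
   ((spaceC (n := n) C a th * ((\prod_(w in Vs) tC isD kex vex w) * B))%:E * S th d))%E); last first.
  rewrite -ge0_sume_distrl; last first.
    move=> f _; rewrite lee_fin; apply: mulr_ge0; first exact: spaceC_ge0.
    by apply: mulr_ge0 => //; exact: prod_tC_ge0.
  rewrite sumEFin sumr_const muleA -EFinM /boundC -mulr_natl; congr (_%:E * _)%E; ring.
rewrite lee_wpmul2l//; apply: lee_sum => f _.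
have X := It_majorant contr noroot es_mem es_uniq edge_eu_ev an n0 parent_not_Dirac
  th0 thn e0P expP (tau := fun w => T (f w) w) (fun w wV => T1 (f w) w wV) c0.
apply: (le_trans X); rewrite /root_gap !c0E dE; apply: lee_wpmul2r; first exact: S_ge0.
by rewrite lee_fin ler_wpM2l ?spaceC_ge0// ler_wpM2l ?prod_tC_ge0.
Qed.

End VertexIntegralBound.

(** * The exponents in terms of Lambda and the hypotheses on branches *)

Section Exponents.
Context {R : realType} {n : nat} {V : finType}.
Variables (par : V -> V) (rho rhob : V) (C : {set {set V}}) (es : seq {set V}).
Hypothesis forest : is_forest par rho rhob.
Hypothesis contr : is_contr par rho rhob C.
Hypothesis noroot : forall e, e \in C -> (rho \notin e) && (rhob \notin e).
Hypothesis es_mem : es =i C.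
Local Notation Vs := (Vstar rho rhob).
Local Notation isr := (is_root rho rhob).
Local Notation br := (branch par).
Implicit Types (e : {set V}) (u v w : V).
Variables (beta gam kap : V -> R) (k : V -> 'I_n -> nat) (a : {set V} -> R) (e0 : {set V}) (th : R).
Hypothesis a0 : forall e, e \in C -> 0 <= a e.
Hypothesis th0 : 0 <= th.
Hypothesis e0P : th = 0 \/ e0 \in C /\ th <= a e0.
Hypothesis kap0 : forall w, ~~ isr (par w) -> kap w = 0.
Local Notation isD := (isDirac par rho rhob beta).
Local Notation Lam := (Lambda par rho rhob beta gam k C a).
Local Notation low := (lowered a e0 th).

(** [kap] is the part of the exponent of the kernel given up in exchange for a power of |t - s|; it
    vanishes on edges not attached to a root. *)
Definition gexp w : R := gam w - (ksize (k w))%:R / 2 - kap w.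

Local Notation kex := (kexp C es forest a gexp e0 th).
Local Notation vex := (vexp C es forest a gexp beta e0 th).

Lemma lowered_bounds e : e \in C -> 0 <= low e /\ low e <= a e.
Proof.
move=> eC; rewrite /lowered; split; last first.
  by rewrite lerBlDr lerDl; case: (e == e0); rewrite ?mulr1n ?mulr0n.
have [E|_] := eqVneq e e0; last by rewrite mulr0n subr0 a0.
case: e0P => [->|[_ tha]]; first by rewrite mul0rn subr0 a0.
by rewrite mulr1n subr_ge0 E.
Qed.

Lemma LambdaE v : Lam v = \sum_(u in br v) beta u +
   \sum_(u in br v :\ v) (gam u - (ksize (k u))%:R / 2 + 1)
   - 4^-1 * \sum_(l in branch_leaves par rho rhob v) bcoef C a l.
Proof.
rewrite /Lambda /branch_edges [in RHS]big_split /= sumr_const; lra.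
Qed.

Lemma kap_inner v w : v \in Vs -> w \in br v :\ v -> kap w = 0.
Proof.
move=> vV; rewrite in_setD1 => /andP[wv wb]; apply: kap0.
case: (branch_cases wb) => [E|pb]; first by rewrite E eqxx in wv.
by rewrite -mem_Vs (branch_Vs forest vV pb).
Qed.

(** [Lambda] charges a quarter of b at all leaves of the branch, whereas [vexp] only pays the shares
    strictly inside it; [sum_share_branch] measures the difference. No loss [kap] occurs there, as
    no edge inside the branch is attached to a root. *)
Lemma vexp_gt v : v \in Istar par rho rhob ->
  Lam v + setmin (Ccross C (br v)) (fun e => a e / 4) <= vex v.
Proof.
rewrite /Istar finset.in_setD => /andP[rv _].
have vV : v \in Vs by rewrite mem_Vs /is_root; move: rv; rewrite !inE.
have := sum_share_branch forest contr noroot es_mem (fun e eC => (lowered_bounds eC).1)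
  (fun e eC => (lowered_bounds eC).2) vV.
rewrite LambdaE /vexp.
have -> : \sum_(u in br v :\ v) (kex u + 1) = \sum_(u in br v :\ v) (gam u - (ksize (k u))%:R / 2 + 1)
   - \sum_(u in br v :\ v) share C es forest low u.
  rewrite -sumrB; apply: eq_bigr => u ub; rewrite /kexp /gexp (kap_inner vV ub); ring.
lra.
Qed.

Lemma vexp_leaf v : v \in Vs -> v \in leaves par rho rhob -> vex v = beta v.
Proof.
move=> vV vL; rewrite /vexp (leaf_branch forest vL) big_set1.
by rewrite [X in _ + X]big1 ?addr0// => u; rewrite in_setD1 inE => /andP[/negbTE ->].
Qed.

Hypothesis beta_ge : forall v, v \in Lstar par rho rhob -> -1 <= beta v.
Hypothesis kap_lt : forall v, v \in Vs -> ~~ isD v -> kap v < 1 + zval par gam k C a v.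
Hypothesis cond_b : forall v, v \in Istar par rho rhob ->
     -1 < Lam v + setmin (Ccross C (br v)) (fun e => a e / 4).

(** Condition (a), reduced by the loss, gives integrability where the time of w approaches that of
    its parent, and condition (b) at time 0; at a leaf the latter is beta > -1, as the value -1 is
    that of Dirac vertices. *)
Lemma exponents_admissible w : w \in Vs ->
  if isD w then vex w = -1 else -1 < vex w /\ -1 < kex w.
Proof.
move=> wV; have wr : w \notin [set rho; rhob]%SET by move: wV; rewrite mem_Vs /is_root !inE.
case: ifPn => [/andP[]|Dw].
  by rewrite /Lstar finset.in_setD => /andP[_ wL] /eqP <-; exact: vexp_leaf.
split; last first.
  have := share_le forest contr noroot es_mem (fun e eC => (lowered_bounds eC).1)
    (fun e eC => (lowered_bounds eC).2) wV.
  by have := kap_lt wV Dw; rewrite /zval /kexp /gexp; lra.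
have [wL|wL] := boolP (w \in leaves par rho rhob).
  have wLs : w \in Lstar par rho rhob by rewrite /Lstar finset.in_setD wr.
  rewrite vexp_leaf// lt_def beta_ge// andbT.
  by move: Dw; rewrite /isDirac wLs.
have wI : w \in Istar par rho rhob by rewrite /Istar finset.in_setD wr inE.
exact: lt_le_trans (cond_b wI) (vexp_gt wI).
Qed.

(** Here the shares are summed exactly. The edge e0 has one endpoint in each tree and is charged a -
    th instead of a, which returns th/4 at each root. *)
Lemma root_exponent r : isr r ->
  th = 0 \/ \sum_(u in e0 | u \in br r) 1 = 1 :> R ->
  beta r + \sum_(w in children par rho rhob r) (vex w + kex w + 1) =
  Lam r + th / 4 - \sum_(w in children par rho rhob r) kap w.
Proof.
move=> rr e0r.
have kapE : \sum_(u in br r :\ r) kap u = \sum_(w in children par rho rhob r) kap w.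
  rewrite [LHS]big_mkcond [RHS]big_mkcond /=; apply: eq_bigr => u _.
  case: ifPn => [/setD1P[ur ub]|ub]; case: ifPn => // uc.
    rewrite kap0//; apply: contra uc => pr.
    case: (branch_cases ub) => [E|pb]; first by rewrite E eqxx in ur.
    rewrite inE (branch_root forest pr pb) eqxx andbT.
    apply/negP => ru; move: ur; rewrite (branch_root forest ru ub) eqxx.
    by [].
  have [uV pu] := child_Vs uc.
  exfalso; move/negP: ub; apply; rewrite in_setD1 -{2}pu mem_branch_par andbT.
  by apply: contraTneq uV => ->; rewrite mem_Vs rr.
have sh := sum_share_root forest contr noroot es_mem low rr.
have bE := sum_bcoef contr a r.
have lowE : \sum_(e in C) \sum_(u in e | u \in br r) low e / 4 =
    4^-1 * \sum_(e in C) \sum_(u in e | u \in br r) a e - th / 4.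
  have [t0|[e0C tha]] := e0P.
    rewrite t0 mul0r subr0 mulr_sumr; apply: eq_bigr => e _; rewrite mulr_sumr.
    by apply: eq_bigr => u _; rewrite /lowered mul0rn subr0 mulrC.
  rewrite [in LHS](bigD1 e0)//= [in RHS](bigD1 e0)//= mulrDr addrAC; congr (_ + _).
    have -> : \sum_(u in e0 | u \in br r) low e0 / 4 = low e0 / 4 * \sum_(u in e0 | u \in br r) 1.
      by rewrite mulr_sumr; apply: eq_bigr => u _; rewrite mulr1.
    have -> : \sum_(u in e0 | u \in br r) a e0 = a e0 * \sum_(u in e0 | u \in br r) 1.
      by rewrite mulr_sumr; apply: eq_bigr => u _; rewrite mulr1.
    rewrite /lowered eqxx mulr1n; case: e0r => ->; lra.
  rewrite mulr_sumr; apply: eq_bigr => e /andP[_ ee0]; rewrite mulr_sumr.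
  by apply: eq_bigr => u _; rewrite /lowered (negbTE ee0) mulr0n subr0 mulrC.
rewrite sum_children_vexp LambdaE bE -kapE.
rewrite lowE in sh.
have -> : \sum_(u in br r :\ r) (beta u + (kex u + 1)) =
   \sum_(u in br r :\ r) beta u + \sum_(u in br r :\ r) (gam u - (ksize (k u))%:R / 2 + 1)
   - \sum_(u in br r :\ r) kap u - \sum_(u in br r :\ r) share C es forest low u.
  rewrite -big_split -!sumrB; apply: eq_bigr => u _; rewrite /kexp /gexp /=; ring.
have bb : \sum_(u in br r) beta u = beta r + \sum_(u in br r :\ r) beta u.
  rewrite (bigD1 r) ?branch_refl//=; congr (_ + _).
  by apply: eq_bigl => u; rewrite in_setD1 andbC.
rewrite sh bb; lra.
Qed.

End Exponents.

Section EdgeChoice.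
Context {R : realType} {V : finType}.
Variables (par : V -> V) (rho rhob : V) (C : {set {set V}}).
Hypothesis forest : is_forest par rho rhob.
Hypothesis contr : is_contr par rho rhob C.
Local Notation isr := (is_root rho rhob).
Local Notation root_of := (tree_root par rho rhob).
Implicit Types (e : {set V}).

Lemma setmax_attained (T : finType) (S : {set T}) (f : T -> R) (e : T) : e \in S ->
  exists2 e', e' \in S & setmax S f = f e'.
Proof.
move=> eS; rewrite /setmax; case: pickP => [e1 e1S|/(_ e)]; last by rewrite eS.
elim/big_ind: _ => [|x y [u uS ->] [v vS ->]|u uS]; first by exists e1.
  by rewrite /Num.max; case: ifP => _; [exists v|exists u].
by exists u.
Qed.

Lemma root_of_rho u : u \in branch par rho -> root_of u = rho.
Proof. by rewrite /tree_root => ->. Qed.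

Lemma root_of_rhob u : u \in branch par rhob -> root_of u = rhob.
Proof.
by rewrite /tree_root => ub; case: ifPn => // ur; case: (branch_roots_disjoint forest ur ub).
Qed.

(* If no contracting edge joins the two trees, then theta = 0 and e0 is taken to
   be the empty set, whose default endpoints are the two roots. *)
Lemma edge_choice (n : nat) (a : {set V} -> R) (th : R) : (0 < n)%N ->
  (forall e, e \in C -> 0 < a e < n%:R) -> 0 <= th ->
  th <= setmax (Cof C (branch_leaves par rho rhob rho)
                :&: Cof C (branch_leaves par rho rhob rhob)) a ->
  exists (es : seq {set V}) (e0 : {set V}), [/\ es =i C, uniq es, th < n%:R,
    th = 0 \/ ((exists es', es = e0 :: es') /\ e0 \in C /\ th <= a e0) &
    (forall r, isr r -> th = 0 \/ \sum_(u in e0 | u \in branch par r) 1 = 1 :> R) /\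
    ((root_of (eu rho e0) = rho /\ root_of (ev rhob e0) = rhob) \/
     (root_of (eu rho e0) = rhob /\ root_of (ev rhob e0) = rho))].
Proof.
move=> n0 an th0; set X := _ :&: _ => thX.
have [X0|[e1 e1X]] := set_0Vmem X.
  have t0 : th = 0.
    apply/le_anti; rewrite th0 andbT (le_trans thX)// X0 /setmax.
    by case: pickP => // e; rewrite inE.
  exists (enum C), finset.set0; split.
  - by move=> e; rewrite mem_enum.
  - exact: enum_uniq.
  - by rewrite t0 ltr0n.
  - by left.
  - split; first by left.
    left; rewrite /eu /ev enum_set0 /=.
    by rewrite root_of_rho ?root_of_rhob ?branch_refl.
have [e0 e0X E] := setmax_attained a e1X.
rewrite E in thX.
move: e0X; rewrite /X /Cof => /finset.setIP[]; rewrite !inE => /andP[e0C p0] /andP[_ q0].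
have [p pe pr] : exists2 p, p \in e0 & p \in branch par rho.
  move: p0; rewrite -lt0n => /card_gt0P[p]; rewrite !inE => /andP[pe /andP[pb _]].
  by exists p => //; rewrite inE.
have [q qe qr] : exists2 p, p \in e0 & p \in branch par rhob.
  move: q0; rewrite -lt0n => /card_gt0P[q]; rewrite !inE => /andP[qe /andP[qb _]].
  by exists q => //; rewrite inE.
have pq : p != q.
  by apply/eqP => pq; rewrite pq in pr; exact: (branch_roots_disjoint forest pr qr).
have en := enum_edge (rho := rho) (rhob := rhob) contr e0C.
have e0E u : (u \in e0) = (u == p) || (u == q).
  have mE z : (z \in e0) = (z == eu rho e0) || (z == ev rhob e0).
    by rewrite -[z \in e0]mem_enum en !inE.
  move: pe qe pq; rewrite !mE => /orP[] /eqP -> /orP[] /eqP ->; rewrite ?eqxx//.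
  by rewrite orbC.
have /andP[_ a0n] := an e0 e0C.
exists (e0 :: rem e0 (enum C)), e0; split.
- by move=> e; rewrite -(perm_mem (perm_to_rem _)) ?mem_enum.
- by rewrite /= mem_rem_uniq ?enum_uniq// inE eqxx rem_uniq ?enum_uniq.
- exact: le_lt_trans thX a0n.
- by right; split=> //; exists (rem e0 (enum C)).
split.
  move=> r rr; right.
  have one (z : V) : (forall u, (u \in e0) && (u \in branch par r) = (u == z)) ->
      \sum_(u in e0 | u \in branch par r) 1 = 1 :> R.
    by move=> H; rewrite (eq_bigl _ _ H) big_pred1_eq.
  case/orP: rr => /eqP rE; rewrite rE in one *.
    apply: (one p) => u; rewrite e0E; case: (eqVneq u p) => [->|_] /=; first by rewrite pr.
    case: (eqVneq u q) => [->|//] /=; apply/negP => qr'.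
    exact: (branch_roots_disjoint forest qr' qr).
  apply: (one q) => u; rewrite e0E orbC; case: (eqVneq u q) => [->|_] /=; first by rewrite qr.
  case: (eqVneq u p) => [->|//] /=; apply/negP => pr'.
  exact: (branch_roots_disjoint forest pr pr').
have uin : eu rho e0 \in e0 by rewrite -[_ \in e0]mem_enum en mem_head.
have vin : ev rhob e0 \in e0 by rewrite -[_ \in e0]mem_enum en !inE eqxx orbT.
have uv : eu rho e0 != ev rhob e0.
  by have := enum_uniq e0; rewrite en /= inE andbT.
move: uin vin uv; rewrite !e0E.
case/orP => /eqP ->; case/orP => /eqP ->; rewrite ?eqxx// => _.
- by left; split; [exact: root_of_rho|exact: root_of_rhob].
- by right; split; [exact: root_of_rhob|exact: root_of_rho].
Qed.

End EdgeChoice.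

Section TorusNorm.
Context {R : realType} {n : nat}.

Lemma S_le_tnorm (th : R) (x xb : 'rV[R]_n) : 0 <= th ->
  in_cube x -> in_cube xb -> x != xb ->
  (S th (dinf (x - xb)) <= (Num.sqrt n%:R `^ th * tnorm (x - xb) `^ (- th))%:E)%E.
Proof.
move=> th0 cx cxb xxb.
have d0 : dinf (x - xb) != 0 by apply: contraNneq xxb => /dinf_sub_eq0 ->.
have dp : 0 < dinf (x - xb) by rewrite lt_def d0 dinf_ge0.
have tp : 0 < tnorm (x - xb) := lt_le_trans dp (tnorm_ge_dinf _).
have td := tnorm_le_dinf (x - xb).
have sn : 0 < Num.sqrt (n%:R : R).
  by have := lt_le_trans tp td; rewrite pmulr_lgt0.
rewrite /S (negbTE d0) lee_fin.
have := powR_le_neg tp td th0; rewrite (powRM _ (ltW sn) (ltW dp)) => H.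
have {}H := ler_wpM2l (powR_ge0 (Num.sqrt n%:R) th) H.
apply: le_trans H; rewrite mulrA -powRD ?subrr ?powRr0 ?mul1r//.
by rewrite lt0r_neq0 ?implybT.
Qed.

Lemma cube_diff (u v : 'rV[R]_n) i : in_cube u -> in_cube v -> `|(u - v) ord0 i| <= 1.
Proof.
move=> /(_ i)/andP[u0 u1] /(_ i)/andP[v0 v1]; rewrite !mxE ler_norml; lra.
Qed.

End TorusNorm.

Section PowerProducts.
Context {R : realType}.

(** The base will be t - s and may be 0. Nonnegative exponents then have sum 0 only if all vanish,
    in which case both sides are 1. *)
Lemma prod_powR_nneg (I : finType) (P : pred I) (r : R) (f : I -> R) : 0 <= r ->
  (forall i, P i -> 0 <= f i) ->
  \prod_(i | P i) r `^ (f i) = r `^ (\sum_(i | P i) f i).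
Proof.
move=> r0 f0; suff [] : 0 <= \sum_(i | P i) f i /\
  \prod_(i | P i) r `^ (f i) = r `^ (\sum_(i | P i) f i) by [].
elim/big_rec2: _ => [|i x y Pi [x0 ->]]; first by rewrite powRr0.
have fi := f0 i Pi; split; first by rewrite addr_ge0.
have [s0|sN] := eqVneq (f i + x) 0; last by rewrite powRD// (negbTE sN).
have -> : f i = 0 by lra.
have -> : x = 0 by lra.
by rewrite addr0 powRr0 mulr1.
Qed.

End PowerProducts.

(** * The two kernel integrals *)

Section KernelIntegrals.
Context {R : realType} {n : nat} {V : finType}.
Variables (par : V -> V) (rho rhob : V) (C : {set {set V}}) (es : seq {set V}).
Hypothesis forest : is_forest par rho rhob.
Hypothesis contr : is_contr par rho rhob C.
Hypothesis noroot : forall e, e \in C -> (rho \notin e) && (rhob \notin e).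
Hypothesis es_mem : es =i C.
Hypothesis es_uniq : uniq es.
Local Notation Vs := (Vstar rho rhob).
Local Notation isr := (is_root rho rhob).
Local Notation br := (branch par).
Local Notation chil := (children par rho rhob).
Implicit Types (e : {set V}) (u v w : V).
Variables (beta gam : V -> R) (k : V -> 'I_n -> nat) (a : {set V} -> R) (e0 : {set V}) (th : R).
Local Notation isD := (isDirac par rho rhob beta).
Local Notation Lam := (Lambda par rho rhob beta gam k C a).
Hypothesis a0n : forall e, e \in C -> 0 <= a e < n%:R.
Hypothesis n0 : (0 < n)%N.
Hypothesis beta_ge : forall v, v \in Lstar par rho rhob -> -1 <= beta v.
Hypothesis cond_a : forall v, v \in Vs -> ~~ isD v -> -1 < zval par gam k C a v.
Hypothesis cond_b : forall v, v \in Istar par rho rhob ->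
     -1 < Lam v + setmin (Ccross C (br v)) (fun e => a e / 4).
Hypothesis th0 : 0 <= th.
Hypothesis thn : th < n%:R.
Hypothesis e0P : th = 0 \/ ((exists es', es = e0 :: es') /\ e0 \in C /\ th <= a e0).
Hypothesis e0_sum : forall r, isr r -> th = 0 \/ \sum_(u in e0 | u \in br r) 1 = 1 :> R.
Hypothesis e0_roots :
  (tree_root par rho rhob (eu rho e0) = rho /\ tree_root par rho rhob (ev rhob e0) = rhob) \/
  (tree_root par rho rhob (eu rho e0) = rhob /\ tree_root par rho rhob (ev rhob e0) = rho).

Lemma gap_dinf (x0 : V -> 'rV[R]_n) :
  dinf (x0 (tree_root par rho rhob (eu rho e0)) - x0 (tree_root par rho rhob (ev rhob e0))) =
  dinf (x0 rho - x0 rhob).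
Proof. by case: e0_roots => -[-> ->] //; rewrite -dinfN opprB. Qed.

Lemma init_rho (T : Type) (d p q : T) : init rho rhob d p q rho = p.
Proof. by have [rr _ _ _] := forest; rewrite /init /upd (negbTE rr) eqxx. Qed.

Lemma init_rhob (T : Type) (d p q : T) : init rho rhob d p q rhob = q.
Proof. by rewrite /init /upd eqxx. Qed.

Lemma init_root (T : Type) (d p q : T) (P : T -> Prop) r : isr r -> P p -> P q ->
  P (init rho rhob d p q r).
Proof. by move=> /orP[] /eqP -> ? ?; rewrite ?init_rho ?init_rhob. Qed.

Section Configuration.
Variables (t0 : V -> R) (x0 : V -> 'rV[R]_n) (c : V * nat -> R).
Hypothesis x0_cube : forall r, isr r -> in_cube (x0 r).
Hypothesis bc : based par rho rhob beta x0 c.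

Lemma based_cube v : in_cube (points_of x0 (enum Vs) c v).
Proof.
rewrite /points_of mem_enum; case: ifPn => [vV i|]; last by rewrite mem_Vs negbK => /x0_cube.
rewrite mxE; apply: bc.2; apply/flattenP; exists (tsw isD v ++ @sp n V v).
  by apply: map_f; rewrite mem_enum.
by rewrite mem_cat; apply/orP; right; apply/mapP; exists (val i) => //; rewrite mem_iota add0n ltn_ord.
Qed.

Lemma based_time w : w \in Vs -> 0 <= times_of isD t0 (enum Vs) c w < 1.
Proof.
move=> wV; rewrite /times_of mem_enum wV; case: ifPn => Dw; first by rewrite lexx ltr01.
apply: bc.2; apply/flattenP; exists (tsw isD w ++ @sp n V w).
  by apply: map_f; rewrite mem_enum.
by rewrite mem_cat /tsw (negbTE Dw) mem_head.
Qed.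

Lemma based_diff u v i :
  `|(points_of x0 (enum Vs) c u - points_of x0 (enum Vs) c v) ord0 i| <= 1.
Proof. by apply: cube_diff; exact: based_cube. Qed.

Lemma based_time_par w : w \in Vs -> (forall r, isr r -> t0 r <= 1) ->
  times_of isD t0 (enum Vs) c (par w) - times_of isD t0 (enum Vs) c w <= 1.
Proof.
move=> wV t01; have /andP[w0 _] := based_time wV.
apply: (@le_trans _ _ (times_of isD t0 (enum Vs) c (par w))); first by rewrite lerBlDr lerDl.
have [pV|pV] := boolP (par w \in Vs); first by have /andP[_ /ltW] := based_time pV.
by rewrite /times_of mem_enum (negbTE pV); apply: t01; rewrite mem_Vs negbK in pV.
Qed.

End Configuration.

Section WithLoss.
Variable kap : V -> R.
Hypothesis kap0 : forall w, ~~ isr (par w) -> kap w = 0.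
Hypothesis kap_lt : forall v, v \in Vs -> ~~ isD v -> kap v < 1 + zval par gam k C a v.
Local Notation g := (gexp gam kap k).
Local Notation kex := (kexp C es forest a g e0 th).
Local Notation vex := (vexp C es forest a g beta e0 th).

Lemma exponents_ok w : w \in Vs -> if isD w then vex w = -1 else -1 < vex w /\ -1 < kex w.
Proof.
apply: exponents_admissible => //; first by move=> e /a0n/andP[].
by case: e0P => [|[_ ?]]; [left|right].
Qed.

Lemma root_power r t : isr r -> 0 < t ->
  gfac par rho rhob beta r t * t `^ (\sum_(w in chil r) (vex w + kex w + 1)) =
  t `^ (Lam r + th / 4 - \sum_(w in chil r) kap w).
Proof.
move=> rr tp; have e0P' : th = 0 \/ e0 \in C /\ th <= a e0.
  by case: e0P => [|[_ ?]]; [left|right].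
rewrite -(root_exponent forest contr noroot es_mem beta gam k e0P' kap0 rr (e0_sum rr)).
rewrite powRD; last by rewrite lt0r_neq0 ?implybT.
congr (_ * _); rewrite /gfac tp; case: ifPn => // /andP[].
by rewrite /Lstar finset.in_setD !inE -/(is_root rho rhob r) rr.
Qed.

End WithLoss.

Lemma big_roots (idx : R) (op : Monoid.com_law idx) (f : V -> R) :
  \big[op/idx]_(w in Vs | isr (par w)) f w =
  op (\big[op/idx]_(w in chil rho) f w) (\big[op/idx]_(w in chil rhob) f w).
Proof.
have [rr _ _ _] := forest.
rewrite (bigID (fun w => par w == rho)) /=; congr (op _ _); apply: eq_bigl => w.
  by rewrite mem_Vs inE /is_root; case: (par w == rho); rewrite ?andbT ?andbF.
rewrite mem_Vs inE /is_root; case: (eqVneq (par w) rho) => [->|_].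
  by rewrite (negbTE rr) ?andbF.
by rewrite andbT.
Qed.

Lemma I_bound : exists c : R, forall (t tb : R) (x xb : 'rV[R]_n),
  0 < t < 1 -> 0 < tb < 1 -> in_cube x -> in_cube xb -> x != xb ->
  (Ival par rho rhob beta gam k C a t tb x xb
    <= (c * t `^ (Lam rho + th / 4) * tb `^ (Lam rhob + th / 4)
          * tnorm (x - xb) `^ (- th))%:E)%E.
Proof.
have [rr _ _ _] := forest.
have /choice[Ck CkP] w : exists Cw : R, 0 <= Cw /\ forall (r : R) (y : 'rV[R]_n), r <= 1 ->
    (forall i, `|y ord0 i| <= 1) ->
    `|kfac (gam w) (k w) r y| <= Cw * maj (gam w - (ksize (k w))%:R / 2) r y.
  by have [Cw C0 H] := kfac_bound (n := n) (gam w) (k w); exists Cw.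
pose kap : V -> R := fun=> 0.
have kap0 w : ~~ isr (par w) -> kap w = 0 by [].
have kapl v : v \in Vs -> ~~ isD v -> kap v < 1 + zval par gam k C a v.
  by move=> vV Dv; have := cond_a vV Dv; rewrite /kap; lra.
have expP := exponents_ok kap0 kapl.
have rp := root_power kap0.
set vex := vexp _ _ _ _ _ _ _ _ in expP rp; set kex := kexp _ _ _ _ _ _ _ in expP rp.
have e0P' : th = 0 \/ (exists es', es = e0 :: es') /\ th <= a e0.
  by case: e0P => [|[? [? ?]]]; [left|right].
pose Kb := boundC (n := n) C es forest a beta (gexp gam kap k) e0 th.
have Kb0 : 0 <= Kb by exact: boundC_ge0.
have PC0 : 0 <= \prod_(w in Vs) Ck w by apply: prodr_ge0 => w _; case: (CkP w).
exists (Kb * \prod_(w in Vs) Ck w * Num.sqrt n%:R `^ th).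
move=> t tb x xb /andP[tp t1] /andP[tbp tb1] cx cxb xxb.
(* No difference of kernels occurs here: both choices of [j] give the same time, and the second
   majorant is merely added. *)
pose T (j : bool) w := if par w == rho then t else tb.
pose t0 := init rho rhob 0 t tb; pose x0 := init rho rhob 0 x xb.
have x0c r : isr r -> in_cube (x0 r) by move=> ir; exact: (@init_root _ 0 x xb in_cube).
have t0c r : isr r -> t0 r <= 1 by move=> ir; apply: (@init_root _ 0 t tb (fun r => r <= 1)) => //; exact: ltW.
have t0r : t0 rho = t by exact: init_rho.
have t0rb : t0 rhob = tb by exact: init_rhob.
pose G := gfac par rho rhob beta rho t * gfac par rho rhob beta rhob tb.
have G0 : 0 <= G by rewrite mulr_ge0 ?gfac_ge0.
pose B := t `^ (\sum_(w in chil rho) (vex w + kex w + 1)) *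
  tb `^ (\sum_(w in chil rhob) (vex w + kex w + 1)).
have B0 : 0 <= B by rewrite mulr_ge0 ?powR_ge0.
have main : (Ival par rho rhob beta gam k C a t tb x xb <=
    (Kb * (G * \prod_(w in Vs) Ck w) * B)%:E * S th (dinf (x - xb)))%E.
  apply: (vint_bound contr noroot es_mem es_uniq a0n n0 th0 thn e0P' expP (T := T)) => //.
  - by rewrite mulr_ge0.
  - move=> c bc; apply/andP; split.
      rewrite lee_fin /Iintegrand !mulr_ge0//; apply: prodr_ge0 => i _ //.
        exact: gfac_ge0.
      exact: cfac_ge0.
    have := integrand_le forest contr es_mem es_uniq a0n t0 (T := T) (g := gexp gam kap k)
      (kappa := fun w => `| kfac (gam w) (k w)
         (times_of isD t0 (enum Vs) c (par w) - times_of isD t0 (enum Vs) c w)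
         (points_of x0 (enum Vs) c (par w) - points_of x0 (enum Vs) c w) |) (D := Ck) bc.
    rewrite /Iintegrand t0r t0rb; apply => //.
      by move=> w; case: (CkP w).
    move=> w wV; have [C0 CP] := CkP w.
    apply: (le_trans (CP _ _ (based_time_par bc wV t0c) (based_diff x0c bc _ _))).
    apply: ler_wpM2l => //; rewrite !(points_vec _ bc).
    rewrite (time_elapsed (tau := T false) beta c wV); last first.
      by rewrite /T => /orP[] /eqP ->; rewrite /t0 ?eqxx ?init_rho ?init_rhob// eq_sym (negbTE rr).
    rewrite /gexp /kap subr0 (bigD1 false)//= lerDl.
    by apply: sumr_ge0 => j _; exact: maj_ge0.
  - by move=> j w _; rewrite /T; case: ifP => _; exact: ltW.
  - move=> f; rewrite big_roots /B !powR_sum//.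
    rewrite le_eqVlt; apply/orP; left; apply/eqP; congr (_ * _); apply: eq_bigr => w wc.
      by rewrite /T; have [_ ->] := child_Vs wc; rewrite eqxx.
    by rewrite /T; have [_ ->] := child_Vs wc; rewrite eq_sym (negbTE rr).
  - by rewrite gap_dinf init_rho init_rhob.
apply: (le_trans main).
have KG0 : 0 <= Kb * (G * \prod_(w in Vs) Ck w) * B.
  by apply: mulr_ge0 => //; apply: mulr_ge0 => //; exact: mulr_ge0.
apply: (le_trans (lee_wpmul2l _ (S_le_tnorm th0 cx cxb xxb))); first by rewrite lee_fin.
rewrite -EFinM lee_fin.
have rho_root : isr rho by rewrite /is_root eqxx.
have rhob_root : isr rhob by rewrite /is_root eqxx orbT.
have kz r : \sum_(w in chil r) kap w = 0 by rewrite big1.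
have := rp rhob tb rhob_root tbp; have := rp rho t rho_root tp.
rewrite !kz !subr0 => <- <-; rewrite /G /B.
have regroup (K u v P p q s d : R) :
    K * (u * v * P) * (p * q) * (s * d) = K * P * s * (u * p) * (v * q) * d by ring.
by rewrite regroup.
Qed.

Lemma prod_partition3 (U W : {set V}) (f1 f2 f3 : V -> R) :
  U \subset W -> W \subset Vs ->
  (\prod_(w in Vs :\: W) f1 w) * (\prod_(w in W :\: U) f2 w) * (\prod_(w in U) f3 w) =
  \prod_(w in Vs) (if w \in U then f3 w else if w \in W then f2 w else f1 w).
Proof.
move=> /fintype.subsetP UW /fintype.subsetP WV.
rewrite [RHS](bigID (mem W)) /= -mulrA [LHS]mulrC; congr (_ * _); last first.
  rewrite (eq_bigl (fun w => (w \in Vs) && (w \notin W))); last first.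
    by move=> w; rewrite finset.in_setD andbC.
  apply: eq_bigr => w /andP[_ wW]; rewrite (negbTE wW) ifN//.
  by apply: contra wW; exact: UW.
rewrite [RHS](bigID (mem U)) /= [LHS]mulrC; congr (_ * _).
  apply: eq_big => w; last by move=> ->.
  by case: (boolP (w \in U)) => [wU|]; rewrite ?andbF// (WV _ (UW _ wU)) (UW _ wU).
apply: eq_big => w.
  by rewrite finset.in_setD; case: (boolP (w \in W)) => [/WV ->|]; rewrite ?andbF ?andbT//.
by rewrite finset.in_setD => /andP[/negbTE -> ->].
Qed.

Lemma sum_indicator (U X : {set V}) (kp : R) : (#|U :&: X| <= 1)%N ->
  \sum_(w in X) (if w \in U then kp else 0) = kp * (#|U :&: X| == 1)%N%:R.
Proof.
move=> c1; rewrite -big_mkcondr /=.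
have -> : \sum_(w in X | w \in U) kp = kp *+ #|U :&: X|.
  by rewrite -sumr_const; apply: eq_bigl => w; rewrite finset.in_setI andbC.
by move: c1; case: #|_| => [|[|m]] //= _; rewrite ?mulr0n ?mulr1n ?mulr0 ?mulr1.
Qed.

(** The factors (t - s)^kap multiply to |t - s|^zeta, because [kap] is supported on U, which has at
    most one vertex below each root. All root times that occur lie between t/2 and t, as t <= 2 s,
    so their powers are comparable to powers of t whatever the sign of the exponents. *)
Lemma K_bound (U W : {set V}) (kap1 kap2 : R) :
  U \subset W -> W \subset chil rho :|: chil rhob ->
  (#|U :&: chil rho| <= 1)%N -> (#|U :&: chil rhob| <= 1)%N ->
  0 <= kap1 <= 1 -> 0 <= kap2 <= 1 ->
  (forall l, U :&: chil rho = [set l]%SET -> ~~ isD l -> kap1 < 1 + zval par gam k C a l) ->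
  (forall l, U :&: chil rhob = [set l]%SET -> ~~ isD l -> kap2 < 1 + zval par gam k C a l) ->
  let zeta := kap1 * (#|U :&: chil rho| == 1)%N%:R + kap2 * (#|U :&: chil rhob| == 1)%N%:R in
  exists c : R, forall (t s : R) (x xb : 'rV[R]_n),
    0 < s -> s <= t -> t <= 2 * s -> t < 1 -> in_cube x -> in_cube xb -> x != xb ->
    (Kval par rho rhob beta gam k C a W U t x xb s
      <= (c * `|t - s| `^ zeta * t `^ (Lam rho + Lam rhob + th / 2 - zeta)
            * tnorm (x - xb) `^ (- th))%:E)%E.
Proof.
move=> UW Wch U1 U2 k1 k2 kl1 kl2 zeta.
have [rr _ _ _] := forest.
have rho_root : isr rho by rewrite /is_root eqxx.
have rhob_root : isr rhob by rewrite /is_root eqxx orbT.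
have Wpar w : w \in W -> w \in Vs /\ isr (par w).
  by move/(fintype.subsetP Wch); rewrite finset.in_setU => /orP[] /child_Vs[-> ->].
have WV : W \subset Vs by apply/fintype.subsetP => w /Wpar[].
have Upar w : w \in U -> w \in Vs /\ isr (par w) by move/(fintype.subsetP UW)/Wpar.
pose kap w : R := if w \in U then (if par w == rho then kap1 else kap2) else 0.
have kap0 w : ~~ isr (par w) -> kap w = 0.
  by rewrite /kap; case: ifP => // /Upar[_ ->].
have kap01 w : 0 <= kap w <= 1.
  by rewrite /kap; case: ifP => _; [case: ifP|rewrite lexx ler01].
have kapl v : v \in Vs -> ~~ isD v -> kap v < 1 + zval par gam k C a v.
  move=> vV Dv; have za := cond_a vV Dv; rewrite /kap; case: ifPn => [vU|_]; last by lra.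
  (* Since U contains at most one child of r, it contains only v among them, and the hypothesis on
     the loss applies to v. *)
  have single (r : V) : par v == r -> isr r -> (#|U :&: chil r| <= 1)%N -> U :&: chil r = [set v]%SET.
    move=> pr ir c1; have vin : v \in U :&: chil r by rewrite finset.in_setI vU inE -mem_Vs vV.
    by apply/esym/eqP; rewrite eqEcard finset.sub1set vin cards1.
  case: ifPn => pr; first by apply: kl1 => //; exact: single.
  apply: kl2 => //; apply: single => //.
  by have [_] := Upar v vU; rewrite /is_root (negbTE pr).
have expP := exponents_ok kap0 kapl.
have rp := root_power kap0.
set vex := vexp _ _ _ _ _ _ _ _ in expP rp; set kex := kexp _ _ _ _ _ _ _ in expP rp.
have e0P' : th = 0 \/ (exists es', es = e0 :: es') /\ th <= a e0.
  by case: e0P => [|[? [? ?]]]; [left|right].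
pose Kb := boundC (n := n) C es forest a beta (gexp gam kap k) e0 th.
have Kb0 : 0 <= Kb by exact: boundC_ge0.
have kz1 : \sum_(w in chil rho) kap w = kap1 * (#|U :&: chil rho| == 1)%N%:R.
  rewrite -(sum_indicator _ U1); apply: eq_bigr => w /child_Vs[_ pw].
  by rewrite /kap pw eqxx.
have kz2 : \sum_(w in chil rhob) kap w = kap2 * (#|U :&: chil rhob| == 1)%N%:R.
  rewrite -(sum_indicator _ U2); apply: eq_bigr => w /child_Vs[_ pw].
  by rewrite /kap pw eq_sym (negbTE rr).
have kapz : \sum_(w in Vs) kap w = zeta.
  rewrite (bigID (fun w => isr (par w))) /= [X in _ + X]big1 ?addr0; last by move=> w /andP[_ /kap0].
  by rewrite (big_roots +%R) kz1 kz2.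
have /choice[Ck CkP] w : exists Cw : R, 0 <= Cw /\ forall (r : R) (y : 'rV[R]_n), r <= 1 ->
    (forall i, `|y ord0 i| <= 1) ->
    `|kfac (gam w) (k w) r y| <= Cw * maj (gam w - (ksize (k w))%:R / 2) r y.
  by have [Cw C0 H] := kfac_bound (n := n) (gam w) (k w); exists Cw.
have /choice[Cd CdP] w : exists Cw : R, 0 <= Cw /\ forall (r r' : R) (y : 'rV[R]_n), r' <= r ->
    r <= 1 -> (forall i, `|y ord0 i| <= 1) ->
    `|kfac (gam w) (k w) r y - kfac (gam w) (k w) r' y| <= Cw * (r - r') `^ kap w *
      (maj (gexp gam kap k w) r y + maj (gexp gam kap k w) r' y).
  by have [Cw C0 H] := kfac_diff (n := n) (gam w) (k w) (kap01 w); exists Cw.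
pose Cm w := Ck w + Cd w.
have Cm0 w : 0 <= Cm w by rewrite addr_ge0//; [case: (CkP w)|case: (CdP w)].
have CkCm w : Ck w <= Cm w by rewrite lerDl; case: (CdP w).
have CdCm w : Cd w <= Cm w by rewrite lerDr; case: (CkP w).
have PC0 : 0 <= \prod_(w in Vs) Cm w by apply: prodr_ge0 => w _; exact: Cm0.
pose ex w := vex w + kex w + 1.
pose P2 : R := \prod_(w in Vs | isr (par w)) 2 `^ `|ex w|.
have P20 : 0 <= P2 by apply: prodr_ge0 => w _; exact: powR_ge0.
exists (Kb * \prod_(w in Vs) Cm w * P2 * Num.sqrt n%:R `^ th).
move=> t s x xb sp st ts2 t1 cx cxb xxb.
have tp : 0 < t := lt_le_trans sp st.
have ts0 : 0 <= t - s by rewrite subr_ge0.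
(* On U the index [j] selects one of the two kernels of the difference; on the rest of W the root
   time is s, and elsewhere t. *)
pose T (j : bool) w := if w \in U then (if j then t else s) else if w \in W then s else t.
have Tts j w : t / 2 <= T j w <= t.
  by rewrite /T; case: ifP => _; case: ifP => _; apply/andP; split; lra.
pose t0 := init rho rhob 0 t t; pose x0 := init rho rhob 0 x xb.
have x0c r : isr r -> in_cube (x0 r) by move=> ir; exact: (@init_root _ 0 x xb in_cube).
have t0t r : isr r -> t0 r = t by move=> ir; apply: (@init_root _ 0 t t (fun r => r = t)).
have t0c r : isr r -> t0 r <= 1 by move=> ir; rewrite t0t// ltW.
pose G := gfac par rho rhob beta rho t * gfac par rho rhob beta rhob t.
have G0 : 0 <= G by rewrite mulr_ge0 ?gfac_ge0.
pose D w := Cm w * (t - s) `^ kap w.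
have D0 w : 0 <= D w by rewrite mulr_ge0 ?powR_ge0.
have DE : \prod_(w in Vs) D w = \prod_(w in Vs) Cm w * (t - s) `^ zeta.
  rewrite big_split /= prod_powR_nneg ?kapz// => w _.
  by case/andP: (kap01 w).
pose B := P2 * (t `^ (\sum_(w in chil rho) ex w) * t `^ (\sum_(w in chil rhob) ex w)).
have B0 : 0 <= B by rewrite !mulr_ge0 ?powR_ge0.
have main : (Kval par rho rhob beta gam k C a W U t x xb s <=
    (Kb * (G * \prod_(w in Vs) D w) * B)%:E * S th (dinf (x - xb)))%E.
  apply: (vint_bound contr noroot es_mem es_uniq a0n n0 th0 thn e0P' expP (T := T)) => //.
  - by rewrite mulr_ge0// prodr_ge0.
  - move=> c bc; apply/andP; split; first by rewrite lee_fin normr_ge0.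
    set tt := times_of isD t0 (enum Vs) c; set xx := points_of x0 (enum Vs) c.
    pose kappa w := `| if w \in U then
        kfac (gam w) (k w) (t - tt w) (xx (par w) - xx w) -
        kfac (gam w) (k w) (s - tt w) (xx (par w) - xx w)
      else if w \in W then kfac (gam w) (k w) (s - tt w) (xx (par w) - xx w)
      else kfac (gam w) (k w) (tt (par w) - tt w) (xx (par w) - xx w) |.
    have -> : Kintegrand par rho rhob beta gam k C a t s W U tt xx =
        (\prod_(w : V) gfac par rho rhob beta w (tt w)) * (\prod_(e in C) cfac a (xx) e) *
        \prod_(w in Vs) kappa w.
      rewrite /Kintegrand.
      have regroup (u v p q r : R) : u * v * p * q * r = u * v * (p * q * r) by ring.
      rewrite regroup prod_partition3// normrM normr_prod ger0_norm//.
      by rewrite mulr_ge0//; apply: prodr_ge0 => i _; [exact: gfac_ge0|exact: cfac_ge0].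
    have := integrand_le forest contr es_mem es_uniq a0n t0 (T := T) (g := gexp gam kap k)
      (kappa := kappa) (D := D) bc.
    rewrite (t0t _ rho_root) (t0t _ rhob_root).
    apply; [by move=> w; exact: normr_ge0|exact: D0|].
    move=> w wV; have [_ CP] := CkP w; have [_ DP] := CdP w.
    have y1 := based_diff x0c bc (par w) w.
    have w01 : 0 <= tt w < 1 := based_time t0 bc wV.
    rewrite -!(points_vec _ bc) -/xx /kappa.
    have mono (x1 y z : R) : x1 <= Ck w * y -> 0 <= y -> y <= z -> kap w = 0 -> x1 <= D w * z.
      move=> xy y0 yz kw; rewrite /D kw powRr0 mulr1.
      by apply: (le_trans xy); apply: ler_pM => //; case: (CkP w).
    have maj1 j r : elapsed par rho rhob isD (T j) c w = r ->
        maj (gexp gam kap k w) r (xx (par w) - xx w) <= \sum_(j : bool)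
          maj (gexp gam kap k w) (elapsed par rho rhob isD (T j) c w) (xx (par w) - xx w).
      by move=> <-; rewrite (bigD1 j)//= lerDl; apply: sumr_ge0 => ? _; exact: maj_ge0.
    case: ifPn => [wU|wU].
      have [_ pr] := Upar w wU.
      have E1 : t - tt w = elapsed par rho rhob isD (T true) c w.
        by apply: root_elapsed => //; rewrite /T wU.
      have E2 : s - tt w = elapsed par rho rhob isD (T false) c w.
        by apply: root_elapsed => //; rewrite /T wU.
      have r'r : s - tt w <= t - tt w by rewrite lerD2r.
      have r1 : t - tt w <= 1 by lra.
      apply: (le_trans (DP _ _ _ r'r r1 y1)).
      rewrite (_ : t - tt w - (s - tt w) = t - s); last by ring.
      rewrite big_bool /= E1 E2; apply: ler_wpM2r; first by rewrite addr_ge0 ?maj_ge0.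
      by apply: ler_wpM2r; [exact: powR_ge0|exact: CdCm].
    have kw : kap w = 0 by rewrite /kap (negbTE wU).
    have gE : gam w - (ksize (k w))%:R / 2 = gexp gam kap k w by rewrite /gexp kw subr0.
    rewrite gE in CP.
    case: ifPn => [wW|wW].
      have [_ pr] := Wpar w wW.
      have r1 : s - tt w <= 1 by lra.
      apply: (mono _ _ _ (CP _ _ r1 y1)) => //; first exact: maj_ge0.
      apply: (maj1 false); apply/esym; apply: root_elapsed => //.
      by rewrite /T (negbTE wU) wW.
    apply: (mono _ _ _ (CP _ _ (based_time_par bc wV t0c) y1)) => //; first exact: maj_ge0.
    apply: (maj1 false); apply/esym; apply: time_elapsed => // pr.
    by rewrite /T (negbTE wU) (negbTE wW) t0t.
  - by move=> j w _; have /andP[_ Tt] := Tts j w; rewrite (le_trans Tt)// ltW.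
  - move=> f; rewrite /B !powR_sum// -(big_roots *%R) /P2 -big_split /=.
    by apply: ler_prod => w _; rewrite powR_ge0 /=; exact: powR_half.
  - by rewrite gap_dinf init_rho init_rhob.
apply: (le_trans main).
have KG0 : 0 <= Kb * (G * \prod_(w in Vs) D w) * B.
  apply: mulr_ge0 => //; apply: mulr_ge0 => //; apply: mulr_ge0 => //.
  by apply: prodr_ge0 => w _; exact: D0.
apply: (le_trans (lee_wpmul2l _ (S_le_tnorm th0 cx cxb xxb))); first by rewrite lee_fin.
rewrite -EFinM lee_fin ger0_norm//.
have -> : Lam rho + Lam rhob + th / 2 - zeta =
    (Lam rho + th / 4 - \sum_(w in chil rho) kap w) + (Lam rhob + th / 4 - \sum_(w in chil rhob) kap w).
  by rewrite kz1 kz2 /zeta; lra.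
rewrite powRD; last by rewrite lt0r_neq0 ?implybT.
rewrite -!rp// DE /G /B.
have regroup (K u v P z p2 p q s1 d : R) :
    K * (u * v * (P * z)) * (p2 * (p * q)) * (s1 * d) = K * P * p2 * s1 * z * ((u * p) * (v * q)) * d by ring.
by rewrite regroup.
Qed.

End KernelIntegrals.

Local Close Scope classical_set_scope.

Theorem theorem3p18 (R : realType) (n : nat) (V : finType)
  (par : V -> V) (rho rhob : V)
  (beta gam : V -> R) (k : V -> 'I_n -> nat)
  (C : {set {set V}}) (a : {set V} -> R) :
  is_forest par rho rhob ->
  is_contr par rho rhob C ->
  (* decoration: beta_v >= -1 on L^* *)
  (forall v, v \in Lstar par rho rhob -> -1 <= beta v) ->
  (* no contracting edge is incident to a root *)
  (forall e, e \in C -> (rho \notin e) && (rhob \notin e)) ->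
  (* (a) *)
  (forall v, v \in Vstar rho rhob -> ~~ isDirac par rho rhob beta v ->
     -1 < zval par gam k C a v) ->
  (* (b) *)
  (forall v, v \in Istar par rho rhob ->
     -1 < Lambda par rho rhob beta gam k C a v
          + setmin (Ccross C (branch par v)) (fun e => a e / 4)) ->
  (* (c) *)
  (forall e, e \in C -> 0 < a e < n%:R) ->
  forall theta : R,
    0 <= theta ->
    theta <= setmax (Cof C (branch_leaves par rho rhob rho)
                     :&: Cof C (branch_leaves par rho rhob rhob)) a ->
  (exists c : R, forall (t tb : R) (x xb : 'rV[R]_n),
     0 < t < 1 -> 0 < tb < 1 -> in_cube x -> in_cube xb -> x != xb ->
     (Ival par rho rhob beta gam k C a t tb x xb
       <= (c * powR t (Lambda par rho rhob beta gam k C a rho + theta / 4)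
             * powR tb (Lambda par rho rhob beta gam k C a rhob + theta / 4)
             * powR (tnorm (x - xb)) (- theta))%:E)%E)
  /\
  (forall (U W : {set V}) (kap kapb : R),
     U \subset W ->
     W \subset children par rho rhob rho :|: children par rho rhob rhob ->
     (#|U :&: children par rho rhob rho| <= 1)%N ->
     (#|U :&: children par rho rhob rhob| <= 1)%N ->
     0 <= kap <= 1 -> 0 <= kapb <= 1 ->
     (forall l, U :&: children par rho rhob rho = [set l] ->
        ~~ isDirac par rho rhob beta l -> kap < 1 + zval par gam k C a l) ->
     (forall l, U :&: children par rho rhob rhob = [set l] ->
        ~~ isDirac par rho rhob beta l -> kapb < 1 + zval par gam k C a l) ->
     let zeta := kap * (#|U :&: children par rho rhob rho| == 1)%N%:R
                 + kapb * (#|U :&: children par rho rhob rhob| == 1)%N%:R in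
     exists c : R, forall (t s : R) (x xb : 'rV[R]_n),
       0 < s -> s <= t -> t <= 2 * s -> t < 1 ->
       in_cube x -> in_cube xb -> x != xb ->
       (Kval par rho rhob beta gam k C a W U t x xb s
         <= (c * powR (`|t - s|) zeta
               * powR t (Lambda par rho rhob beta gam k C a rho
                         + Lambda par rho rhob beta gam k C a rhob
                         + theta / 2 - zeta)
               * powR (tnorm (x - xb)) (- theta))%:E)%E).
Proof.
move=> forest contr beta_ge noroot cond_a cond_b a_pos theta theta0 theta_max.
(* In dimension 0 the torus is a single point and no two distinct points exist. *)
have [n0|] := posnP n.
  have triv (x xb : 'rV[R]_n) : x != xb -> False.
    by move=> /eqP; apply; apply/rowP => i; have := ltn_ord i; rewrite [X in (_ < X)%N]n0.
  split; first by exists 0 => t tb x xb _ _ _ _ /triv.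
  by move=> U W kap kapb *; exists 0 => t s x xb _ _ _ _ _ _ /triv.
move=> n0.
have a0n e : e \in C -> 0 <= a e < n%:R by move=> /a_pos/andP[/ltW -> ->].
have [es [e0 [es_mem es_uniq theta_n e0P [e0_sum e0_roots]]]] :=
  edge_choice forest contr n0 a_pos theta0 theta_max.
split; first exact: (I_bound forest contr noroot es_mem es_uniq a0n n0 beta_ge cond_a cond_b
  theta0 theta_n e0P e0_sum e0_roots).
move=> U W kap kapb; exact: (K_bound forest contr noroot es_mem es_uniq a0n n0 beta_ge cond_a cond_b
  theta0 theta_n e0P e0_sum e0_roots).
Qed.
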